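(* Let $n\ge1$ be a fixed integer and let $\omega_n:\Lambda(q)\to\Lambda(q)$ be the semi-linear map determined by $\omega_n(q)=q^{-1}$ and $\omega_n(s_\lambda)=q^{(n-1)|\lambda|}s_{\lambda'}$ for all partitions $\lambda$. Then $\omega_n$ is a $\mathbb{C}$-algebra homomorphism which is an involution, and it maps $\mathcal{G}_{\lambda/\mu}$ to $\mathcal{G}_{(\lambda/\mu)'}$ for every skew shape $\lambda/\mu$.
   Context: $\Lambda(q)=\Lambda\otimes_{\mathbb{C}}\mathbb{C}(q)$ where $\Lambda$ is the ring of symmetric functions over $\mathbb{C}$ in $X=(x_1,x_2,\ldots)$; $s_\lambda$ are the Schur functions. Semi-linear means $\mathbb{C}$-linear with $\omega_n(a(q)f)=a(q^{-1})\omega_n(f)$ for $a(q)\in\mathbb{C}(q)$. $\lambda'$ is the conjugate of $\lambda$ and $(\lambda/\mu)'=\lambda'/\mu'$. Ribbons and ribbon functions: fix $n\ge1$. Partitions are identified with their Young diagrams (first row on top); ''connected'' means connected through edges. A ribbon is a connected skew shape with exactly $n$ squares containing no $2\times 2$ square; its spin is its number of rows minus 1. The spin $s(T)$ of a shape tiled by ribbons is the sum of the spins of its ribbons. A horizontal ribbon strip is a skew shape tiled by ribbons such that the topright-most square of every ribbon touches the northern edge of the shape; such a tiling is unique if it exists. A semistandard ribbon tableau $T$ of shape $\lambda/\mu$ is a chain of partitions $\mu=\mu^0\subset\mu^1\subset\cdots\subset\mu^r=\lambda$ with each $\mu^{i}/\mu^{i-1}$ a (possibly empty) horizontal ribbon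 strip, whose ribbons are labelled $i$; its weight $w(T)$ is the composition whose $i$-th part is the number of ribbons labelled $i$. Put $\mathcal{G}_{\lambda/\mu}=\mathcal{G}_{\lambda/\mu}(X;q)=\sum_T q^{s(T)}\mathbf{x}^{w(T)}$, summed over semistandard ribbon tableaux of shape $\lambda/\mu$ (zero if $\lambda/\mu$ is not tileable by ribbons); this is known to be a symmetric function. *)

(* Defs.v *)
From HB Require Import structures.
From mathcomp Require Import all_boot all_order all_algebra.
From mathcomp Require Import finmap.
From mathcomp Require Import boolp classical_sets reals.
From mathcomp Require Import complex mpoly.

Set Implicit Arguments.
Unset Strict Implicit.
Unset Printing Implicit Defensive.

Import GRing.Theory.
Local Open Scope fset_scope.
Local Open Scope ring_scope.

(* (row, column), both counted from 0, first row on top (English notation). *)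
Definition cell : Type := (nat * nat)%type.

(* For c in row or column 0 the truncated predecessor is c itself. *)
Definition is_diagram (D : {fset cell}) : bool :=
  all (fun c : cell => ((c.1.-1, c.2) \in D) && ((c.1, c.2.-1) \in D)) D.

(* A partition, identified with its Young diagram. *)
Record young := Young { diagram :> {fset cell}; diagramP : is_diagram diagram }.

Definition transpose (S : {fset cell}) : {fset cell} :=
  [fset (c.2, c.1) | c in S].

Lemma mem_transpose (S : {fset cell}) (i j : nat) :
  ((i, j) \in transpose S) = ((j, i) \in S).
Proof.
apply/imfsetP/idP => [[[a b] /= abS [-> ->]] //|jiS].
by exists (j, i).
Qed.

Lemma transpose_diagram (la : young) : is_diagram (transpose la).
Proof.
apply/allP => -[i j] /=; rewrite !mem_transpose => ijD.
by have /allP/(_ _ ijD)/= := diagramP la; rewrite andbC.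
Qed.

Definition conjugate (la : young) : young := Young (transpose_diagram la).

Definition is_skew (S : {fset cell}) : Prop :=
  exists la mu : young, mu `<=` la /\ S = la `\` mu.

(* The two cells share an edge. *)
Definition adjacent (c d : cell) : bool :=
     ((c.1 == d.1) && ((c.2.+1 == d.2) || (d.2.+1 == c.2)))
  || ((c.2 == d.2) && ((c.1.+1 == d.1) || (d.1.+1 == c.1))).

Definition connected_shape (S : {fset cell}) : Prop :=
  forall c d : S, connect (fun a b : S => adjacent (val a) (val b)) c d.

Definition has_square (S : {fset cell}) : Prop :=
  exists i j : nat, [/\ (i, j) \in S, (i, j.+1) \in S,
                        (i.+1, j) \in S & (i.+1, j.+1) \in S].

Definition is_ribbon (n : nat) (S : {fset cell}) : Prop :=
  [/\ is_skew S, connected_shape S, #|` S| = n & ~ has_square S].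

Definition nrows (S : {fset cell}) : nat := #|` [fset c.1 | c in S]|.

Definition spin (S : {fset cell}) : nat := (nrows S).-1.

Definition is_tiling (n : nat) (S : {fset cell}) (P : {fset {fset cell}}) :
    Prop :=
  [/\ forall A, A \in P -> is_ribbon n A,
      forall A B, A \in P -> B \in P -> A <> B -> [disjoint A & B]%fset
    & forall c, c \in S <-> exists2 A, A \in P & c \in A].

Definition toprightmost (A : {fset cell}) (c : cell) : Prop :=
  c \in A /\ forall d, d \in A -> (c.1 <= d.1)%N /\ (d.2 <= c.2)%N.

(* The square c touches the northern edge of S when the square above c is not
   in S. *)
Definition is_horizontal_tiling (n : nat) (S : {fset cell})
    (P : {fset {fset cell}}) : Prop :=
  is_tiling n S P /\
  forall A c, A \in P -> toprightmost A c ->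
    forall i, c.1 = i.+1 -> (i, c.2) \notin S.

Definition is_horizontal_strip (n : nat) (S : {fset cell}) : Prop :=
  is_skew S /\ exists P, is_horizontal_tiling n S P.

(* The tiling of a horizontal ribbon strip is unique, so the value chosen by
   xget is the tiling; off horizontal ribbon strips it is the dummy fset0. *)
Definition strip_tiling (n : nat) (S : {fset cell}) : {fset {fset cell}} :=
  xget fset0 [set P | is_horizontal_tiling n S P]%classic.

(* A family (f_N)_N of polynomials, with f_N in the N variables x_1, ..., x_N
   (0-based 'X_0, ..., 'X_(N-1) below), and the componentwise operations. *)
Definition polyfam (K : comNzRingType) : Type := forall N : nat, {mpoly K[N]}.

Section PolyFam.
Variable K : comNzRingType.
Implicit Types f g h : polyfam K.

HB.instance Definition _ := gen_eqMixin (polyfam K).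
HB.instance Definition _ := gen_choiceMixin (polyfam K).

Definition pf0 : polyfam K := fun N => 0.
Definition pf1 : polyfam K := fun N => 1.
Definition pf_opp f : polyfam K := fun N => - f N.
Definition pf_add f g : polyfam K := fun N => f N + g N.
Definition pf_mul f g : polyfam K := fun N => f N * g N.
Definition pf_scale (a : K) f : polyfam K := fun N => a *: f N.

Lemma polyfamP f g : (forall N, f N = g N) -> f = g.
Proof. exact: functional_extensionality_dep. Qed.

Fact pf_addA : associative pf_add.
Proof. by move=> f g h; apply: polyfamP => N; apply: addrA. Qed.
Fact pf_addC : commutative pf_add.
Proof. by move=> f g; apply: polyfamP => N; apply: addrC. Qed.
Fact pf_add0 : left_id pf0 pf_add.
Proof. by move=> f; apply: polyfamP => N; apply: add0r. Qed.
Fact pf_addN : left_inverse pf0 pf_opp pf_add.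
Proof. by move=> f; apply: polyfamP => N; apply: addNr. Qed.

HB.instance Definition _ :=
  GRing.isZmodule.Build (polyfam K) pf_addA pf_addC pf_add0 pf_addN.

Fact pf_mulA : associative pf_mul.
Proof. by move=> f g h; apply: polyfamP => N; apply: mulrA. Qed.
Fact pf_mulC : commutative pf_mul.
Proof. by move=> f g; apply: polyfamP => N; apply: mulrC. Qed.
Fact pf_mul1 : left_id pf1 pf_mul.
Proof. by move=> f; apply: polyfamP => N; apply: mul1r. Qed.
Fact pf_mulDl : left_distributive pf_mul +%R.
Proof. by move=> f g h; apply: polyfamP => N; apply: mulrDl. Qed.
Fact pf_1neq0 : pf1 != 0.
Proof.
by apply/eqP => /(congr1 (fun f : polyfam K => f 0%N)); apply/eqP/oner_neq0.
Qed.

HB.instance Definition _ := GRing.Zmodule_isComNzRing.Build (polyfam K)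
  pf_mulA pf_mulC pf_mul1 pf_mulDl pf_1neq0.

Fact pf_scaleA a b f : pf_scale a (pf_scale b f) = pf_scale (a * b) f.
Proof. by apply: polyfamP => N; apply: scalerA. Qed.
Fact pf_scale1 : left_id 1 pf_scale.
Proof. by move=> f; apply: polyfamP => N; apply: scale1r. Qed.
Fact pf_scaleDr : right_distributive pf_scale +%R.
Proof. by move=> a f g; apply: polyfamP => N; apply: scalerDr. Qed.
Fact pf_scaleDl f : {morph pf_scale^~ f : a b / a + b}.
Proof. by move=> a b; apply: polyfamP => N; apply: scalerDl. Qed.

HB.instance Definition _ := GRing.Zmodule_isLmodule.Build K (polyfam K)
  pf_scaleA pf_scale1 pf_scaleDr pf_scaleDl.

Fact pf_scaleAl (a : K) f g : a *: (f * g) = (a *: f) * g.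
Proof. by apply: polyfamP => N; apply: scalerAl. Qed.

HB.instance Definition _ := GRing.Lmodule_isLalgebra.Build K (polyfam K)
  pf_scaleAl.
HB.instance Definition _ := GRing.Lalgebra_isComAlgebra.Build K (polyfam K).

Lemma pf_addE f g N : (f + g) N = f N + g N. Proof. by []. Qed.
Lemma pf_mulE f g N : (f * g) N = f N * g N. Proof. by []. Qed.
Lemma pf_scaleE (a : K) f N : (a *: f) N = a *: f N. Proof. by []. Qed.
Lemma pf_1E N : (1 : polyfam K) N = 1. Proof. by []. Qed.

End PolyFam.

(* Setting the last variable to 0. *)
Definition drop_last (K : comNzRingType) (N : nat) (p : {mpoly K[N.+1]}) :
    {mpoly K[N]} :=
  mmap (@mpolyC N K)
    (fun i : 'I_N.+1 => if unlift ord_max i is Some j then 'X_j else 0) p.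

Definition is_symfun (K : comNzRingType) (f : polyfam K) : Prop :=
  [/\ forall N, f N \is symmetric,
      forall N, drop_last (f N.+1) = f N
    & exists d, forall N, (msize (f N) <= d)%N].

Definition symfun_pred (K : comNzRingType) : {pred polyfam K} :=
  fun f => `[< is_symfun f >].

Fact symfun_closed (K : comNzRingType) : subalg_closed (@symfun_pred K).
Proof.
have dlM N (p r : {mpoly K[N.+1]}) :
    drop_last (p * r) = drop_last p * drop_last r by exact: rmorphM.
have dlD N (p r : {mpoly K[N.+1]}) :
    drop_last (p + r) = drop_last p + drop_last r by exact: raddfD.
have dlZ N a (p : {mpoly K[N.+1]}) : drop_last (a *: p) = a *: drop_last p.
  by rewrite /drop_last mmapZ mul_mpolyC.
split.
- apply/asboolP; split=> [N|N|].
  + by rewrite pf_1E rpred1.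
  + by rewrite !pf_1E; apply: rmorph1.
  + by exists 1%N => N; rewrite pf_1E msize1.
- move=> a f g /asboolP[fs fc [df fd]] /asboolP[gs gc [dg gd]].
  apply/asboolP; split=> [N|N|].
  + rewrite pf_addE pf_scaleE. apply: rpredD; [exact/rpredZ/fs | exact: gs].
  + by rewrite !pf_addE !pf_scaleE dlD dlZ fc gc.
  + exists (maxn df dg) => N; rewrite pf_addE pf_scaleE.
    apply: leq_trans (msizeD_le _ _) _.
    rewrite geq_max (leq_trans (gd N) (leq_maxr _ _)) andbT.
    apply: leq_trans (msizeZ_le _ _) _.
    exact: leq_trans (fd N) (leq_maxl _ _).
- move=> f g /asboolP[fs fc [df fd]] /asboolP[gs gc [dg gd]].
  apply/asboolP; split=> [N|N|].
  + by rewrite pf_mulE; apply: rpredM; [exact: fs | exact: gs].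
  + by rewrite !pf_mulE dlM fc gc.
  + exists (df + dg).+1%N => N; rewrite pf_mulE.
    apply: leq_trans (msizeM_le _ _) _.
    by rewrite ltnS leq_add.
Qed.

HB.instance Definition _ (K : comNzRingType) :=
  GRing.isSubalgClosed.Build K (polyfam K) (@symfun_pred K)
    (symfun_closed K).

(* The ring of symmetric functions over K, as the inverse limit, in the
   category of graded rings, of the rings of symmetric polynomials in N
   variables: an element is a compatible family of symmetric polynomials of
   bounded degree. *)
Record symfun (K : comNzRingType) :=
  SymFun { symfun_val :> polyfam K; _ : symfun_val \in @symfun_pred K }.

Section SymFunAlgebra.
Variable K : comNzRingType.
HB.instance Definition _ := [isSub for @symfun_val K].
HB.instance Definition _ := [Choice of symfun K by <:].
HB.instance Definition _ :=
  [SubChoice_isSubComNzRing of symfun K by <:].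
HB.instance Definition _ := [SubZmodule_isSubLmodule of symfun K by <:].
HB.instance Definition _ :=
  [SubNzRing_SubLmodule_isSubLalgebra of symfun K by <:].
HB.instance Definition _ := [SubLalgebra_isSubAlgebra of symfun K by <:].
End SymFunAlgebra.

Definition is_ssyt (la : young) (N : nat) (T : {ffun la -> 'I_N}) : Prop :=
  forall c d : la,
    (((val c).1 = (val d).1 -> (val c).2 < (val d).2 -> T c <= T d)%N
  /\ ((val c).2 = (val d).2 -> (val c).1 < (val d).1 -> T c < T d)%N).

Definition schur (K : comNzRingType) (la : young) : polyfam K :=
  fun N => \sum_(T : {ffun la -> 'I_N} | `[< is_ssyt T >]) \prod_(c : la) 'X_(T c).

(* A semistandard ribbon tableau of shape la/mu with labels in {1, ..., N} is a
   chain mu = T 0 `<=` T 1 `<=` ... `<=` T N = la; step i < N carries the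
   label i + 1 and the variable 'X_i. *)
Definition chain (la : young) (N : nat) := {ffun 'I_N.+1 -> fpowerset la}.

Definition chain_step (la : young) (N : nat) (T : chain la N) (i : 'I_N) :
    {fset cell} :=
  val (T (lift ord0 i)) `\` val (T (widen_ord (leqnSn N) i)).

Definition is_ribbon_tableau (n : nat) (la mu : young) (N : nat)
    (T : chain la N) : Prop :=
  [/\ val (T ord0) = mu, val (T ord_max) = la,
      forall i, is_diagram (val (T i))
    & forall i : 'I_N,
        val (T (widen_ord (leqnSn N) i)) `<=` val (T (lift ord0 i)) /\
        is_horizontal_strip n (chain_step T i)].

Definition tableau_spin (n : nat) (la : young) (N : nat) (T : chain la N) :
    nat :=
  (\sum_(i < N) \sum_(A <- strip_tiling n (chain_step T i)) spin A)%N.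

Definition tableau_weight (n : nat) (la : young) (N : nat) (T : chain la N) :
    'X_{1..N} :=
  [multinom #|` strip_tiling n (chain_step T i)| | i < N].

Definition ribbonG (K : comNzRingType) (q : K) (n : nat) (la mu : young) :
    polyfam K :=
  fun N => \sum_(T : chain la N | `[< is_ribbon_tableau n mu T >])
             q ^+ tableau_spin n T *: 'X_[tableau_weight n T].

Section Semilinear.
Variable R : realType.

Definition Cq : fieldType := {fraction {poly R[i]}}.

Definition constq (c : R[i]) : Cq := tofrac c%:P.

Definition q : Cq := tofrac 'X.

Definition eval_invq (p : {poly R[i]}) : Cq := (map_poly constq p).[q^-1].

(* a(q) |-> a(q^-1), computed on a representative of the fraction a. *)
Definition bar (a : Cq) : Cq :=
  eval_invq \n_(repr a) / eval_invq \d_(repr a).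

(* Symmetric functions over C(q), i.e. the extension of scalars to C(q) of the
   symmetric functions over C. *)
Definition Lambdaq := symfun Cq.

Definition C_linear (w : Lambdaq -> Lambdaq) : Prop :=
  forall (c : R[i]) (f g : Lambdaq),
    w (constq c *: f + g) = constq c *: w f + w g.

Definition semi_linear (w : Lambdaq -> Lambdaq) : Prop :=
  C_linear w /\ forall (a : Cq) (f : Lambdaq), w (a *: f) = bar a *: w f.

Definition C_algebra_hom (w : Lambdaq -> Lambdaq) : Prop :=
  [/\ C_linear w, w 1 = 1 & forall f g, w (f * g) = w f * w g].

(* The families a and b are symmetric functions, and w maps a to b. *)
Definition maps_to (w : Lambdaq -> Lambdaq) (a b : polyfam Cq) : Prop :=
  exists f g : Lambdaq,
    [/\ symfun_val f = a, symfun_val g = b & w f = g].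

Definition is_omega (n : nat) (w : Lambdaq -> Lambdaq) : Prop :=
  [/\ semi_linear w, w q%:A = (q^-1)%:A
    & forall la : young,
        maps_to w (schur Cq la)
          (q ^+ ((n - 1) * #|` la|) *: schur Cq (conjugate la))].

End Semilinear.

(* Main.v *)
(* Encode a partition by the beads of its boundary word: adding an n-ribbon
   moves a bead n places to the right, and its spin is the number of beads
   jumped over. The generating function of horizontal ribbon strips becomes an
   operator H(x), and G_{la/mu} is a matrix coefficient of
   H(x_1) ... H(x_N). Let V(x) be the operator with the moves attempted in the
   opposite order. Then V(-x) is inverse to H(x), and the H(x) commute,
   which is seen by letting two strips act at once while the word is read from
   left to right. Hence the coefficients of H(x_1) ... H(x_N) V(z_1) ... V(z_M) are
   supersymmetric in (x | z), and a supersymmetric function is determined by its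
   restriction to z = (): as a polynomial in z_1 of bounded degree it is known
   at z_1 = - x_i for as many x_i as one likes. So if G_{la/mu} is a polynomial
   in the e_k, the same polynomial in the h_k gives the coefficients of
   V(z_1) ... V(z_M). Conjugation reverses and complements the boundary word,
   which exchanges H and V, replaces q by 1/q and rescales x by q^(n-1); this is
   the claim for the map sending e_k to q^((n-1)k) h_k and q to 1/q. The case
   n = 1, q = 1 shows that this map has the prescribed values on Schur
   functions, and these span. *)

Require Import Defs.
From HB Require Import structures.
From mathcomp Require Import fingroup perm all_boot all_order all_algebra.
From mathcomp Require Import finmap.
From mathcomp Require Import boolp classical_sets reals.
From mathcomp Require Import complex mpoly.
From mathcomp Require Import zify ring.
(* Again, so that [is_skew] is not the notion of sesquilinear forms. *)
Require Import Defs.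

Set Implicit Arguments.
Unset Strict Implicit.
Unset Printing Implicit Defensive.

Import Order.TTheory GRing.Theory Num.Theory.
Local Open Scope fset_scope.
Local Open Scope ring_scope.

(** * Moving beads *)

(** Words are finite: the boundary of a diagram in an M x M box has 2M edges, and a move whose
    target lies outside the word is forbidden. Operators act on functions of the starting word, so
    the outermost factor of a composite is the first to alter the word, and a matrix coefficient is
    the value at one word of an operator applied to the indicator of another. The delicate point is
    commutativity. When two strips are added at once, exchanging x and y does not match
    configurations one by one: a bead in flight may belong to either strip, and only certain sums
    over the possible owners agree. The relation [good] retains exactly the sums that the rest of
    the reading can still form. Supersymmetry is used twice: for the coefficients of the operators,
    and to see that the value at the h_k of a polynomial expression in the e_k depends only on its
    value at the e_k, which makes the map well defined. The factor q^(n-1) comes from the n-1 places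
    strictly between the two ends of a move: complementing them turns j beads jumped over into
    n-1-j. *)

Section Moves.
Variable n : nat.

(* A partition is read off its boundary as a word in which [true] is a bead.
   Moving a bead [n] places to the right adds an [n]-ribbon, whose spin is the
   number [jmp] of beads jumped over. *)
Definition can (k : nat) (l : seq bool) : bool :=
  [&& nth false l k, (k + n < size l)%N & ~~ nth false l (k + n)].

Definition mv (k : nat) (l : seq bool) : seq bool :=
  set_nth false (set_nth false l k false) (k + n) true.

Definition jmp (k : nat) (l : seq bool) : nat :=
  count id (take n.-1 (drop k.+1 l)).

Lemma size_mv k l : can k l -> size (mv k l) = size l.
Proof.
move=> /and3P[_ klt _]; rewrite /mv !size_set_nth; lia.
Qed.

Variable R : comNzRingType.
Variable q : R.

Definition step (x : R) (k : nat) (phi : seq bool -> R) (l : seq bool) : R :=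
  phi l + (if can k l then x * q ^+ jmp k l * phi (mv k l) else 0).

(* [addop] attempts the moves from left to right, so that a bead that was moved
   may move again: its coefficients are the weights of horizontal ribbon
   strips. [remop] attempts the moves from right to left. *)
Definition addop (x : R) (phi : seq bool -> R) (l : seq bool) : R :=
  foldr (step x) phi (iota 0 (size l - n)) l.

Definition remop (x : R) (phi : seq bool -> R) (l : seq bool) : R :=
  foldr (step x) phi (rev (iota 0 (size l - n))) l.

Lemma step_cons x k phi a l :
  step x k.+1 phi (a :: l) = step x k (fun l' => phi (a :: l')) l.
Proof. by rewrite /step /can /mv /jmp /= addSn. Qed.

Lemma foldr_step_cons x phi a l m s :
  foldr (step x) phi (iota s.+1 m) (a :: l) =
  foldr (step x) (fun l' => phi (a :: l')) (iota s m) l.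
Proof.
elim: m s l => [|m IH] s l //=.
rewrite step_cons; congr step; apply: functional_extensionality_dep => l'.
exact: IH.
Qed.

(** Only the move at position 0 involves the first letter. It is settled before all others, and a
    bead lifted there lands at index [n.-1] of the tail. *)
Lemma addop_cons x phi a l : (0 < n)%N ->
  addop x phi (a :: l) =
  addop x (fun l' => phi (a :: l')) l +
  (if [&& a, (n.-1 < size l)%N & ~~ nth false l n.-1] then
     x * q ^+ count id (take n.-1 l) *
     addop x (fun l' => phi (false :: l')) (set_nth false l n.-1 true)
   else 0).
Proof.
move=> n0; rewrite /addop; have [ltl|lel] := ltnP n.-1 (size l); last first.
  have -> : (size (a :: l) - n = 0)%N by rewrite /=; lia.
  have -> : (size l - n = 0)%N by lia.
  by rewrite /= andbF addr0.
have -> : (size (a :: l) - n = (size l - n).+1)%N by rewrite /=; lia.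
rewrite /= {1}/step /can /jmp /mv /= foldr_step_cons add0n drop0.
have -> : (size l).+1 = size (a :: l) by [].
case: n n0 ltl => //= p _ ltl.
rewrite ltnS ltl foldr_step_cons size_set_nth.
by rewrite (maxn_idPr ltl).
Qed.

Lemma foldr_step_linear x (c d : R) phi psi ks l :
  foldr (step x) (fun l' => c * phi l' + d * psi l') ks l =
  c * foldr (step x) phi ks l + d * foldr (step x) psi ks l.
Proof.
elim: ks l => [|k ks IH] l //=.
rewrite /step !IH; case: ifP => _; ring.
Qed.

End Moves.

Section Inverse.
Variables (n : nat) (R : comNzRingType) (q : R).
Hypothesis n0 : (0 < n)%N.

Lemma nth_mv k l j : nth false (mv n k l) j =
  if j == (k + n)%N then true else if j == k then false else nth false l j.
Proof. by rewrite /mv !nth_set_nth /= nth_set_nth /=. Qed.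

(** An elementary step is 1 + xT with T squared equal to 0, because a move empties position [k] and
    cannot be repeated there. *)
Lemma stepK x k phi : step n q x k (step n q (- x) k phi) = phi.
Proof.
apply: functional_extensionality_dep => l; rewrite /step.
case: ifP => // ckl; last by rewrite !addr0.
have -> : can n k (mv n k l) = false.
  by rewrite /can nth_mv eqxx; case: eqP => //; lia.
ring.
Qed.

Lemma size_foldr_ext m x phi psi ks l :
  (forall l', size l' = m -> phi l' = psi l') -> size l = m ->
  foldr (step n q x) phi ks l = foldr (step n q x) psi ks l.
Proof.
move=> E; elim: ks l => [|k ks IH] l sl /=; first exact: E.
rewrite /step IH //; case: ifP => // c; rewrite IH // size_mv //.
Qed.

(** Both operators are products of elementary steps, in opposite orders, so the factors cancel in
    pairs from the middle outwards. *)
Lemma addop_remop x phi l : addop n q x (remop n q (- x) phi) l = phi l.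
Proof.
rewrite {1}/addop.
transitivity (foldr (step n q x)
   (foldr (step n q (- x)) phi (rev (iota 0 (size l - n))))
   (iota 0 (size l - n)) l).
  apply: (@size_foldr_ext (size l)) => // l' sl'.
  by rewrite /remop sl'.
congr (_ l); move: (iota 0 (size l - n)) => ks.
elim: ks phi => [|k ks IH] phi //=.
by rewrite rev_cons -cats1 foldr_cat /= IH stepK.
Qed.

End Inverse.

(** * The operators that add a strip commute *)

Section Queue.
Variables (n : nat) (R : comNzRingType) (q : R).
Hypothesis n0 : (0 < n)%N.
Local Notation addop := (addop n q).

(* [addop] computed while reading the word once; the queue [fs] tells which of
   the next [n] positions are the target of a bead already lifted. *)
Fixpoint qop (x : R) (fs bs : seq bool) (phi : seq bool -> R) : R :=
  match bs with
  | [::] => if has id fs then 0 else phi [::]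
  | b :: bs' =>
    let f := head false fs in let fs' := behead fs in
    if f && b then 0
    else if f || b then q ^+ count id fs' *
      (qop x (rcons fs' false) bs' (fun l => phi (true :: l)) +
       x * qop x (rcons fs' true) bs' (fun l => phi (false :: l)))
    else qop x (rcons fs' false) bs' (fun l => phi (false :: l))
  end.

Fixpoint merge_q (fs bs : seq bool) : seq bool :=
  match fs, bs with
  | f :: fs', b :: bs' => (f || b) :: merge_q fs' bs'
  | [::], _ => bs
  | _, [::] => [::]
  end.

Fixpoint noclash (fs bs : seq bool) : bool :=
  match fs, bs with
  | f :: fs', b :: bs' => ~~ (f && b) && noclash fs' bs'
  | [::], _ => true
  | f :: fs', [::] => ~~ has id fs
  end.

Fixpoint pending (fs bs : seq bool) : nat :=
  match fs, bs with
  | f :: fs', b :: bs' => ((f || b) * count id fs' + pending fs' bs')%N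
  | _, _ => 0%N
  end.

Lemma size_merge_q fs bs : size (merge_q fs bs) = size bs.
Proof. by elim: fs bs => [|f fs IH] [|b bs] //=; rewrite IH. Qed.

Lemma rcons_false_q fs bs :
  [/\ merge_q (rcons fs false) bs = merge_q fs bs,
      noclash (rcons fs false) bs = noclash fs bs
    & pending (rcons fs false) bs = pending fs bs].
Proof.
elim: fs bs => [|f fs IH] [|b bs] //=.
- by split; rewrite // ?muln0.
- by rewrite has_rcons.
- by have [-> -> ->] := IH bs; rewrite -cats1 count_cat /= !addn0.
Qed.

Lemma rcons_true_q fs bs :
  [/\ noclash (rcons fs true) bs = [&& noclash fs bs, (size fs < size bs)%N
         & ~~ nth false (merge_q fs bs) (size fs)],
      (size fs < size bs)%N -> merge_q (rcons fs true) bs =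
        set_nth false (merge_q fs bs) (size fs) true
    & (size fs < size bs)%N -> pending (rcons fs true) bs =
        (pending fs bs + count id (take (size fs) (merge_q fs bs)))%N].
Proof.
elim: fs bs => [|f fs IH] [|b bs] //=.
- by split; rewrite // ?orbT ?muln0 ?andbT.
- by rewrite has_rcons orbT /= andbF.
- have [-> E2 E3] := IH bs; split; first by rewrite ltnS andbA.
  + by move=> lt; rewrite E2.
  + move=> lt; rewrite E3 // -cats1 count_cat /=.
    case: (f || b) => /=; rewrite ?mul1n ?mul0n ?addn0 ?add0n; last by [].
    set A := count _ fs; set B := pending _ _; set C := count _ _.
    by move: A B C => A B C; lia.
Qed.

Lemma noclash_nil fs : noclash fs [::] = ~~ has id fs.
Proof. by case: fs. Qed.

(** The spin is charged to the bead that is jumped over: a bead met while reading contributes q to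
    the number of beads in flight above it. [merge_q] is the word once the beads of the queue have
    landed, and [pending] collects the charges these beads cause. *)
Lemma qopE x fs bs phi : size fs = n ->
  qop x fs bs phi =
  if noclash fs bs then q ^+ pending fs bs * addop x phi (merge_q fs bs) else 0.
Proof.
elim: bs fs phi => [|b bs IH] fs phi sfs.
  rewrite noclash_nil /= if_neg; case: ifP => // _.
  have -> : pending fs [::] = 0%N by case: (fs).
  have -> : merge_q fs [::] = [::] by case: (fs).
  by rewrite mul1r /(addop _ _).
case: fs sfs => [sfs|f fs /= sfs]; first by move: n0; rewrite -sfs.
have snf : size fs = n.-1 by rewrite -sfs.
case fb: (f && b) => //=.
have [mf cf pf] := rcons_false_q fs bs.
have [ct mt pt] := rcons_true_q fs bs.
rewrite addop_cons // size_merge_q.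
case fob: (f || b); last by rewrite IH ?size_rcons ?sfs // mf cf pf /= addr0.
rewrite mul1n !IH ?size_rcons ?sfs // mf cf pf ct snf.
case: (noclash fs bs) => /=; last by rewrite mulr0 addr0 mulr0.
case: ltnP => lt /=; last by rewrite mulr0 !addr0 exprD mulrA.
rewrite -snf in lt *.
case: ifP => _; last by rewrite mulr0 !addr0 exprD mulrA.
rewrite mt // pt // !exprD; ring.
Qed.

Lemma merge_q0 m bs : merge_q (nseq m false) bs = bs.
Proof. by elim: m bs => [|m IH] [|b bs] //=; rewrite IH. Qed.

Lemma noclash0 m bs : noclash (nseq m false) bs.
Proof.
elim: m bs => [|m IH] [|b bs] //=.
by rewrite has_nseq andbF.
Qed.

Lemma pending0 m bs : pending (nseq m false) bs = 0%N.
Proof.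
elim: m bs => [|m IH] [|b bs] //=.
by rewrite IH count_nseq /= mul0n muln0.
Qed.

Lemma addop_qop x bs phi : addop x phi bs = qop x (nseq n false) bs phi.
Proof. by rewrite qopE ?size_nseq // noclash0 pending0 merge_q0 mul1r. Qed.

Lemma eq_qop x fs bs phi psi : phi =1 psi -> qop x fs bs phi = qop x fs bs psi.
Proof.
by move=> E; congr qop; apply: functional_extensionality_dep.
Qed.

Lemma qop_linear x fs bs (c d : R) phi psi :
  qop x fs bs (fun l => c * phi l + d * psi l) =
  c * qop x fs bs phi + d * qop x fs bs psi.
Proof.
elim: bs fs phi psi => [|b bs IH] fs phi psi /=.
  by case: ifP => // _; rewrite !mulr0 addr0.
rewrite !IH; case: ifP => _; first by rewrite !mulr0 addr0.
case: ifP => _ //; ring.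
Qed.

Lemma qop_scale x fs bs (c : R) phi :
  qop x fs bs (fun l => c * phi l) = c * qop x fs bs phi.
Proof.
have := qop_linear x fs bs c 0 phi phi.
rewrite mul0r addr0 => <-; apply: eq_qop => l; by rewrite mul0r addr0.
Qed.

Lemma qop0 x fs bs : qop x fs bs (fun=> 0) = 0.
Proof.
have := qop_scale x fs bs 0 (fun=> 0).
by rewrite !mul0r.
Qed.

End Queue.

(** * Functions of ownership words, compared under exchange of the two layers *)

Section Good.
Variables (R : comNzRingType) (q : R).

(* Words in the letters [false] and [true] record, oldest first, which of the
   two layers owns each undecided bead in flight. *)
Definition pushw (x y : R) (F : seq bool -> R) (w : seq bool) : R :=
  x * q ^+ (2 * count negb w) * F (rcons w false) +
  y * q ^+ (2 * size w) * F (rcons w true).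

Definition popw (F : seq bool -> R) (w : seq bool) : R := F (behead w).

Definition lockw (x : R) (F : seq bool -> R) (w : seq bool) : R :=
  if w is true :: w' then x * q ^+ (2 * count negb w') * F w' else 0.

(* Swapping the two layers does not preserve the value of each single word,
   only of the combinations that can still be formed by later pushes. *)
Fixpoint good (x y : R) (m : nat) (F F' : seq bool -> R) : Prop :=
  if m is m'.+1 then
    good x y m' (fun w => F (rcons w false)) (fun w => F' (rcons w false)) /\
    good x y m' (pushw x y F) (pushw y x F')
  else F [::] = F' [::].

Lemma goodS x y m F F' : good x y m.+1 F F' ->
  good x y m (fun w => F (rcons w false)) (fun w => F' (rcons w false)) /\
  good x y m (pushw x y F) (pushw y x F').
Proof. by []. Qed.

Lemma good_ext x y m F F' G G' : (forall w, size w = m -> F w = G w) ->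
  (forall w, size w = m -> F' w = G' w) -> good x y m F F' -> good x y m G G'.
Proof.
elim: m F F' G G' => [|m IH] F F' G G' E E' /=; first by rewrite E // E'.
move=> [g1 g2]; split; [move: g1 | move: g2]; apply: IH => w sw;
  rewrite /pushw ?E ?E' ?size_rcons ?sw //.
Qed.

Lemma good_linear x y m (c d : R) F F' G G' : good x y m F F' ->
  good x y m G G' -> good x y m (fun w => c * F w + d * G w)
                                (fun w => c * F' w + d * G' w).
Proof.
elim: m F F' G G' => [|m IH] F F' G G' /=; first by move=> -> ->.
move=> [f1 f2] [g1 g2]; split; first exact: IH f1 g1.
by apply: good_ext (IH _ _ _ _ f2 g2) => w _; rewrite /pushw; ring.
Qed.

Lemma good_scale x y m (c : R) F F' : good x y m F F' ->
  good x y m (fun w => c * F w) (fun w => c * F' w).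
Proof.
move=> g; apply: good_ext (good_linear c 0 g g) => w _; by rewrite mul0r addr0.
Qed.

Lemma good_cancel x y m (c : R) F F' : GRing.lreg c ->
  good x y m (fun w => c * F w) (fun w => c * F' w) -> good x y m F F'.
Proof.
move=> rc; elim: m F F' => [|m IH] F F' /=; first exact: rc.
move=> [g1 g2]; split; first exact: IH.
by apply: IH; apply: good_ext g2 => w _; rewrite /pushw; ring.
Qed.

Lemma good0 x y m : good x y m (fun=> 0) (fun=> 0).
Proof.
elim: m => [|m IH] //=; split=> //.
by apply: good_ext IH => w _; rewrite /pushw; ring.
Qed.

Lemma good_lockw x y m F F' : good x y m F F' ->
  good x y m.+1 (lockw x F) (lockw y F').
Proof.
elim: m F F' => [|m IH] F F' /=.
  move=> E; split=> //; rewrite /pushw /= E; ring.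
move=> [g1 g2]; split.
- apply: good_ext (good_scale (q ^+ 2) (IH _ _ g1));
  by case=> [|[] w] //= _; rewrite ?mulr0 // -cats1 count_cat /= addn1 mulnS exprD; ring.
- apply: good_ext (good_scale (q ^+ 2) (IH _ _ g2));
  case=> [|[] w] //= _; rewrite /pushw /= ?mulr0 ?addr0 //;
  rewrite -!cats1 !count_cat /= !addn1 !addn0 ?add0n !mulnS !exprD; ring.
Qed.

(** Dropping the oldest letter commutes with a push up to the factor q^2, except when that letter is
    [true], which the first weight of [pushw] does not count. The defect is then 1 - q^2 times a
    [lockw]. *)
Lemma good_popw x y m F F' : good x y m F F' ->
  good x y m.+1 (popw F) (popw F').
Proof.
elim: m F F' => [|m IH] F F' /=.
  by move=> E; rewrite /popw /pushw /= E; split=> //; ring.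
move=> [g1 g2]; split.
  by apply: good_ext (IH _ _ g1); case.
apply: good_ext (good_linear (q ^+ 2) (1 - q ^+ 2) (IH _ _ g2)
   (good_lockw g1)); case=> [|[] w] //= _;
  rewrite /pushw /popw /= ?mulr0 ?addr0 // ?mulnS ?exprD; ring.
Qed.

End Good.

(* Whether, among the next [n] positions, a given one is the target of a lifted
   bead in no layer, in exactly one layer, or in both. *)
Inductive runner := Idle | Free | Locked.

Section TwoLayers.
Variables (n : nat) (R : comNzRingType) (q : R).
Hypotheses (n0 : (0 < n)%N) (q_reg : GRing.lreg q).
Local Notation good := (good q).
Local Notation pushw := (pushw q).
Local Notation lockw := (lockw q).

Definition layers (x y : R) fs gs bs phi : R :=
  qop q x fs bs (fun l => qop q y gs l phi).

(** The first layer hands what it leaves to the second. A bead that is met stays or is lifted by one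
    of the layers. Where the second layer lands a bead, the first must have lifted any bead standing
    there. *)
Lemma layers_cons x y f fs g gs b bs phi :
  let D f' g' b' := layers x y (rcons fs f') (rcons gs g') bs
                           (fun l => phi (b' :: l)) in
  let c1 := q ^+ count id fs in let c2 := q ^+ count id gs in
  layers x y (f :: fs) (g :: gs) (b :: bs) phi =
  match f, g, b with
  | true, _, true => 0
  | false, false, false => D false false false
  | false, true, false => c2 * (D false false true + y * D false true false)
  | true, false, false | false, false, true =>
    c1 * (c2 * (D false false true + y * D false true false) +
          x * D true false false)
  | true, true, false | false, true, true =>
    c1 * (x * (c2 * (D true false true + y * D true true false)))
  end.
Proof.
have E c fs' g1 g2 p1 p2 : qop q x fs' bs (fun l =>
     c * (qop q y g1 l p1 + y * qop q y g2 l p2)) =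
   c * (layers x y fs' g1 bs p1 + y * layers x y fs' g2 bs p2).
  rewrite mulrDr mulrA /layers -qop_linear; apply: eq_qop => l; ring.
case: f; case: g; case: b => //=; rewrite /layers /= ?E ?qop0 /layers //; ring.
Qed.

Fixpoint nfree (t : seq runner) : nat :=
  match t with [::] => 0 | Free :: t' => (nfree t').+1 | _ :: t' => nfree t' end.

Fixpoint nlocked (t : seq runner) : nat :=
  match t with [::] => 0 | Locked :: t' => (nlocked t').+1
             | _ :: t' => nlocked t' end.

Fixpoint flags1 (t : seq runner) (w : seq bool) : seq bool :=
  match t with
  | [::] => [::]
  | Idle :: t' => false :: flags1 t' w
  | Free :: t' => ~~ head false w :: flags1 t' (behead w)
  | Locked :: t' => true :: flags1 t' w
  end.

Fixpoint flags2 (t : seq runner) (w : seq bool) : seq bool :=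
  match t with
  | [::] => [::]
  | Idle :: t' => false :: flags2 t' w
  | Free :: t' => head false w :: flags2 t' (behead w)
  | Locked :: t' => true :: flags2 t' w
  end.

(* Chosen so that [value] below transforms through [popw], [pushw] and [lockw]
   only, up to factors that do not depend on the word. *)
Fixpoint gauge (t : seq runner) (w : seq bool) : nat :=
  match t with
  | [::] => 0
  | Idle :: t' => gauge t' w
  | Free :: t' => gauge t' (behead w) + size (behead w) +
      head false w * (count negb (behead w) + nlocked t')
  | Locked :: t' => gauge t' w + count id w
  end.

Lemma count_flags t w : size w = nfree t ->
  count id (flags1 t w) = (count negb w + nlocked t)%N /\
  count id (flags2 t w) = (count id w + nlocked t)%N.
Proof.
elim: t w => [|[] t IH] w /=; first by move/size0nil ->.
- by move=> /IH[-> ->].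
- by case: w => [|a w] //= [/IH[-> ->]]; rewrite !addnA.
- by move=> /IH[-> ->]; rewrite !add1n !addnS.
Qed.

Lemma flags_rcons_idle t w : size w = nfree t ->
  flags1 (rcons t Idle) w = rcons (flags1 t w) false /\
  flags2 (rcons t Idle) w = rcons (flags2 t w) false.
Proof.
elim: t w => [|[] t IH] w //=; try by move=> /IH[-> ->].
by case: w => [|a w] //= [/IH[-> ->]].
Qed.

Lemma flags_rcons_locked t w : size w = nfree t ->
  flags1 (rcons t Locked) w = rcons (flags1 t w) true /\
  flags2 (rcons t Locked) w = rcons (flags2 t w) true.
Proof.
elim: t w => [|[] t IH] w //=; try by move=> /IH[-> ->].
by case: w => [|a w] //= [/IH[-> ->]].
Qed.

Lemma flags_rcons_free t w a : size w = nfree t ->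
  flags1 (rcons t Free) (rcons w a) = rcons (flags1 t w) (~~ a) /\
  flags2 (rcons t Free) (rcons w a) = rcons (flags2 t w) a.
Proof.
elim: t w => [|[] t IH] w /=; first by move=> /size0nil ->.
- by move=> /IH[-> ->].
- by case: w => [|b w] //= [/IH[-> ->]].
- by move=> /IH[-> ->].
Qed.

Lemma nlocked_rcons t r :
  nlocked (rcons t r) = (nlocked t + (if r is Locked then 1 else 0))%N.
Proof. by elim: t => [|[] t IH] /=; rewrite ?IH ?addSn //; case: r. Qed.

Lemma nfree_rcons t r :
  nfree (rcons t r) = (nfree t + (if r is Free then 1 else 0))%N.
Proof. by elim: t => [|[] t IH] /=; rewrite ?IH ?addSn //; case: r. Qed.

Lemma gauge_rcons_idle t w : gauge (rcons t Idle) w = gauge t w.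
Proof. by elim: t w => [|[] t IH] w //=; rewrite IH ?nlocked_rcons ?addn0. Qed.

Lemma gauge_rcons_locked t w : size w = nfree t ->
  gauge (rcons t Locked) w = (gauge t w + count id w)%N.
Proof.
elim: t w => [|[] t IH] w //=; try by move=> /IH ->.
- by case: w => [|a w] //= [/IH ->]; rewrite nlocked_rcons; case: a => /=; lia.
Qed.

Lemma gauge_rcons_free t w a : size w = nfree t ->
  gauge (rcons t Free) (rcons w a) =
  (gauge t w + count negb w + (if a then count id w + nlocked t
                               else 2 * count id w))%N.
Proof.
elim: t w => [|[] t IH] w /=; first by move=> /size0nil ->; case: a.
- by move=> /IH ->.
- case: w => [|b w] //= [/[dup] sw /IH ->].
  rewrite nlocked_rcons size_rcons -cats1 count_cat.
  have := count_predC id w; rewrite -/negb.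
  have -> : count (predC id) w = count negb w by apply: eq_count.
  by clear IH; case: a; case: b => /=; lia.
- move=> /IH ->; clear IH; rewrite -cats1 count_cat; case: a => /=; lia.
Qed.

Definition value (t : seq runner) bs phi (x y : R) (w : seq bool) : R :=
  y ^+ nlocked t * q ^+ gauge t w * layers x y (flags1 t w) (flags2 t w) bs phi.

Let expE := (mul1n, mul0n, mulnDr, mul2n, addn0, add0n, addnS, addn1).

Lemma size_count (w : seq bool) : size w = (count negb w + count id w)%N.
Proof. by rewrite addnC -(count_predC id w); congr addn; exact: eq_count. Qed.

Lemma layers_nil x y t phi w : size w = nfree t ->
  layers x y (flags1 t w) (flags2 t w) [::] phi =
  if (nfree t + nlocked t == 0)%N then phi [::] else 0.
Proof.
move=> sw; rewrite /layers /= !has_count.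
have [-> ->] := count_flags sw; rewrite -sw size_count.
case: ifP => h1; first by case: ifP => // h2; exfalso; lia.
by case: ifP => h2; case: ifP => // h3; exfalso; lia.
Qed.

(** Induction on the word, by the state of the first place and the letter read. Lifting a bead that
    either layer may take is a push. A free bead landing on an empty place is a [popw], up to a
    correction. A free bead landing on a bead of the word is a [lockw]: it must belong to the second
    layer, the first having lifted the bead below it. *)
Lemma good_value x y bs t phi : size t = n ->
  good x y (nfree t) (value t bs phi x y) (value t bs phi y x).
Proof.
elim: bs t phi => [|b bs IH] t phi st.
  have E u v w : size w = nfree t -> value t [::] phi u v w =
     v ^+ nlocked t * q ^+ gauge t w *
     (if (nfree t + nlocked t == 0)%N then phi [::] else 0).
    by move=> sw; rewrite /value layers_nil.
  case: eqP E => [z|_] E; last first.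
    by apply: good_ext (good0 q x y _) => w sw; rewrite E // mulr0.
  have zf : nfree t = 0%N by lia.
  have zl : nlocked t = 0%N by lia.
  by rewrite zf /= !E ?zf // zl.
case: t st => [/esym|r t]; first by move=> E; move: n0; rewrite E.
move=> /= st.
set V := fun r' b' => value (rcons t r') bs (fun l => phi (b' :: l)).
have G r' b' : good x y (nfree (rcons t r')) (V r' b' x y) (V r' b' y x).
  by apply: IH; rewrite size_rcons.
have GI b' : good x y (nfree t) (V Idle b' x y) (V Idle b' y x).
  by have := G Idle b'; rewrite nfree_rcons addn0.
have GL b' : good x y (nfree t) (V Locked b' x y) (V Locked b' y x).
  by have := G Locked b'; rewrite nfree_rcons addn0.
have GF b' : good x y (nfree t).+1 (V Free b' x y) (V Free b' y x).
  by have := G Free b'; rewrite nfree_rcons addn1.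
have [[G0 P0] [G1 P1]] := (goodS (GF false), goodS (GF true)).
pose m := nfree t; pose f := nlocked t.
have qr k : GRing.lreg (q ^+ k) by apply: GRing.lregX.
have EI u v b' w : size w = m -> V Idle b' u v w = v ^+ f * q ^+ gauge t w *
    layers u v (rcons (flags1 t w) false) (rcons (flags2 t w) false) bs
      (fun l => phi (b' :: l)).
  move=> sw; rewrite /V /value nlocked_rcons addn0 gauge_rcons_idle.
  by have [-> ->] := flags_rcons_idle sw.
have EL u v b' w : size w = m -> V Locked b' u v w =
    v ^+ f.+1 * q ^+ (gauge t w + count id w) *
    layers u v (rcons (flags1 t w) true) (rcons (flags2 t w) true) bs
      (fun l => phi (b' :: l)).
  move=> sw; rewrite /V /value nlocked_rcons addn1 gauge_rcons_locked //.
  by have [-> ->] := flags_rcons_locked sw.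
have EF0 u v b' w : size w = m -> V Free b' u v (rcons w false) =
    v ^+ f * q ^+ (gauge t w + count negb w + 2 * count id w) *
    layers u v (rcons (flags1 t w) true) (rcons (flags2 t w) false) bs
      (fun l => phi (b' :: l)).
  move=> sw; rewrite /V /value nlocked_rcons addn0 gauge_rcons_free //.
  by have [-> ->] := flags_rcons_free false sw.
have EF1 u v b' w : size w = m -> V Free b' u v (rcons w true) =
    v ^+ f * q ^+ (gauge t w + count negb w + (count id w + f)) *
    layers u v (rcons (flags1 t w) false) (rcons (flags2 t w) true) bs
      (fun l => phi (b' :: l)).
  move=> sw; rewrite /V /value nlocked_rcons addn0 gauge_rcons_free //.
  by have [-> ->] := flags_rcons_free true sw.
case: r st => st; case: b.
(* The push carries q^(2m) more than the corresponding term of [layers_cons]. Multiplying through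
   and cancelling avoids negative exponents. *)
- apply: (good_cancel (qr (2 * m)%N)).
  have g := good_linear (q ^+ (3 * m + 2 * f)) (q ^+ f) (GI true) P0.
  apply: good_ext g => w sw; rewrite /value /pushw /= EI // EF0 // EF1 //
    layers_cons; have [c1E c2E] := count_flags sw; rewrite ?c1E ?c2E;
    rewrite -/m -/f in sw *; rewrite -sw size_count !expE -?addnn !exprD; ring.
- apply: good_ext (GI false) => w sw; rewrite /value /= EI // layers_cons //.
- have g := good_linear (q ^+ (m + 3 * f)) (q ^+ (3 * f))
    (good_lockw (GL false)) (good_lockw G1).
  apply: good_ext g => -[|a w] //= [sw]; rewrite /value /= layers_cons;
    case: a => /=; rewrite ?mulr0 ?addr0 // EL // EF0 //;
    have [c1E c2E] := count_flags sw; rewrite ?c1E ?c2E;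
    rewrite -/m -/f in sw *; rewrite -sw size_count !expE -?addnn !exprD ?exprS;
    ring.
- apply: (good_cancel (qr m)).
  have g := good_linear 1 (q ^+ f)
    (good_scale (q ^+ (3 * m + 2 * f)) (good_popw (GI true)))
    (good_linear 1 (- 1) (good_popw P0) (good_lockw G0)).
  apply: good_ext g => -[|a w] //= [sw];
    rewrite /value /popw /= layers_cons /pushw EI // EF0 // EF1 //;
    case: a => /=;
    have [c1E c2E] := count_flags sw; rewrite ?c1E ?c2E;
    rewrite -/m -/f in sw *; rewrite -sw size_count !expE -?addnn !exprD; ring.
- apply: good_ext (good0 q x y _) => w sw;
    by rewrite /value /= layers_cons mulr0.
- have g := good_linear (x * y * q ^+ (m + 2 * f)) (x * y * q ^+ (2 * f))
    (GL false) G1.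
  apply: good_ext g => w sw; rewrite /value /= layers_cons EL // EF0 //;
    have [c1E c2E] := count_flags sw; rewrite ?c1E ?c2E;
    rewrite -/m -/f in sw *; rewrite -sw size_count !expE -?addnn !exprD ?exprS;
    ring.
Qed.

(** With nothing in flight there are no owners to record, and [good] is plain equality. *)
Lemma addopC x y phi l :
  addop n q x (addop n q y phi) l = addop n q y (addop n q x phi) l.
Proof.
have nf m : nfree (nseq m Idle) = 0%N by elim: m.
have nl m : nlocked (nseq m Idle) = 0%N by elim: m.
have f1 m : flags1 (nseq m Idle) [::] = nseq m false by elim: m => //= m ->.
have f2 m : flags2 (nseq m Idle) [::] = nseq m false by elim: m => //= m ->.
have g m : gauge (nseq m Idle) [::] = 0%N by elim: m.
have := good_value x y l phi (size_nseq n Idle).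
rewrite nf /= /value nl f1 f2 g !mul1r /layers => E.
rewrite !addop_qop //.
transitivity (layers x y (nseq n false) (nseq n false) l phi).
  by apply: eq_qop => l'; rewrite addop_qop.
by rewrite /layers E; apply: eq_qop => l'; rewrite addop_qop.
Qed.

End TwoLayers.

(** * Supersymmetric functions *)

Section Super.
Variable R : idomainType.
Hypothesis char0 : injective (fun k : nat => k%:R : R).
Implicit Types (X Y Z : seq R) (G : seq R -> seq R -> R).

Record supersymmetric G : Prop := Supersymmetric {
  super_perm : forall X X' Z, perm_eq X X' -> G X Z = G X' Z;
  super_cancel : forall x X Z, G (x :: X) (- x :: Z) = G X Z;
  super_zero : forall X Z, G (0 :: X) Z = G X Z;
  super_polyl : forall X Z, exists p : {poly R}, forall x, G (x :: X) Z = p.[x];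
  super_polyr : exists d, forall X Z, exists2 p : {poly R},
    (size p <= d)%N & forall z, G X (z :: Z) = p.[z] }.

(* As a polynomial of bounded degree in the first variable of [Z], [G] vanishes
   at the opposite of every element of [X], of which there can be arbitrarily
   many. *)
Lemma super_eq0 G : supersymmetric G -> (forall X, G X [::] = 0) ->
  forall X Z, G X Z = 0.
Proof.
move=> [perm canc zero polyl [d polyr]] G0 X Z.
elim: Z X => [|z Z IH] // X.
(* [m] counts the roots still missing to exceed the degree in z; the induction goes down to
   [m = 0]. *)
suff H m Y : (size Y + m = d)%N -> uniq Y -> G (Y ++ X) (z :: Z) = 0.
  exact: (H d [::]).
elim: m Y => [|m IHm] Y sY uY.
  have [p sp pE] := polyr (Y ++ X) Z.
  suff p0 : p = 0 by rewrite pE p0 horner0.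
  apply: (@roots_geq_poly_eq0 _ _ [seq - y | y <- Y]).
  - apply/allP => _ /mapP[y yY ->]; rewrite /root -pE.
    rewrite (perm _ (y :: (rem y Y ++ X))) ?canc ?IH //.
    by rewrite -cat_cons perm_cat2r perm_to_rem.
  - by rewrite map_inj_uniq //; apply: oppr_inj.
  - by rewrite size_map (leq_trans sp) // -sY addn0.
have [p pE] := polyl (Y ++ X) (z :: Z).
suff p0 : p = 0 by rewrite -zero pE p0 horner0.
pose s := [seq k%:R : R | k <- iota 0 (size p + size Y)].
have us : uniq s by rewrite map_inj_uniq ?iota_uniq.
pose t := [seq x <- s | x \notin Y].
apply: (@roots_geq_poly_eq0 _ _ t).
- apply/allP => x; rewrite mem_filter => /andP[xY _]; rewrite /root -pE.
  by rewrite -cat_cons; apply/eqP/IHm; rewrite /= ?xY // -sY addSnnS.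
- exact: filter_uniq.
- have : (count (mem Y) s <= size Y)%N.
    rewrite -size_filter; apply: uniq_leq_size; first exact: filter_uniq.
    by move=> x; rewrite mem_filter => /andP[].
  have := count_predC (mem Y) s; rewrite size_map size_iota /t size_filter.
  by rewrite -[count (predC _) s]/(count (fun x => x \notin Y) s); lia.
Qed.

Lemma super_const c : supersymmetric (fun _ _ => c).
Proof.
split=> // [X Z|]; first by exists c%:P => x; rewrite hornerC.
exists 1%N => X Z; exists c%:P; first exact: size_polyC_leq1.
by move=> z; rewrite hornerC.
Qed.

Lemma super_add G1 G2 : supersymmetric G1 -> supersymmetric G2 ->
  supersymmetric (fun X Z => G1 X Z + G2 X Z).
Proof.
move=> [p1 c1 z1 l1 [d1 r1]] [p2 c2 z2 l2 [d2 r2]]; split.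
- by move=> X X' Z e; rewrite (p1 X X') // (p2 X X').
- by move=> x X Z; rewrite c1 c2.
- by move=> X Z; rewrite z1 z2.
- move=> X Z; have [p pE] := l1 X Z; have [p' p'E] := l2 X Z.
  by exists (p + p') => x; rewrite hornerD pE p'E.
- exists (maxn d1 d2) => X Z; have [p sp pE] := r1 X Z; have [p' sp' p'E] := r2 X Z.
  exists (p + p'); last by move=> x; rewrite hornerD pE p'E.
  apply: leq_trans (size_polyD _ _) _.
  by rewrite geq_max !leq_max sp sp' orbT.
Qed.

Lemma super_mul G1 G2 : supersymmetric G1 -> supersymmetric G2 ->
  supersymmetric (fun X Z => G1 X Z * G2 X Z).
Proof.
move=> [p1 c1 z1 l1 [d1 r1]] [p2 c2 z2 l2 [d2 r2]]; split.
- by move=> X X' Z e; rewrite (p1 X X') // (p2 X X').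
- by move=> x X Z; rewrite c1 c2.
- by move=> X Z; rewrite z1 z2.
- move=> X Z; have [p pE] := l1 X Z; have [p' p'E] := l2 X Z.
  by exists (p * p') => x; rewrite hornerM pE p'E.
- exists (d1 + d2)%N => X Z; have [p sp pE] := r1 X Z; have [p' sp' p'E] := r2 X Z.
  exists (p * p'); last by move=> x; rewrite hornerM pE p'E.
  apply: leq_trans (size_polyMleq _ _) _; lia.
Qed.

Lemma super_eq G1 G2 : supersymmetric G1 -> supersymmetric G2 ->
  (forall X, G1 X [::] = G2 X [::]) -> forall X Z, G1 X Z = G2 X Z.
Proof.
move=> s1 s2 E X Z; apply/eqP; rewrite -subr_eq0; apply/eqP.
rewrite -mulN1r.
apply: (super_eq0 (super_add s1 (super_mul (super_const (-1)) s2))) => Y.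
by rewrite E mulN1r subrr.
Qed.

End Super.

(** * Supersymmetric elementary functions and the supersymmetry of the operators *)

Section Generating.
Variable R : comNzRingType.

Definition mulgen (x : R) (a : nat -> R) (k : nat) : R :=
  a k + x * (if k is k'.+1 then a k' else 0).

Fixpoint divgen (z : R) (a : nat -> R) (k : nat) : R :=
  if k is k'.+1 then a k + z * divgen z a k' else a 0%N.

(* The coefficients of [\prod_(x <- X) (1 + x t) / \prod_(z <- Z) (1 - z t)]. *)
Definition esuper (X Z : seq R) : nat -> R :=
  foldr mulgen (foldr divgen (fun k => (k == 0%N)%:R) Z) X.

Lemma mulgenC x y a : mulgen x (mulgen y a) = mulgen y (mulgen x a).
Proof.
apply: functional_extensionality_dep => -[|[|k]]; rewrite /mulgen; ring.
Qed.

Lemma mulgen_divgen x a : mulgen x (divgen (- x) a) = a.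
Proof.
apply: functional_extensionality_dep => -[|k]; rewrite /mulgen /=; ring.
Qed.

Lemma mulgen0 a : mulgen 0 a = a.
Proof. by apply: functional_extensionality_dep => k; rewrite /mulgen mul0r addr0. Qed.

Lemma foldr_perm (T : eqType) (S : Type) (f : T -> S -> S) (s : S) (X X' : seq T) :
  (forall x y s, f x (f y s) = f y (f x s)) -> perm_eq X X' ->
  foldr f s X = foldr f s X'.
Proof.
move=> fC; elim: X X' => [|x X IH] X' pe.
  by move: pe; rewrite perm_sym => /perm_nilP ->.
have xX' : x \in X' by rewrite -(perm_mem pe) mem_head.
case/splitPr: xX' pe => s1 s2; rewrite perm_sym perm_catC /= perm_cons => pe.
rewrite /= (IH (s1 ++ s2)); last by rewrite perm_sym perm_catC.
by elim: s1 {pe} => //= y s1 <-; rewrite fC.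
Qed.

End Generating.

Section Instances.
Variable R : idomainType.
Implicit Types (X Y Z : seq R).

Lemma super_esuper k : supersymmetric (fun X Z => esuper X Z k).
Proof.
have psize1 (p p' : {poly R}) d : (size p <= d)%N -> (size p' <= d)%N ->
    (size (p + p')%R <= d)%N.
  by move=> h h'; apply: leq_trans (size_polyD _ _) _; rewrite geq_max h.
split.
- by move=> X X' Z pe; rewrite /esuper (foldr_perm _ _ pe) // => *; apply: mulgenC.
- move=> x X Z; rewrite /esuper /=; congr (_ k).
  by elim: X => [|y X IH] /=; rewrite ?mulgen_divgen // mulgenC IH.
- by move=> X Z; rewrite /esuper /= mulgen0.
- move=> X Z; rewrite /esuper /=; set a := foldr _ _ X.
  exists ((a k)%:P + (if k is k'.+1 then a k' else 0)%:P * 'X) => x.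
  by rewrite hornerD hornerM !hornerC hornerX /mulgen [x * _]mulrC.
- exists k.+1 => X Z; rewrite /esuper /=.
  elim: X k => [|x X IH] k /=.
    set a := foldr _ _ Z; elim: k => [|k [p sp pE]].
      by exists (a 0%N)%:P => [|z]; rewrite ?hornerC // size_polyC_leq1.
    exists ((a k.+1)%:P + 'X * p) => [|z]; last first.
      by rewrite /= hornerD hornerM hornerC hornerX pE.
    apply: psize1; first by rewrite (leq_trans (size_polyC_leq1 _)).
    by rewrite (leq_trans (size_polyMleq _ _)) // size_polyX.
  have [p sp pE] := IH k; case: k sp pE => [|k] sp pE.
    by exists p => // z; rewrite /mulgen mulr0 addr0 pE.
  have [p' sp' p'E] := IH k; exists (p + x%:P * p') => [|z]; last first.
    by rewrite /mulgen hornerD hornerM hornerC pE p'E.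
  apply: psize1 => //; rewrite mul_polyC.
  by rewrite (leq_trans (size_scale_leq _ _)) // (leq_trans sp').
Qed.

Variables (q : R) (n : nat).
Hypotheses (n0 : (0 < n)%N) (q0 : q != 0).

Definition addrem X Z (phi : seq bool -> R) (l : seq bool) : R :=
  foldr (addop n q) (foldr (remop n q) phi Z) X l.

Lemma addop0 phi : addop n q 0 phi = phi.
Proof.
apply: functional_extensionality_dep => l; rewrite /addop; congr (_ l).
elim: (iota _ _) => //= k ks ->.
apply: functional_extensionality_dep => l'; rewrite /step.
by case: ifP => _; rewrite ?mul0r addr0.
Qed.

Lemma addop_comm x y phi :
  addop n q x (addop n q y phi) = addop n q y (addop n q x phi).
Proof.
by apply: functional_extensionality_dep => l; apply: addopC => //; apply/lregP.
Qed.

Lemma addop_remop_id x phi : addop n q x (remop n q (- x) phi) = phi.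
Proof. by apply: functional_extensionality_dep => l; apply: addop_remop. Qed.

Definition poly_bounded (d : nat) (f : R -> seq bool -> R) : Prop :=
  forall l, exists2 p : {poly R}, (size p <= d)%N & forall z, f z l = p.[z].

Lemma poly_stepX d f k : poly_bounded d f ->
  poly_bounded d.+1 (fun z => step n q z k (f z)).
Proof.
move=> h l; have [p sp pE] := h l; have [p' sp' p'E] := h (mv n k l).
case c: (can n k l); last first.
  by exists p => [|z]; rewrite ?(leq_trans sp) // /step c addr0.
exists (p + q ^+ jmp n k l *: ('X * p')) => [|z]; last first.
  by rewrite /step c hornerD hornerZ hornerM hornerX pE p'E mulrCA mulrA.
rewrite (leq_trans (size_polyD _ _)) // geq_max (leq_trans sp) //.
rewrite (leq_trans (size_scale_leq _ _)) // (leq_trans (size_polyMleq _ _)) //.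
by rewrite size_polyX.
Qed.

Lemma poly_foldr_stepX d f ks : poly_bounded d f ->
  poly_bounded (d + size ks) (fun z => foldr (step n q z) (f z) ks).
Proof.
move=> h; elim: ks => /= [|k ks IH]; first by rewrite addn0.
by rewrite addnS; apply: poly_stepX.
Qed.

(** For the cancellation, [addop] at x is carried inwards past the others by commutativity until it
    meets its inverse [remop] at -x. The degree in z is at most the number of elementary steps in
    one operator. This is uniform in [X] and [Z], as moves preserve the length of the word. *)
Lemma super_addrem phi l : supersymmetric (fun X Z => addrem X Z phi l).
Proof.
have cst (psi : seq bool -> R) : poly_bounded 1 (fun _ => psi).
  by move=> l'; exists (psi l')%:P => [|z]; rewrite ?size_polyC_leq1 ?hornerC.
split.
- by move=> X X' Z pe; rewrite /addrem (foldr_perm _ _ pe) // => *; apply: addop_comm.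
- move=> x X Z; rewrite /addrem /=; congr (_ l).
  by elim: X => [|y X IH] /=; rewrite ?addop_remop_id // addop_comm IH.
- by move=> X Z; rewrite /addrem /= addop0.
- move=> X Z; rewrite /addrem /=; set a := foldr _ _ X.
  by have [p _ pE] := poly_foldr_stepX (iota 0 (size l - n)) (cst a) l; exists p.
- exists (1 + (size l - n))%N => X Z; rewrite /addrem /=.
  set psi := foldr _ _ Z.
  suff H : forall l', size l' = size l -> exists2 p : {poly R},
     (size p <= 1 + (size l - n))%N & forall z,
     foldr (addop n q) (remop n q z psi) X l' = p.[z] by exact: H.
  elim: X => [|x X IH] l' sl' /=.
    have := poly_foldr_stepX (rev (iota 0 (size l - n))) (cst psi) l'.
    by rewrite size_rev size_iota /remop sl'.
  rewrite /addop sl'; elim: (iota _ _) l' sl' => [|k ks IHk] l' sl' /=.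
    exact: IH.
  have [p sp pE] := IHk _ sl'; case c: (can n k l'); last first.
    by exists p => // z; rewrite /step c addr0 pE.
  have [|p' sp' p'E] := IHk (mv n k l'); first by rewrite size_mv.
  exists (p + (x * q ^+ jmp n k l') *: p') => [|z]; last first.
    by rewrite /step c hornerD hornerZ pE p'E.
  rewrite (leq_trans (size_polyD _ _)) // geq_max sp.
  by rewrite (leq_trans (size_scale_leq _ _)).
Qed.

End Instances.

(* Polynomials in countably many generators, kept as syntax because [peval]
   below evaluates them along maps [c] of the constants that are not ring
   morphisms. *)
Inductive pexp (K : Type) : Type :=
| PConst of K
| PVar of nat
| PAdd of pexp K & pexp K
| PMul of pexp K & pexp K.

Fixpoint peval (K : Type) (A : comNzRingType) (c : K -> A) (v : nat -> A)
    (e : pexp K) : A :=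
  match e with
  | PConst a => c a
  | PVar k => v k
  | PAdd e1 e2 => peval c v e1 + peval c v e2
  | PMul e1 e2 => peval c v e1 * peval c v e2
  end.

Lemma super_peval (R : idomainType) (K : Type) (c : K -> R) (e : pexp K) :
  supersymmetric (fun X Z => peval c (esuper X Z) e).
Proof.
elim: e => [a|k|e1 h1 e2 h2|e1 h1 e2 h2] /=.
- exact: super_const.
- exact: super_esuper.
- exact: super_add.
- exact: super_mul.
Qed.

(** * Boundary words of diagrams in a box *)

Lemma diagram_le (D : {fset cell}) r c r' c' : is_diagram D ->
  (r, c) \in D -> (r' <= r)%N -> (c' <= c)%N -> (r', c') \in D.
Proof.
move=> /allP H rcD; have H1 i j : (i.+1, j) \in D -> (i, j) \in D.
  by move=> /H /andP[].
have H2 i j : (i, j.+1) \in D -> (i, j) \in D by move=> /H /andP[].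
move=> /subnKC er /subnKC ec; move: rcD; rewrite -er -ec.
elim: (r - r')%N => [|a IH]; rewrite ?addn0 ?addnS; last by move/H1.
by elim: (c - c')%N => [|b IH]; rewrite ?addn0 ?addnS //; move/H2.
Qed.

Lemma count_down (P : pred nat) m t : (forall i, P i.+1 -> P i) ->
  (t < m)%N -> (t < count P (iota 0 m))%N = P t.
Proof.
move=> H; have H' i j : (i <= j)%N -> P j -> P i.
  by move=> /subnKC <-; elim: (j - i)%N => [|d IH]; rewrite ?addn0 ?addnS // => /H.
elim: m => // m IH; rewrite -[in iota _ _]addn1 iotaD count_cat /= add0n addn0.
have ub : (count P (iota 0 m) <= m)%N by rewrite (leq_trans (count_size _ _)) ?size_iota.
case Pm: (P m).
  have -> : count P (iota 0 m) = m.
    transitivity (size (iota 0 m)); last by rewrite size_iota.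
    apply/eqP; rewrite -all_count; apply/allP => j.
    by rewrite mem_iota add0n => /andP[_ jm]; apply: H' Pm; apply: ltnW.
  by rewrite /= addn1 => tm; rewrite tm; apply/esym/(H' _ m).
rewrite /= addn0 ltnS leq_eqVlt => /predU1P[->|/IH //].
by rewrite Pm ltnNge ub.
Qed.

Section Box.
Variable M : nat.
Implicit Types (D S : {fset cell}) (d : nat -> nat).

(* The content is shifted by [M] to be nonnegative inside the [M] x [M] box;
   [cellat k t] is the cell number [t] on the diagonal [k]. *)
Definition content (c : cell) : nat := (c.2 + M - c.1)%N.
Definition cellat (k t : nat) : cell := (t + (M - k), t + (k - M))%N.
Definition in_box S : Prop := forall c, c \in S -> (c.1 < M)%N /\ (c.2 < M)%N.
(** Diagonals rather than rows: an n-ribbon raises n consecutive diagonal lengths by 1, so that only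
    two of their differences change. *)
Definition dg S k : nat := count (fun t => cellat k t \in S) (iota 0 M).

Lemma content_cellat k t : content (cellat k t) = k.
Proof. rewrite /content /=; lia. Qed.

Lemma cellat_content (c : cell) : (c.1 < M)%N ->
  c = cellat (content c) (minn c.1 c.2).
Proof. by case: c => i j /=; rewrite /cellat /content /= => h; congr pair; lia. Qed.

Lemma content_bound (c : cell) : (c.1 < M)%N -> (c.2 < M)%N ->
  (0 < content c < 2 * M)%N.
Proof. case: c => i j; rewrite /content /=; lia. Qed.

Lemma content_le (c : cell) : (c.1 < M)%N -> (c.2 < M)%N ->
  (content c <= 2 * M)%N.
Proof. by move=> h1 h2; have /andP[_ /ltnW] := content_bound h1 h2. Qed.

Lemma mem_dg D k t : is_diagram D -> in_box D ->
  (cellat k t \in D) = (t < dg D k)%N.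
Proof.
move=> dD bD; case: (ltnP t M) => tM.
  rewrite /dg count_down // => i; rewrite /cellat => h.
  by apply: diagram_le h _ _ => //; lia.
have -> : (cellat k t \in D) = false.
  by apply/negP => /bD /=; lia.
by apply/esym/negbTE; rewrite -leqNgt (leq_trans _ tM) // (leq_trans (count_size _ _)) ?size_iota.
Qed.

Lemma mem_dgE D (c : cell) : is_diagram D -> in_box D -> (c.1 < M)%N ->
  (c \in D) = (minn c.1 c.2 < dg D (content c))%N.
Proof. by move=> dD bD c1; rewrite -mem_dg // -cellat_content. Qed.

Definition profile d : Prop :=
  [/\ d 0%N = 0%N, d (2 * M)%N = 0%N & forall e, (e < 2 * M)%N ->
    if (e < M)%N then (d e <= d e.+1 <= (d e).+1)%N
    else (d e.+1 <= d e <= (d e.+1).+1)%N].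

(* A bead is a vertical edge of the boundary path, read from bottom left to top
   right. *)
Definition bit d (e : nat) : bool :=
  if (e < M)%N then d e == d e.+1 else d e != d e.+1.

Definition bits D : seq bool := mkseq (bit (dg D)) (2 * M).

(** One linear relation for both halves of the boundary; it turns statements about beads into
    arithmetic on diagonal lengths. *)
Lemma bitE d e : profile d -> (e < 2 * M)%N ->
  (bit d e + d e.+1 = (e < M) + d e)%N.
Proof. move=> [_ _ h] /h; rewrite /bit; case: ifP => _; lia. Qed.

Lemma dg_profile D : is_diagram D -> in_box D -> profile (dg D).
Proof.
move=> dD bD; have le k l t u : (cellat k t \in D -> cellat l u \in D) ->
    (t < dg D k)%N -> (u < dg D l)%N.
  by rewrite !mem_dg.
have out k t : (k == 0%N) || (k == 2 * M)%N -> (dg D k <= t)%N.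
  by move=> kE; rewrite leqNgt -mem_dg //; apply/negP => /bD /=; lia.
split=> [||e eM].
- by apply/eqP; rewrite -leqn0; apply: out; rewrite eqxx.
- by apply/eqP; rewrite -leqn0; apply: out; rewrite eqxx orbT.
- have nle a b : (forall t, (t < a)%N -> (t < b)%N) -> (a <= b)%N.
    by case: a => // a; apply.
  have nle1 a b : (forall t, (t.+1 < a)%N -> (t < b)%N) -> (a <= b.+1)%N.
    by case: a => // -[|a] // h; rewrite ltnS; apply: h.
  case: ifP => eM'; apply/andP; split.
  + apply: nle => t; apply: le => h; apply: diagram_le h _ _ => //; lia.
  + apply: nle1 => t; apply: le => h; apply: diagram_le h _ _ => //; lia.
  + apply: nle => t; apply: le => h; apply: diagram_le h _ _ => //; lia.
  + apply: nle1 => t; apply: le => h; apply: diagram_le h _ _ => //; lia.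
Qed.

(** The bits determine the successive differences of the diagonal lengths, which start from 0. *)
Lemma bits_inj D D' : is_diagram D -> in_box D -> is_diagram D' -> in_box D' ->
  bits D = bits D' -> D = D'.
Proof.
move=> dD bD dD' bD' E.
have Eb e : (e < 2 * M)%N -> bit (dg D) e = bit (dg D') e.
  by move=> eM; rewrite -(nth_mkseq false (bit (dg D)) eM) -/(bits D) E nth_mkseq.
have pD := dg_profile dD bD; have pD' := dg_profile dD' bD'.
have Ed k : (k <= 2 * M)%N -> dg D k = dg D' k.
  elim: k => [|k IH] kM; first by case: pD => ->; case: pD' => ->.
  have := bitE pD kM; have := bitE pD' kM; rewrite Eb // (IH (ltnW kM)).
  by move=> <- /eqP; rewrite eqn_add2l => /eqP.
apply/fsetP => c; apply/idP/idP => cD.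
- have [c1 c2] := bD c cD; have ck : (content c <= 2 * M)%N by apply: content_le.
  by rewrite mem_dgE // -Ed // -mem_dgE.
- have [c1 c2] := bD' c cD; have ck : (content c <= 2 * M)%N by apply: content_le.
  by rewrite mem_dgE // Ed // -mem_dgE.
Qed.

Definition shape d : {fset cell} :=
  [fset c in [seq (i, j) | i <- iota 0 M, j <- iota 0 M] |
    (minn c.1 c.2 < d (content c))%N].

Lemma mem_shape d (c : cell) : (c \in shape d) =
  [&& (c.1 < M)%N, (c.2 < M)%N & (minn c.1 c.2 < d (content c))%N].
Proof.
rewrite !inE /=; case: c => i j /=; rewrite andbA; congr andb.
apply/allpairsP/andP => [[[a b] /=]|[iM jM]].
  by rewrite !mem_iota !add0n => -[/andP[_ ?] /andP[_ ?] [-> ->]].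
by exists (i, j); rewrite !mem_iota.
Qed.

Lemma shape_in_box d : in_box (shape d).
Proof. by move=> c; rewrite mem_shape => /and3P[]. Qed.

Lemma shape_diagram d : profile d -> is_diagram (shape d).
Proof.
move=> pd; apply/allP => -[i j]; rewrite mem_shape /= => /and3P[iM jM h].
rewrite !mem_shape /=.
have [hi hj] : (i.-1 < M)%N /\ (j.-1 < M)%N by lia.
have [_ _ H] := pd.
rewrite hi hj iM jM /=; apply/andP; split.
- case: i iM h hi => // i iM h hi; rewrite /content /= in h *.
  have E : (j + M - i = (j + M - i.+1).+1)%N by lia.
  rewrite E; have /H : (j + M - i.+1 < 2 * M)%N by lia.
  by case: ifP => ?; lia.
- case: j jM h hj => // j jM h hj; rewrite /content /= in h *.
  have E : (j.+1 + M - i = (j + M - i).+1)%N by lia.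
  rewrite E in h; have /H : (j + M - i < 2 * M)%N by lia.
  by case: ifP => ?; lia.
Qed.

Lemma profile_bound d k : profile d -> (k <= 2 * M)%N ->
  (d k <= k)%N /\ (d k + k <= 2 * M)%N.
Proof.
move=> [d0 dM H] kM; split.
  elim: k kM => [|k IH] kM; first by rewrite d0.
  by have := H _ kM; have := IH (ltnW kM); case: ifP; lia.
have [m mE] : exists m, (k + m = 2 * M)%N by exists (2 * M - k)%N; lia.
elim: m k kM mE => [|m IH] k kM mE; first by rewrite addn0 in mE; rewrite mE dM; lia.
have /H : (k < 2 * M)%N by lia.
have : (d k.+1 + k.+1 <= 2 * M)%N by apply: IH; lia.
by case: ifP; lia.
Qed.

Lemma dg_shape d k : profile d -> (k <= 2 * M)%N -> dg (shape d) k = d k.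
Proof.
move=> pd kM; have dS := shape_diagram pd; have bS := @shape_in_box d.
have E t : (t < dg (shape d) k)%N = (t < d k)%N.
  rewrite -mem_dg // mem_shape content_cellat /=.
  have [b1 b2] := profile_bound pd kM.
  apply/and3P/idP => [[_ _]|h]; first by lia.
  by split; lia.
apply/eqP; rewrite eqn_leq; apply/andP; split; rewrite leqNgt.
- by rewrite E ltnn.
- by rewrite -E ltnn.
Qed.

End Box.

(** * Ribbons as moves of beads *)

Lemma skew_convex (S : {fset cell}) r1 c1 r2 c2 r c : is_skew S ->
  (r1, c1) \in S -> (r2, c2) \in S -> (r1 <= r <= r2)%N -> (c1 <= c <= c2)%N ->
  (r, c) \in S.
Proof.
move=> [la [mu [_ ->]]]; rewrite !in_fsetD => /andP[n1 m1] /andP[n2 m2].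
move=> /andP[r1r rr2] /andP[c1c cc2]; apply/andP; split.
  by apply: contraNN n1 => h; apply: diagram_le h _ _ => //; apply: diagramP.
by apply: diagram_le m2 _ _ => //; apply: diagramP.
Qed.

Lemma crossing (S : {fset cell}) (P : pred cell) (c d : cell) :
  connected_shape S -> c \in S -> d \in S -> P c -> ~~ P d ->
  exists a b, [/\ a \in S, b \in S, adjacent a b, P a & ~~ P b].
Proof.
move=> cS cs ds Pc Pd; have := cS [` cs] [` ds]; move=> /connectP[p].
have : P (val [` cs]) by [].
move: [` cs] => x Px pth E; have : ~~ P (val (last x p)) by rewrite -E.
elim: p x Px pth {E} => [|y p IH] x Px /=; first by rewrite Px.
move=> /andP[xy pth] h; case Py: (P (val y)); first exact: IH pth h.
by exists (val x), (val y); split; rewrite ?Py ?fsvalP.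
Qed.

Section Ribbons.
Variables (M n : nat).
Hypothesis n0 : (0 < n)%N.
Implicit Types (A S : {fset cell}).
Local Notation content := (content M).
Local Notation in_box := (in_box M).

Definition segment (k0 : nat) A : Prop :=
  [/\ forall c, c \in A -> (k0 < content c <= k0 + n)%N,
      forall k, (k0 < k <= k0 + n)%N -> exists2 c, c \in A & content c = k
    & forall c c', c \in A -> c' \in A -> content c = content c' -> c = c'].

(** Two cells on the same diagonal of a skew shape span a rectangle inside it, hence a 2 x 2
    square. *)
Lemma content_inj_skew A c c' : in_box A -> is_skew A -> ~ has_square A ->
  c \in A -> c' \in A -> content c = content c' -> c = c'.
Proof.
case: c c' => i j [i' j'] bA sA nA cA cA' E.
wlog ii' : i j i' j' cA cA' E / (i <= i')%N => [H|].
  by case/orP: (leq_total i i') => h; [apply: H | apply/esym/H].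
have [/= b1 b2] := bA _ cA; have [/= b3 b4] := bA _ cA'.
rewrite !/(content _) /= in E.
case: (ltnP i i') => [lt|ge]; last by congr pair; lia.
case: nA; exists i, j; split=> //;
  apply: (@skew_convex A i j i' j') => //; lia.
Qed.

Lemma adjacent_content c d : (c.1 < M)%N -> (d.1 < M)%N -> adjacent c d ->
  (content d = (content c).+1) \/ (content c = (content d).+1).
Proof.
case: c d => [i j] [i' j'] /= iM iM'; rewrite /adjacent !/(content _) /=.
by lia.
Qed.

Lemma crossing_content A k c d : in_box A -> connected_shape A ->
  c \in A -> d \in A -> (content c <= k)%N -> (k < content d)%N ->
  exists a b, [/\ a \in A, b \in A, adjacent a b, content a = k
                & content b = k.+1].
Proof.
move=> bA kA cA dA ck kd.
have [||a [b [aA bA' ab ak bk]]] :=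
  @crossing A (fun e => (content e <= k)%N) c d kA cA dA => //.
  by rewrite -ltnNge.
have [a1 _] := bA _ aA; have [b1 _] := bA _ bA'.
exists a, b; split=> //; have := adjacent_content a1 b1 ab; lia.
Qed.

(** Connectedness leaves no gap among the contents, and the absence of squares no repetition, so n
    cells occupy n consecutive diagonals. *)
Lemma ribbon_segment A : in_box A -> is_ribbon n A ->
  exists2 k0, segment k0 A & forall c c', c \in A -> c' \in A ->
    content c' = (content c).+1 -> adjacent c c'.
Proof.
move=> bA [sA kA nA sqA].
have inj c c' : c \in A -> c' \in A -> content c = content c' -> c = c'.
  exact: content_inj_skew.
pose cs := [seq content c | c <- enum_fset A].
have mem_cs k : reflect (exists2 c, c \in A & content c = k) (k \in cs).
  by apply: (iffP mapP) => [[c cA ->]|[c cA <-]]; exists c.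
have scs : size cs = n by rewrite size_map -nA cardfE cardE.
have ucs : uniq cs.
  by rewrite map_inj_in_uniq ?fset_uniq // => c c' cA cA'; apply: inj.
have ex : exists k, k \in cs.
  case: (cs) scs => [|k s] //= => [E|_]; last by exists k; rewrite inE eqxx.
  by move: n0; rewrite -E.
have ub k : k \in cs -> (k <= 2 * M)%N.
  by move=> /mem_cs[c /bA[c1 c2] <-]; apply: content_le.
have mn := ex_minnP ex; have mx := ex_maxnP ex ub.
case: mn => a acs amin; case: mx => b bcs bmax.
have all_k k : (a <= k <= b)%N -> k \in cs.
  move=> /andP[ak kb]; have [c cA cE] := mem_cs _ acs; have [d dA dE] := mem_cs _ bcs.
  move: kb; rewrite leq_eqVlt => /predU1P[->//|kb].
  have [||u [v [uA _ _ uE _]]] := @crossing_content A k c d bA kA cA dA.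
  - by rewrite cE.
  - by rewrite dE.
  - by apply/mem_cs; exists u.
have ab : (a <= b)%N by apply: amin.
have pcs : perm_eq cs (iota a (b - a).+1).
  apply: uniq_perm => //; first exact: iota_uniq.
  move=> k; rewrite mem_iota; apply/idP/idP => [kcs|h].
    by have := amin _ kcs; have := bmax _ kcs; lia.
  by apply: all_k; lia.
have nE : n = (b - a).+1 by rewrite -scs (perm_size pcs) size_iota.
have a0 : (0 < a)%N.
  have [c /bA[c1 c2] <-] := mem_cs _ acs.
  by have /andP[] := content_bound c1 c2.
(* Contents are positive in the box, and bit [a.-1] is the edge between the diagonals a - 1 and a,
   that is, the bead to be moved. *)
exists a.-1.
- split=> // [c cA|k kab].
    have kcs : content c \in cs by apply/mem_cs; exists c.
    by have := amin _ kcs; have := bmax _ kcs; lia.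
  by apply/mem_cs/all_k; lia.
- move=> c c' cA cA' E.
  have [||u [v [uA vA uv uE vE]]] :=
    @crossing_content A (content c) c c' bA kA cA cA'; rewrite ?E //.
  by rewrite (inj c u) // (inj c' v) // vE E.
Qed.

Lemma ribbon_next A k0 c : in_box A -> segment k0 A ->
  (forall c c', c \in A -> c' \in A ->
    content c' = (content c).+1 -> adjacent c c') ->
  c \in A -> (content c < k0 + n)%N ->
  exists c', [/\ c' \in A, content c' = (content c).+1 &
    c' = (c.1, c.2.+1) \/ (c.1 = c'.1.+1 /\ c'.2 = c.2)].
Proof.
move=> bA [h1 h2 h3] hadj cA ck.
have /h2[c' cA' E] : (k0 < (content c).+1 <= k0 + n)%N.
  by have := h1 _ cA; lia.
exists c'; split=> //; have := hadj _ _ cA cA' E.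
have [c1 _] := bA _ cA; have [c1' _] := bA _ cA'.
case: c c' E c1 c1' {cA cA' ck} => i j [i' j'] /=.
rewrite /adjacent !/(content _) /= => E c1 c1' h.
have [[-> ->]|[-> ->]] : (i' = i /\ j' = j.+1) \/ (i = i'.+1 /\ j' = j) by lia.
- by left.
- by right.
Qed.

End Ribbons.

(** A discrete intermediate value property, used to count the rows that a ribbon meets. *)
Lemma stairs (rho : nat -> nat) (b : pred nat) a m :
  (forall i, (i < m)%N -> rho (a + i)%N = (rho (a + i).+1 + b (a + i))%N) ->
  rho a = (rho (a + m) + count b (iota a m))%N /\
  forall v, (rho (a + m) <= v <= rho a)%N ->
    exists2 i, (i <= m)%N & rho (a + i)%N = v.
Proof.
elim: m => [|m IH] H.
  by rewrite !addn0; split=> // v v1; exists 0%N => //; rewrite addn0; lia.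
have [i im|E1 E2] := IH; first by apply: H; lia.
have h := H m (leqnn _); rewrite -[in iota _ _]addn1 iotaD count_cat /= addn0 addnS.
split; first by rewrite E1 h; lia.
move=> v v1; have [v2|v2] := leqP (rho (a + m)%N) v; last first.
  by exists m.+1 => //; rewrite addnS; move: h; case: (b _) => /=; lia.
by have [|i im <-] := E2 v; [lia | exists i => //; lia].
Qed.

Section Boxed.
Variables (M n : nat).
Hypothesis n0 : (0 < n)%N.
Implicit Types (A S D : {fset cell}).
Local Notation content := (content M).
Local Notation in_box := (in_box M).
Local Notation segment := (segment M n).
Local Notation bits := (bits M).
Local Notation bit := (bit M).
Local Notation dg := (dg M).

Lemma nth_bits D e : (e < 2 * M)%N -> nth false (bits D) e = bit (dg D) e.
Proof. by move=> eM; rewrite nth_mkseq. Qed.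

Lemma size_bits D : size (bits D) = (2 * M)%N.
Proof. exact: size_mkseq. Qed.

Lemma cellat_inj k t t' : cellat M k t = cellat M k t' -> t = t'.
Proof. by case=> /addIn. Qed.

Lemma dg_sub D D' k : is_diagram D -> in_box D -> is_diagram D' -> in_box D' ->
  D `<=` D' -> (dg D k <= dg D' k)%N.
Proof.
move=> dD bD dD' bD' /fsubsetP sub; rewrite leqNgt; apply/negP.
by rewrite -mem_dg // => /sub; rewrite mem_dg // ltnn.
Qed.

Section Step.
Variables (nu la : {fset cell}) (k0 : nat).
Hypotheses (dnu : is_diagram nu) (bnu : in_box nu).
Hypotheses (dla : is_diagram la) (bla : in_box la).
Hypothesis sub : nu `<=` la.

Lemma mem_diff k t :
  (cellat M k t \in la `\` nu) = (dg nu k <= t < dg la k)%N.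
Proof. by rewrite in_fsetD !mem_dg // -leqNgt. Qed.

Lemma segment_dg k : segment k0 (la `\` nu) ->
  dg la k = (dg nu k + (k0 < k <= k0 + n))%N.
Proof.
move=> [h1 h2 h3]; have le : (dg nu k <= dg la k)%N by apply: dg_sub.
case: (boolP (k0 < k <= k0 + n)%N) => kk; last first.
  rewrite addn0; apply/eqP; rewrite eqn_leq le andbT leqNgt; apply: contra kk => lt.
  have /h1 : cellat M k (dg nu k) \in la `\` nu by rewrite mem_diff leqnn.
  by rewrite content_cellat.
have [c cA cE] := h2 _ kk; have /fsetDP[/bla[c1 _] _] := cA.
move: cA; rewrite (cellat_content c1) cE mem_diff => h.
apply/eqP; rewrite eqn_leq addn1; apply/andP; split; last by lia.
rewrite leqNgt; apply/negP => lt.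
have := h3 (cellat M k (dg nu k)) (cellat M k (dg nu k).+1).
rewrite !mem_diff !content_cellat => /(_ _ _ erefl) H.
have /cellat_inj : cellat M k (dg nu k) = cellat M k (dg nu k).+1.
  by apply: H; lia.
by lia.
Qed.

End Step.

Lemma bits_add (d d' : nat -> nat) k0 : profile M d -> profile M d' ->
  (k0 < 2 * M)%N ->
  (forall k, (k <= 2 * M)%N -> d' k = (d k + (k0 < k <= k0 + n))%N) ->
  can n k0 (mkseq (bit d) (2 * M)) /\
  mkseq (bit d') (2 * M) = mv n k0 (mkseq (bit d) (2 * M)).
Proof.
move=> pd pd' k0M dE.
have k0n : (k0 + n < 2 * M)%N.
  rewrite ltnNge; apply/negP => h; have [_ E' _] := pd'; have [_ E _] := pd.
  by have := dE _ (leqnn _); rewrite E E'; lia.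
have bE e : (e < 2 * M)%N ->
   (bit d' e + (k0 < e.+1 <= k0 + n) = bit d e + (k0 < e <= k0 + n))%N.
  move=> eM; have := bitE pd eM; have := bitE pd' eM.
  by rewrite !dE ?(ltnW eM) //; lia.
have ck : can n k0 (mkseq (bit d) (2 * M)).
  rewrite /can size_mkseq !nth_mkseq // k0n.
  have := bE _ k0M; have := bE _ k0n; move: (bit d k0) (bit d (k0 + n)).
  by move: (bit d' k0) (bit d' (k0 + n)) => [] [] [] [] //=; lia.
split=> //; apply: (@eq_from_nth _ false); first by rewrite size_mv // !size_mkseq.
move=> e; rewrite size_mkseq => eM; rewrite nth_mv !nth_mkseq //.
move: ck; rewrite /can size_mkseq !nth_mkseq // => /and3P[b1 _ b2].
have := bE _ eM; case: eqP => [->|e1].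
  by move: b2; case: (bit d (k0 + n)) => //; case: (bit d' _) => //=; lia.
case: eqP => [->|e2].
  by rewrite b1; case: (bit d' _) => //=; lia.
by case: (bit d e); case: (bit d' e) => //=; lia.
Qed.

Lemma jmp_bits D k0 : (k0 + n < 2 * M)%N ->
  jmp n k0 (bits D) = count (bit (dg D)) (iota k0.+1 n.-1).
Proof.
move=> h; rewrite /jmp !/(bits _) /mkseq -map_drop -map_take count_map.
rewrite drop_iota take_iota add0n.
by have -> : minn n.-1 (2 * M - k0.+1) = n.-1 by lia.
Qed.

Lemma segment_lt A k0 : in_box A -> segment k0 A -> (k0 < 2 * M)%N.
Proof.
move=> bA [_ h2 _]; have [|c /bA[c1 c2] cE] := h2 k0.+1; first by lia.
by have := content_bound c1 c2; rewrite cE; lia.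
Qed.

Lemma in_box_diff D S : in_box D -> in_box (D `\` S).
Proof. by move=> bD c /fsetDP[/bD]. Qed.

Lemma ribbon_step nu la k0 : is_diagram nu -> in_box nu -> is_diagram la ->
  in_box la -> nu `<=` la -> segment k0 (la `\` nu) ->
  [/\ can n k0 (bits nu), bits la = mv n k0 (bits nu)
    & spin (la `\` nu) = jmp n k0 (bits nu)].
Proof.
move=> dnu bnu dla bla sub seg.
have k0M : (k0 < 2 * M)%N by apply: segment_lt seg; apply: in_box_diff.
have pnu := dg_profile dnu bnu; have pla := dg_profile dla bla.
have dE k : dg la k = (dg nu k + (k0 < k <= k0 + n))%N by apply: segment_dg.
have [ck bE] := bits_add pnu pla k0M (fun k _ => dE k).
split=> //; have k0n : (k0 + n < 2 * M)%N.
  by have /and3P[] := ck; rewrite size_mkseq.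
rewrite jmp_bits //.
(* The row of the cell added on diagonal k. From one diagonal to the next it drops by 1 at a bead
   and is constant otherwise, so the spin counts the beads jumped over. *)
pose rho k := (dg nu k + (M - k))%N.
have E0 i : (i < n.-1)%N -> rho (k0.+1 + i)%N =
    (rho (k0.+1 + i).+1 + bit (dg nu) (k0.+1 + i))%N.
  move=> im; rewrite /rho; have /(bitE pnu) : (k0.+1 + i < 2 * M)%N by lia.
  by case: (bit _ _) => /=; lia.
have [E1 E2] := stairs E0.
rewrite /spin /nrows.
have -> : [fset c.1 | c in la `\` nu] = [fset r in
    iota (rho (k0.+1 + n.-1)%N) (count (bit (dg nu)) (iota k0.+1 n.-1)).+1].
  have rowE k : (k0 < k <= k0 + n)%N ->
      cellat M k (dg nu k) \in la `\` nu /\ (cellat M k (dg nu k)).1 = rho k.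
    by move=> kk; rewrite mem_diff // dE kk leqnn addn1 leqnn.
  apply/fsetP => r; rewrite !inE /= mem_iota; apply/imfsetP/idP => /=.
    move=> [c cA ->]; have [h1 _ h3] := seg; have kk := h1 _ cA.
    have [c1 c2] := rowE _ kk.
    have -> : c = cellat M (content c) (dg nu (content c)).
      by apply: h3; rewrite // content_cellat.
    rewrite c2; have [] := @stairs rho (bit (dg nu)) k0.+1 (content c - k0.+1).
      by move=> i ilt; apply: E0; lia.
    have [] := @stairs rho (bit (dg nu)) (content c) (k0 + n - content c).
      move=> i ilt; have -> : (content c + i = k0.+1 + (content c - k0.+1 + i))%N by lia.
      by apply: E0; lia.
    have -> : (k0.+1 + (content c - k0.+1) = content c)%N by lia.
    have -> : (content c + (k0 + n - content c) = k0.+1 + n.-1)%N by lia.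
    by lia.
  move=> h; have [|i im rE] := E2 r; first by lia.
  have [|c1 c2] := rowE (k0.+1 + i)%N; first by lia.
  by exists (cellat M (k0.+1 + i) (dg nu (k0.+1 + i))); rewrite // c2.
by rewrite card_fseq undup_id ?iota_uniq // size_iota.
Qed.

End Boxed.

Section Adding.
Variables (M n : nat).
Hypothesis n0 : (0 < n)%N.
Implicit Types (A S D : {fset cell}).
Local Notation content := (content M).
Local Notation in_box := (in_box M).
Local Notation segment := (segment M n).
Local Notation bits := (bits M).
Local Notation bit := (bit M).
Local Notation dg := (dg M).

Lemma adjacentC c d : adjacent c d = adjacent d c.
Proof.
rewrite /adjacent (eq_sym c.1) (eq_sym c.2).
by congr orb; congr andb; apply: orbC.
Qed.

Lemma segment_ribbon A k0 : in_box A -> is_skew A -> segment k0 A ->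
  (forall c c', c \in A -> c' \in A ->
     content c' = (content c).+1 -> adjacent c c') ->
  is_ribbon n A.
Proof.
move=> bA sA [h1 h2 h3] adj; split=> //.
- have conn m : forall c d : A, content (val d) = (content (val c) + m)%N ->
      connect (fun a b : A => adjacent (val a) (val b)) c d.
    elim: m => [|m IH] c d E.
      have -> : c = d by apply/val_inj/h3; rewrite ?fsvalP // E addn0.
      exact: connect0.
    have [|e eA eE] := h2 (content (val c) + m)%N.
      by have := h1 (val c) (fsvalP c); have := h1 (val d) (fsvalP d); lia.
    apply: (connect_trans (y := [` eA])); first exact: IH.
    by apply: connect1; apply: adj; rewrite ?fsvalP //= eE E addnS.
  move=> c d; have [/subnKC E|/ltnW/subnKC E] := leqP (content (val c)) (content (val d)).
    by apply: (conn (content (val d) - content (val c))%N); rewrite E.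
  have sy : ssrbool.symmetric (fun a b : A => adjacent (val a) (val b)).
    by move=> a b; apply: adjacentC.
  rewrite (sym_connect_sym sy).
  by apply: (conn (content (val c) - content (val d))%N); rewrite E.
- have inj : {in enum_fset A &, injective content} by move=> c d; apply: h3.
  rewrite -(size_map content) -(size_iota k0.+1 n); apply: perm_size.
  apply: uniq_perm; rewrite ?iota_uniq ?map_inj_in_uniq ?fset_uniq //.
  move=> k; rewrite mem_iota; apply/mapP/idP => [[c cA ->]|kk].
    by have := h1 _ cA; lia.
  by have [|c cA <-] := h2 k; [lia | exists c].
- move=> [i [j [cA _ _ dA]]].
  by have [/n_Sn] := h3 _ _ cA dA erefl.
Qed.

(** A bead at [k0] and a gap at [k0 + n] are what keeps the raised diagonal lengths a profile; the
    new diagram is then read off from them. *)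
Lemma add_segment nu k0 : is_diagram nu -> in_box nu -> can n k0 (bits nu) ->
  exists la, [/\ is_diagram la, in_box la, nu `<=` la,
    bits la = mv n k0 (bits nu) & segment k0 (la `\` nu) /\ is_ribbon n (la `\` nu)].
Proof.
move=> dnu bnu ck; have pnu := dg_profile dnu bnu.
pose d' k := (dg nu k + (k0 < k <= k0 + n))%N.
have /and3P[b1 lt b2] := ck; rewrite size_bits in lt.
have k0M : (k0 < 2 * M)%N by lia.
rewrite !nth_bits // in b1 b2.
have B1 := bitE pnu k0M; have B2 := bitE pnu lt; rewrite b1 (negbTE b2) /= in B1 B2.
have pd : profile M d'.
  have [d0 dM H] := pnu; split; rewrite /d' ?d0 ?dM; try lia.
  move=> e eM; have := H e eM; case: (eqVneq e k0) => [->|e1].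
    by case: ifP B1 => ? /=; lia.
  case: (eqVneq e (k0 + n)%N) => [->|e2]; first by case: ifP B2 => ? /=; lia.
  by case: ifP => ?; lia.
pose la := shape M d'.
have dla : is_diagram la by apply: shape_diagram.
have bla : in_box la by apply: shape_in_box.
have dE k : (k <= 2 * M)%N -> dg la k = d' k by apply: dg_shape.
have sub : nu `<=` la.
  apply/fsubsetP => c cnu; have [c1 c2] := bnu _ cnu.
  have ck2 : (content c <= 2 * M)%N by apply: content_le.
  move: cnu; rewrite (mem_dgE dnu bnu c1) (mem_dgE dla bla c1) dE // /d'.
  by move/leq_trans; apply; apply: leq_addr.
have bA : in_box (la `\` nu) by apply: in_box_diff.
have memA k t : (k <= 2 * M)%N -> (cellat M k t \in la `\` nu) =
    (k0 < k <= k0 + n)%N && (t == dg nu k).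
  by move=> kM; rewrite mem_diff // dE // /d'; case: (_ < _ <= _)%N => /=; lia.
have cellA c : c \in la `\` nu -> (k0 < content c <= k0 + n)%N /\
    c = cellat M (content c) (dg nu (content c)).
  move=> cA; have [c1 c2] := bA _ cA.
  move: (cA); rewrite {1}(cellat_content c1) memA ?content_le //.
  by move=> /andP[kk /eqP E]; split=> //; rewrite -E -cellat_content.
have seg : segment k0 (la `\` nu).
  split=> [c /cellA[]//|k kk|c c' /cellA[_ E] /cellA[_ E'] Ec].
    exists (cellat M k (dg nu k)); last exact: content_cellat.
    by rewrite memA ?kk ?eqxx //; lia.
  by rewrite E E' Ec.
exists la; split=> //.
  have [_ <-] := bits_add n0 pnu pd k0M (fun k _ => erefl).
  apply/eq_in_map => e; rewrite mem_iota add0n => /andP[_ eM].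
  by rewrite /bit !dE //; lia.
split=> //; apply: (segment_ribbon bA _ seg).
  by exists (Young dla), (Young dnu).
move=> c c' /cellA[kk ->] /cellA[kk' ->]; rewrite !content_cellat => E.
rewrite E in kk' *; have /(bitE pnu) : (content c < 2 * M)%N by lia.
rewrite /adjacent /=; case: (bit _ _) => /=; case: (ltnP (content c) M) => ? /=; lia.
Qed.

End Adding.

(** * Horizontal ribbon strips as sequences of moves *)

Section Tilings.
Variables (M n : nat).
Hypothesis n0 : (0 < n)%N.
Implicit Types (A B S D mu la : {fset cell}) (P : {fset {fset cell}}).
Local Notation content := (content M).
Local Notation in_box := (in_box M).
Local Notation segment := (segment M n).
Local Notation bits := (bits M).

(* [reach i l l' m s]: some of the moves at positions below [i], attempted from
   left to right, lead from [l] to [l']; [m] of them are made, of total spin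
   [s]. *)
Inductive reach : nat -> seq bool -> seq bool -> nat -> nat -> Prop :=
| reach0 l : reach 0 l l 0 0
| reach_stay i l l' m s : reach i l l' m s -> reach i.+1 l l' m s
| reach_move i l l' m s : reach i l l' m s -> can n i l' ->
    reach i.+1 l (mv n i l') m.+1 (s + jmp n i l').

Lemma reach0E l l' m s : reach 0 l l' m s -> [/\ l' = l, m = 0%N & s = 0%N].
Proof.
move=> H; have : forall i, reach i l l' m s -> i = 0%N ->
  [/\ l' = l, m = 0%N & s = 0%N] by move=> i; case.
by move/(_ 0%N H erefl).
Qed.

Lemma reachSE i l l' m s : reach i.+1 l l' m s -> reach i l l' m s \/
  exists l'' m' s', [/\ reach i l l'' m' s', can n i l'', l' = mv n i l'',
                        m = m'.+1 & s = (s' + jmp n i l'')%N].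
Proof.
move=> H; have : forall j, reach j l l' m s -> j = i.+1 -> reach i l l' m s \/
  exists l'' m' s', [/\ reach i l l'' m' s', can n i l'', l' = mv n i l'',
                        m = m'.+1 & s = (s' + jmp n i l'')%N].
  move=> j; case=> // {}j ? l1 m1 s1 H1; first by case=> <-; left.
  by move=> c [jE]; right; exists l1, m1, s1; rewrite -jE.
by move/(_ _ H erefl).
Qed.

(* Later moves do not touch the positions below [i]. *)
Lemma reach_det i l l1 m1 s1 l2 m2 s2 :
  reach i l l1 m1 s1 -> reach i l l2 m2 s2 ->
  (forall j, (j < i)%N -> nth false l1 j = nth false l2 j) ->
  [/\ l1 = l2, m1 = m2 & s1 = s2].
Proof.
elim: i l1 m1 s1 l2 m2 s2 => [|i IH] l1 m1 s1 l2 m2 s2.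
  by move=> /reach0E[-> -> ->] /reach0E[-> -> ->].
have low l' j : (j < i)%N -> nth false (mv n i l') j = nth false l' j.
  move=> ji; rewrite nth_mv; case: eqP => [?|_]; first by lia.
  by case: eqP => [?|_] //; lia.
have at_i l' : can n i l' -> nth false (mv n i l') i = false /\ nth false l' i.
  by case/and3P=> h _ _; rewrite nth_mv eqxx; case: eqP => // ?; lia.
move=> /reachSE[r1|[a [ma [sa [r1 c1 -> -> ->]]]]]
       /reachSE[r2|[b [mb [sb [r2 c2 -> -> ->]]]]] E.
- by apply: IH r1 r2 _ => j ji; apply: E; apply: ltnW.
- have [Eb _ _] := IH _ _ _ _ _ _ r1 r2 (fun j ji =>
    etrans (E j (ltnW ji)) (low b j ji)).
  by have := E i (leqnn _); have [-> ] := at_i _ c2; rewrite Eb => ->.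
- have [Ea _ _] := IH _ _ _ _ _ _ r1 r2 (fun j ji =>
    etrans (esym (low a j ji)) (E j (ltnW ji))).
  by have := E i (leqnn _); have [-> ] := at_i _ c1; rewrite Ea => ->.
- have [] := IH _ _ _ _ _ _ r1 r2; last by move=> -> -> ->.
  by move=> j ji; have := E j (ltnW ji); rewrite !low.
Qed.

Lemma head_toprightmost A k0 h : in_box A -> segment k0 A ->
  (forall c c', c \in A -> c' \in A ->
    content c' = (content c).+1 -> adjacent c c') ->
  h \in A -> content h = (k0 + n)%N -> toprightmost A h.
Proof.
move=> bA seg adj hA hE; split=> // d dA.
have [h1 _ h3] := seg.
have [m] : exists m, (content d + m = k0 + n)%N.
  by exists (k0 + n - content d)%N; have := h1 _ dA; lia.
elim: m d dA => [|m IH] d dA dE.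
  by rewrite (h3 _ _ dA hA) //; lia.
have [|e [eA eE]] := ribbon_next n0 bA seg adj dA; first by lia.
have [|e1 e2] := IH _ eA; first by lia.
case=> [E|[E1 E2]].
  by move: e1 e2; rewrite E /= => e1 e2; split=> //; apply: ltnW.
by rewrite E1 -E2; split=> //; apply: leqW.
Qed.

Lemma toprightmost_head A k0 c : in_box A -> segment k0 A ->
  toprightmost A c -> content c = (k0 + n)%N.
Proof.
move=> bA [h1 h2 _] [cA top].
have [|d dA dE] := h2 (k0 + n)%N; first by lia.
have := h1 _ cA; have := top _ dA; have [] := bA _ cA; have [] := bA _ dA.
by move: dE; case: c d {cA dA top} => [i j] [i' j']; rewrite !/(content _) /=; lia.
Qed.

Section Removal.
Variables (mu la : {fset cell}) (P : {fset {fset cell}}).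
Hypotheses (dmu : is_diagram mu) (dla : is_diagram la) (bla : in_box la).
Hypothesis sub : mu `<=` la.
Hypothesis tP : is_horizontal_tiling n (la `\` mu) P.

Lemma tile_sub A c : A \in P -> c \in A -> c \in la `\` mu.
Proof. by have [[_ _ cov] _] := tP => AP cA; apply/cov; exists A. Qed.

Lemma tile_box A : A \in P -> in_box A.
Proof. by move=> AP c /(tile_sub AP) /fsetDP[/bla]. Qed.

Lemma tile_segment A : A \in P -> exists2 k0, segment k0 A &
  forall c c', c \in A -> c' \in A ->
    content c' = (content c).+1 -> adjacent c c'.
Proof.
move=> AP; apply: ribbon_segment => //; first exact: tile_box.
by have [[h _ _] _] := tP; apply: h.
Qed.

Lemma diff_convex c d x : c \in la `\` mu -> d \in la `\` mu ->
  (c.1 <= x.1 <= d.1)%N -> (c.2 <= x.2 <= d.2)%N -> x \in la `\` mu.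
Proof.
case: c d x => [i j] [i' j'] [a b]; apply: skew_convex.
by exists (Young dla), (Young dmu).
Qed.

(** By convexity the square just above [b] would lie in the strip, although [b] is the topright-most
    square of its ribbon. *)
Lemma not_below_head B b a k : B \in P -> segment k B -> b \in B ->
  content b = (k + n)%N -> a \in la `\` mu -> content a = content b ->
  (a.1 < b.1)%N -> False.
Proof.
move=> BP seg bB bE aS abE lt.
have [k' seg' adj] := tile_segment BP.
have bB' := tile_box BP.
have kk : k = k'.
  have [h1 h2 _] := seg; have [h1' h2' _] := seg'.
  have := h1' _ bB; rewrite bE.
  have [|c cB cE] := h2' (k' + n)%N; first by lia.
  by have := h1 _ cB; rewrite cE; lia.
have top : toprightmost B b by apply: head_toprightmost seg adj bB bE; rewrite ?kk.
have [_ /(_ B b BP top)] := tP; case E : b.1 lt => [//|r] lt /(_ r erefl) /negP; apply.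
have [a1 a2] : (a.1 < M)%N /\ (a.2 < M)%N by move: aS => /fsetDP[/bla].
have [b1 b2] := bB' _ bB.
apply: (diff_convex aS (tile_sub BP bB)); rewrite /= ?E.
- by apply/andP; split; [exact: lt | exact: leqnSn].
- by move: abE a1 b1 E lt; case: (a) (b) => [i j] [i' j']; rewrite !/(content _) /=; lia.
Qed.

(** Follow both ribbons towards larger contents, one diagonal at a time. Rows drop by at most 1 and
    disjoint ribbons share no cell, so [A] stays above [B] up to the head of [B], where
    [not_below_head] applies. *)
Lemma deeper_false A B kA kB a b : A \in P -> B \in P -> A <> B ->
  segment kA A -> segment kB B -> (kB <= kA)%N ->
  a \in A -> b \in B -> content a = content b -> (a.1 < b.1)%N -> False.
Proof.
move=> AP BP AB segA segB kk aA bB.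
have [[_ dis _] _] := tP.
have nAB c : c \in A -> c \in B -> False.
  by move=> cA cB; have /fdisjointP/(_ _ cA)/negP := dis _ _ AP BP AB.
have adj C k c : C \in P -> segment k C -> c \in C -> (content c < k + n)%N ->
    exists c', [/\ c' \in C, content c' = (content c).+1 &
    c' = (c.1, c.2.+1) \/ (c.1 = c'.1.+1 /\ c'.2 = c.2)].
  move=> CP seg cC ck; have [k' seg' ad] := tile_segment CP.
  exact: (ribbon_next n0 (tile_box CP) seg ad cC ck).
have [m mE] : exists m, (content b + m = kB + n)%N.
  by exists (kB + n - content b)%N; have [h _ _] := segB; have := h _ bB; lia.
elim: m a b mE aA bB => [|m IH] a b mE aA bB E lt.
  apply: (not_below_head BP segB bB _ (tile_sub AP aA) E lt); lia.
have [|a' [a'A a'E ha]] := adj _ _ _ AP segA aA; first by lia.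
have [|b' [b'B b'E hb]] := adj _ _ _ BP segB bB; first by lia.
apply: (IH a' b' _ a'A b'B); rewrite ?a'E ?b'E ?E //; first by lia.
have nE : a' <> b' by move=> e; apply: (nAB a'); rewrite // e.
rewrite ltn_neqAle; apply/andP; split; last first.
  have ha1 : (a'.1 <= a.1)%N by case: ha => [->|[-> _]].
  have hb1 : (b.1 <= b'.1.+1)%N by case: hb => [->|[-> _]].
  by rewrite -ltnS; apply: leq_ltn_trans ha1 _; apply: leq_trans lt hb1.
apply/eqP => r; apply: nE.
have [a1 _] := tile_box AP a'A; have [b1 _] := tile_box BP b'B.
have : content a' = content b' by rewrite a'E b'E E.
move: a1 b1 r; case: (a') (b') => [i j] [i' j']; rewrite !/(content _) /=.
by move=> ? ? -> ?; congr pair; lia.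
Qed.

End Removal.

End Tilings.

Section TilingReach.
Variables (M n : nat).
Hypothesis n0 : (0 < n)%N.
Implicit Types (A B S D mu la : {fset cell}) (P : {fset {fset cell}}).
Local Notation content := (content M).
Local Notation in_box := (in_box M).
Local Notation segment := (segment M n).
Local Notation bits := (bits M).

Lemma segment_head k A : segment k A -> exists2 h, h \in A & content h = (k + n)%N.
Proof. by move=> [_ h2 _]; apply: h2; rewrite leqnn andbT -addn1 leq_add2l. Qed.

Lemma segment_le k A c : segment k A -> c \in A -> (content c <= k + n)%N.
Proof. by move=> [h1 _ _] /h1 /andP[]. Qed.

Lemma content_right (c : cell) : (c.1 < M)%N ->
  content (c.1, c.2.+1) = (content c).+1.
Proof. by move=> h; rewrite !/(content _) /= addSn subSn // (leq_trans (ltnW h)) ?leq_addl. Qed.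

Lemma content_above (c : cell) r : (c.1 < M)%N -> c.1 = r.+1 ->
  content (r, c.2) = (content c).+1.
Proof.
move=> h E; rewrite !/(content _) /= E subnSK //.
by rewrite -E (leq_trans (ltnW h)) ?leq_addl.
Qed.

Lemma same_content (a b : cell) : (a.1 < M)%N -> content a = content b ->
  a.1 = b.1 -> a = b.
Proof.
case: a b => [x y] [x' y'] /= xM; rewrite !/(content _) /= => E xx.
by subst x'; congr pair; clear -E xM; lia.
Qed.

(** Suppose a cell [x] of another tile [B] is right of or below a cell [c0] of [A]. If it is to the
    right, the next cell of [A] lies above it on the same diagonal. If it is below and not the head
    of [B], the next cell of [B] is either [c0] or lies under it on its diagonal. If it is the head
    of [B], it does not touch the northern edge. All of these are impossible, as no tile reaches
    further than [A]. *)
Lemma tile_removable mu la P A i : is_diagram mu -> is_diagram la ->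
  in_box la -> mu `<=` la -> is_horizontal_tiling n (la `\` mu) P ->
  A \in P -> segment i A ->
  (forall c, c \in la `\` mu -> (content c < i.+1 + n)%N) ->
  is_diagram (la `\` A).
Proof.
move=> dmu dla bla sub tP AP seg top.
have bA := tile_box bla tP AP.
have [k0' seg' adjA] := tile_segment n0 bla tP AP.
have [[_ dis cov] hor] := tP.
have key c0 x : c0 \in A -> x \in la -> x \notin A ->
    x = (c0.1, c0.2.+1) \/ x = (c0.1.+1, c0.2) -> False.
  move=> c0A xla xA xE.
  have c0S := tile_sub tP AP c0A; have /fsetDP[c0la c0mu] := c0S.
  have xS : x \in la `\` mu.
    rewrite in_fsetD xla andbT; apply: contraNN c0mu => xmu.
    rewrite [c0]surjective_pairing; case: xE xmu => -> /diagram_le; apply=> //=.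
  have /cov[B BP xB] := xS.
  have AB : A <> B by move=> E; move: xA; rewrite E xB.
  have bB := tile_box bla tP BP.
  have [kB segB adjB] := tile_segment n0 bla tP BP.
  have [c01 c02] := bA _ c0A; have [x1 x2] := bB _ xB.
  have kBi : (kB <= i)%N.
    have [h hB hE] := segment_head segB.
    by have := top _ (tile_sub tP BP hB); rewrite hE ltn_add2r ltnS.
  have nAB c : c \in A -> c \in B -> False.
    by move=> cA cB; have /fdisjointP/(_ _ cA)/negP := dis _ _ AP BP AB.
  case: xE => xE.
  - have xc : content x = (content c0).+1.
      by rewrite xE content_right.
    have [|a [aA aE ha']] := ribbon_next n0 bA seg adjA c0A.
      by rewrite -xc (leq_trans (segment_le segB xB)) // leq_add2r.
    case: ha' => [aE'|[a1 a2]]; first by move: xA; rewrite xE -aE' aA.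
    apply: (deeper_false n0 dmu dla bla sub tP AP BP AB seg segB kBi aA xB).
      by rewrite aE xc.
    by rewrite xE /= a1.
  - have xc : content c0 = (content x).+1.
      have e1 : x.1 = c0.1.+1 by rewrite xE.
      have e2 : x.2 = c0.2 by rewrite xE.
      by have := content_above x1 e1; rewrite e2 -surjective_pairing.
    have [xk|xk] := ltnP (content x) (kB + n)%N.
      have [b [bB' bE hb']] := ribbon_next n0 bB segB adjB xB xk.
      case: hb' => [bE'|[b1 b2]].
        apply: (deeper_false n0 dmu dla bla sub tP AP BP AB seg segB kBi c0A bB').
          by rewrite bE.
        by rewrite bE' xE.
      apply: (nAB c0) => //; suff -> : c0 = b by [].
      rewrite [c0]surjective_pairing [b]surjective_pairing b2.
      by move: b1; rewrite xE /= => -[->].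
    have xk' : content x = (kB + n)%N by apply/eqP; rewrite eqn_leq xk (segment_le segB xB).
    have top_x := head_toprightmost n0 bB segB adjB xB xk'.
    have := hor B x BP top_x c0.1; rewrite xE /= => /(_ erefl).
    by rewrite -surjective_pairing c0S.
apply/allP => -[r s] /fsetDP[xla xA] /=.
have /allP/(_ _ xla)/andP[/= u l] := dla.
rewrite !in_fsetD u l !andbT; apply/andP; split.
- case: r xla xA u l => // r xla xA u l; apply/negP => c0A.
  by apply: (key _ _ c0A xla xA); right.
- case: s xla xA u l => // s xla xA u l; apply/negP => c0A.
  by apply: (key _ _ c0A xla xA); left.
Qed.

(** Otherwise the two heads are different cells of one diagonal, and [deeper_false] excludes either
    order. *)
Lemma tile_top_unique mu la P A B i : is_diagram mu -> is_diagram la ->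
  in_box la -> mu `<=` la -> is_horizontal_tiling n (la `\` mu) P ->
  A \in P -> segment i A -> B \in P -> segment i B -> A = B.
Proof.
move=> dmu dla bla sub tP AP segA BP segB.
apply: contrapT => AB; have [[_ dis _] _] := tP.
have [a aA aE] := segment_head segA; have [b bB bE] := segment_head segB.
have ab : content a = content b by rewrite aE bE.
have [lt|lt|e] := ltngtP a.1 b.1.
- exact: (deeper_false n0 dmu dla bla sub tP AP BP AB segA segB (leqnn i) aA bB ab).
- by apply: (deeper_false n0 dmu dla bla sub tP BP AP _ segB segA (leqnn i) bB aA) => // /esym.
- have [a1 _] := tile_box bla tP AP aA; have [b1 _] := tile_box bla tP BP bB.
  have E : a = b by apply: same_content.
  have /fdisjointP/(_ _ aA)/negP := dis _ _ AP BP AB.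
  by rewrite E.
Qed.

(** Induction from the right end: the bound on contents says that moves below [i] suffice, and when
    the last admissible diagonal is occupied, the unique tile ending there is peeled off as the last
    move. *)
Lemma tiling_reach i mu la P : is_diagram mu -> is_diagram la ->
  in_box la -> mu `<=` la -> is_horizontal_tiling n (la `\` mu) P ->
  (forall c, c \in la `\` mu -> (content c < i + n)%N) ->
  reach n i (bits mu) (bits la) #|` P| (\sum_(A <- P) spin A)%N.
Proof.
elim: i la P => [|i IH] la P dmu dla bla sub tP top.
  have P0 : P = fset0.
    apply: contrapT => /eqP/fset0Pn[A AP].
    have [k0 /segment_head[h hA hE] _] := tile_segment n0 bla tP AP.
    by have := top _ (tile_sub tP AP hA); rewrite hE ltn_add2r.
  have E : mu = la.
    apply/eqP; rewrite eqEfsubset sub /=; apply/fsubsetP => c cla.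
    apply: contraT => cmu; have [[_ _ cov] _] := tP.
    have /cov[A] : c \in la `\` mu by rewrite in_fsetD cmu.
    by rewrite P0 in_fset0.
  by rewrite P0 cardfs0 big_seq_fset0 E; apply: reach0.
case: (pselect (exists2 c, c \in la `\` mu & content c = (i + n)%N)); last first.
  move=> nc; apply: reach_stay; apply: IH => // c cS.
  have := top _ cS; rewrite addSn ltnS leq_eqVlt => /predU1P[E|//].
  by case: nc; exists c.
move=> [c cS cE]; have [[rib dis cov] hor] := tP.
have /cov[A AP cA] := cS.
have [k0 seg adj] := tile_segment n0 bla tP AP.
have k0E : k0 = i.
  have [h hA hE] := segment_head seg.
  have := top _ (tile_sub tP AP hA); rewrite hE ltn_add2r ltnS => k0i.
  apply/eqP; rewrite eqn_leq k0i -(leq_add2r n) -cE.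
  exact: segment_le seg cA.
rewrite {}k0E {k0} in seg.
pose nu := la `\` A.
have Asub : A `<=` la.
  by apply/fsubsetP => x /(tile_sub tP AP) /fsetDP[].
have dnu : is_diagram nu by apply: (tile_removable dmu dla bla sub tP AP seg).
have bnu : in_box nu by apply: in_box_diff.
have mnu : mu `<=` nu.
  apply/fsubsetP => x xmu; rewrite in_fsetD (fsubsetP sub) // andbT.
  by apply/negP => /(tile_sub tP AP) /fsetDP[_]; rewrite xmu.
have AE : la `\` nu = A by rewrite /nu fsetDK.
have diffE x : (x \in nu `\` mu) = (x \in la `\` mu) && (x \notin A).
  by rewrite !in_fsetD; case: (x \in A); rewrite /= ?andbF ?andbT.
have tP' : is_horizontal_tiling n (nu `\` mu) (P `\ A).
  split; last first.
    move=> B x /fsetD1P[_ BP] tx r rE; apply: contraNN (hor B x BP tx r rE).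
    by rewrite diffE => /andP[].
  split.
  - by move=> B /fsetD1P[_ /rib].
  - by move=> B C /fsetD1P[_ BP] /fsetD1P[_ CP]; apply: dis.
  - move=> x; rewrite diffE; split.
      move=> /andP[/cov[B BP xB] xA]; exists B => //.
      by rewrite in_fsetD1 BP andbT; apply: contraNneq xA => <-.
    move=> [B /fsetD1P[/eqP BA BP] xB]; rewrite (tile_sub tP BP xB) /=.
    by have /fdisjointP/(_ _ xB) := dis _ _ BP AP BA.
have [ck bE sE] := ribbon_step n0 dnu bnu dla bla (fsubsetDl _ _)
  (eq_ind_r (segment i) seg AE).
rewrite AE in sE; rewrite bE (cardfsD1 A) AP add1n (big_fsetD1 A) //= sE addnC.
apply: reach_move => //; apply: IH => // x.
rewrite diffE => /andP[xS xA]; have := top _ xS.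
rewrite addSn ltnS leq_eqVlt => /predU1P[xE|//].
have /cov[B BP xB] := xS; have [k segB _] := tile_segment n0 bla tP BP.
have kE : k = i.
  have [h hB hE] := segment_head segB.
  have := top _ (tile_sub tP BP hB); rewrite hE ltn_add2r ltnS => ki.
  apply/eqP; rewrite eqn_leq ki -(leq_add2r n) -xE.
  exact: segment_le segB xB.
move: xA; rewrite (tile_top_unique dmu dla bla sub tP AP seg BP) ?xB //.
by rewrite -kE.
Qed.

Lemma reach_tiling i mu l m s : is_diagram mu -> in_box mu ->
  reach n i (bits mu) l m s ->
  exists la, [/\ is_diagram la, in_box la, mu `<=` la, bits la = l &
    (forall c, c \in la `\` mu -> (content c < i + n)%N) /\
    exists P, [/\ is_horizontal_tiling n (la `\` mu) P, #|` P| = m &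
                  (\sum_(A <- P) spin A)%N = s]].
Proof.
move=> dmu bmu; elim: i l m s => [|i IH] l m s.
  move=> /reach0E[-> -> ->]; exists mu; split=> //; rewrite fsetDv.
  split; first by move=> c; rewrite in_fset0.
  exists fset0; rewrite cardfs0 big_seq_fset0; split=> //; split; last first.
    by move=> A c; rewrite in_fset0.
  split=> [A|A B|c]; rewrite ?in_fset0 //.
  by split=> // -[A]; rewrite in_fset0.
move=> /reachSE[/IH[la [d b sub E [top hP]]]|].
  by exists la; split=> //; split=> // c /top h; rewrite addSn ltnS ltnW.
move=> [l' [m' [s' [/IH[nu [dnu bnu sub E [top [P [tP mE sE]]]]] ck -> -> ->]]]].
rewrite -E in ck.
have [la [dla bla sub' bE [seg rib]]] := add_segment n0 dnu bnu ck.
pose A := la `\` nu.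
have [_ _ spE] := ribbon_step n0 dnu bnu dla bla sub' seg.
have diffE x : (x \in la `\` mu) = (x \in nu `\` mu) || (x \in A).
  rewrite !in_fsetD; move: (fsubsetP sub x) (fsubsetP sub' x).
  case: (x \in mu) => /= [/(_ isT) -> //|_].
  by case: (x \in nu) => /= [/(_ isT) ->|_].
have bA : in_box A by apply: in_box_diff.
have AnP : A \notin P.
  apply/negP => AP; have [h hA hE] := segment_head seg.
  have [[_ _ cov] _] := tP.
  have /top : h \in nu `\` mu by apply/cov; exists A.
  by rewrite hE ltnn.
exists la; split=> //; first exact: fsubset_trans sub sub'.
  by rewrite bE E.
split=> [c|].
  rewrite diffE addSn ltnS => /orP[/top/ltnW //|cA].
  exact: segment_le seg cA.
exists (A |` P); rewrite cardfsU1 AnP mE add1n big_fsetU1 //= sE spE E addnC.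
have [[ribP dis cov] hor] := tP.
have PA B c : B \in P -> c \in B -> c \notin A.
  move=> BP cB; have /fsetDP[cnu _] : c \in nu `\` mu by apply/cov; exists B.
  by rewrite in_fsetD cnu.
split=> //; split; last first.
  (* The square above the new head has content i + n + 1, beyond every square of the strip. The
     square above an older head, if it were in the strip, could not be in the new ribbon because it
     belongs to [nu]. *)
  move=> B c /fset1UP[->|BP] tc r rE; apply/negP; rewrite diffE.
    have cE := toprightmost_head n0 bA seg tc.
    have [c1 _] := bA _ (proj1 tc).
    move=> /orP[/top|/(segment_le seg)]; rewrite (content_above c1 rE) cE.
      by rewrite ltnNge ltnW.
    by rewrite ltnn.
  have := hor B c BP tc r rE => /negbTE -> /=.
  rewrite in_fsetD => /andP[/negP h _]; apply: h.
  have /fsetDP[cnu _] : c \in nu `\` mu by apply/cov; exists B => //; case: tc.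
  rewrite [c]surjective_pairing rE in cnu.
  by apply: diagram_le cnu _ _.
split=> [B /fset1UP[->//|/ribP//]|B C|c].
- move=> /fset1UP[->|BP] /fset1UP[->|CP] //= BC.
  + by apply/fdisjointP => c cA; apply: contraL cA; apply: PA.
  + by apply/fdisjointP => c cB; apply: PA cB.
  + exact: dis.
- rewrite diffE; split.
    move=> /orP[/cov[B BP cB]|cA]; first by exists B => //; apply/fset1UP; right.
    by exists A => //; apply/fset1UP; left.
  move=> [B /fset1UP[->->|BP cB]]; rewrite ?orbT //.
  by have -> : c \in nu `\` mu by apply/cov; exists B.
Qed.

End TilingReach.

(** * Matrix coefficients of the operator that adds a strip *)

Section Delta.
Variables (R : comNzRingType) (q : R) (n : nat).
Hypothesis n0 : (0 < n)%N.

Definition delta (l : seq bool) : seq bool -> R := fun l' => (l' == l)%:R.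

Lemma mv_inj k l l' : can n k l -> can n k l' -> mv n k l = mv n k l' -> l = l'.
Proof.
move=> c c' E; have sz : size l = size l' by rewrite -(size_mv c) E size_mv.
have /and3P[a1 _ a2] := c; have /and3P[b1 _ b2] := c'.
apply: (eq_from_nth (x0 := false) sz) => j _.
have := congr1 (nth false ^~ j) E; rewrite !nth_mv.
case: eqP => [->|_]; first by rewrite (negbTE a2) (negbTE b2).
by case: eqP => [->|//]; rewrite a1 b1.
Qed.

Lemma step_delta_move x k l : can n k l ->
  step n q x k (delta (mv n k l)) =
  (fun l' => 1 * delta (mv n k l) l' + x * q ^+ jmp n k l * delta l l').
Proof.
move=> c; apply: functional_extensionality_dep => l'; rewrite /step mul1r.
congr +%R; case: ifP => c'.
  rewrite /delta; case: (eqVneq l' l) => [->|nl]; first by rewrite eqxx.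
  have -> : (mv n k l' == mv n k l) = false.
    by apply: contra_neqF nl => /eqP; apply: mv_inj.
  by rewrite !mulr0.
by rewrite /delta; case: eqP c' => [->|_ _]; rewrite ?c ?mulr0.
Qed.

Lemma step_delta_stay x k l : (forall l', can n k l' -> mv n k l' <> l) ->
  step n q x k (delta l) = delta l.
Proof.
move=> h; apply: functional_extensionality_dep => l'; rewrite /step.
case: ifP => c; last by rewrite addr0.
by have /eqP/negbTE E := h _ c; rewrite /delta E mulr0 addr0.
Qed.

(** At most one sequence of moves leads from [l] to [l'], so the coefficient is a single monomial or
    0. *)
Lemma foldr_delta x i l l' :
  (forall m s, reach n i l l' m s ->
     foldr (step n q x) (delta l') (iota 0 i) l = x ^+ m * q ^+ s) /\
  ((forall m s, ~ reach n i l l' m s) ->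
     foldr (step n q x) (delta l') (iota 0 i) l = 0).
Proof.
elim: i l' => [|i IH] l'.
  split=> [m s /reach0E[-> -> ->]|h] /=; first by rewrite /delta eqxx mulr1.
  rewrite /delta; case: eqP => // E; rewrite E in h.
  by case: (h 0%N 0%N); apply: reach0.
have iE : iota 0 i.+1 = iota 0 i ++ [:: i] by rewrite -addn1 iotaD.
rewrite iE foldr_cat /=.
case: (pselect (exists2 l'', can n i l'' & mv n i l'' = l')) => [[l'' c E]|nex].
  rewrite -E (step_delta_move x c) foldr_step_linear mul1r.
  (* The word [l''] and its move at [i] agree below [i]; if both were reached by moves below [i],
     [reach_det] would make them equal, yet they differ at [i]. Hence only one of the two terms
     survives. *)
  have excl m s m' s' : reach n i l (mv n i l'') m s -> reach n i l l'' m' s' -> False.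
    move=> r1 r2; have [|E' _ _] := reach_det n0 r1 r2.
      move=> j ji; rewrite nth_mv; case: eqP => [jE|_]; first by exfalso; lia.
      by case: eqP => // jE; exfalso; lia.
    have /and3P[a1 _ _] := c; move: a1; rewrite -E' nth_mv eqxx.
    by case: eqP => // ? _; lia.
  have [h1 h2] := IH (mv n i l''); have [h3 h4] := IH l''.
  split=> [m s /reachSE[r|[la [m' [s' [r c' Ea -> ->]]]]]|no].
  - by rewrite (h1 _ _ r) h4 ?mulr0 ?addr0 // => m' s' r'; apply: excl r r'.
  - rewrite (mv_inj c c' Ea) in h1 h2 excl h3 h4 *.
    rewrite (h3 _ _ r) h2 ?add0r; last by move=> m1 s1 r1; apply: excl r1 r.
    rewrite exprS exprD; ring.
  - rewrite h2 ?h4 ?mulr0 ?addr0 // => m s r.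
      by apply: (no m.+1 (s + jmp n i l'')%N); apply: reach_move.
    by apply: (no m s); apply: reach_stay.
have [h1 h2] := IH l'; rewrite step_delta_stay; last first.
  by move=> la c E; apply: nex; exists la.
split=> [m s /reachSE[/h1 //|[la [m' [s' [_ c E _ _]]]]]|no].
  by case: nex; exists la.
by apply: h2 => m s r; apply: (no m s); apply: reach_stay.
Qed.

Definition strip_weight (x : R) (mu la : {fset cell}) : R :=
  if `[< mu `<=` la /\ is_horizontal_strip n (la `\` mu) >] then
    q ^+ (\sum_(A <- strip_tiling n (la `\` mu)) spin A)%N *
    x ^+ #|` strip_tiling n (la `\` mu)|
  else 0.

Lemma strip_tilingP S : is_horizontal_strip n S ->
  is_horizontal_tiling n S (strip_tiling n S).
Proof.
move=> [_ [P hP]]; rewrite /strip_tiling.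
by case: xgetP => [Q _ //|/(_ P)]; case.
Qed.

Lemma addop_strip M x mu la : is_diagram mu -> in_box M mu ->
  is_diagram la -> in_box M la ->
  addop n q x (delta (bits M la)) (bits M mu) = strip_weight x mu la.
Proof.
move=> dmu bmu dla bla; rewrite /addop size_bits /strip_weight.
set i := (2 * M - n)%N; have [h1 h2] := foldr_delta x i (bits M mu) (bits M la).
case: ifP => /asboolP h.
  have [sub str] := h; rewrite mulrC; apply: h1.
  apply: tiling_reach => //; first exact: strip_tilingP.
  (* All contents in the box are below 2M, which is at most [i + n] even when the subtraction in [i]
     is truncated. *)
  move=> c /fsetDP[/bla[c1 c2] _]; have /andP[_ cM] := content_bound c1 c2.
  by apply: leq_trans cM _; rewrite addnC -leq_subLR.
apply: h2 => m s r; apply: h.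
have [la' [dla' bla' sub bE [_ [P [tP _ _]]]]] := reach_tiling n0 dmu bmu r.
have E : la' = la by apply: (bits_inj dla' bla' dla bla).
rewrite -E; split=> //; split; last by exists P.
by exists (Young dla'), (Young dmu).
Qed.

End Delta.

(** * Ribbon functions through the operators *)

Section PathSum.
Variables (R : comNzRingType) (S : finType) (w : R -> S -> S -> R).

Definition pathsum (xs : seq R) (g : S -> R) : S -> R :=
  foldr (fun x h s => \sum_s' w x s s' * h s') g xs.

(** The transfer matrix method: a product of matrices is a sum over paths of states, here the future
    chains of diagrams. *)
Lemma pathsumE N (X : 'I_N -> R) (g : S -> R) (s : S) :
  pathsum [seq X i | i <- enum 'I_N] g s =
  \sum_(T : {ffun 'I_N.+1 -> S} | T ord0 == s)
    (\prod_(i < N) w (X i) (T (widen_ord (leqnSn N) i)) (T (lift ord0 i))) *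
    g (T ord_max).
Proof.
elim: N X s => [|N IH] X s.
  rewrite (eq_bigl (pred1 [ffun=> s])) => [|T].
    rewrite big_pred1_eq big_ord0 mul1r ffunE /=.
    by case: (enum 'I_0) (size_enum_ord 0).
  apply/eqP/eqP => [Ts|->]; last by rewrite ffunE.
  by apply/ffunP => i; rewrite ffunE (ord1 i).
rewrite enum_ordSl /= -map_comp.
have -> : [seq (X \o lift ord0) i | i <- enum 'I_N] = [seq X (lift ord0 i) | i <- enum 'I_N] by [].
pose h (T : {ffun 'I_N.+1 -> S}) : {ffun 'I_N.+2 -> S} :=
  [ffun i => if unlift ord0 i is Some j then T j else s].
pose h' (T : {ffun 'I_N.+2 -> S}) : {ffun 'I_N.+1 -> S} :=
  [ffun j => T (lift ord0 j)].
have h0 T : h T ord0 = s by rewrite ffunE unlift_none.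
have hl T j : h T (lift ord0 j) = T j by rewrite ffunE liftK.
rewrite [RHS](reindex_onto h h'); last first.
  move=> T /eqP T0; apply/ffunP => i; rewrite ffunE.
  by case: unliftP => [j ->|->]; rewrite ?ffunE.
have E T : (h T ord0 == s) && (h' (h T) == T) = true.
  by rewrite h0 eqxx /=; apply/eqP/ffunP => j; rewrite ffunE hl.
rewrite (eq_bigl _ _ E) (partition_big (fun T : {ffun 'I_N.+1 -> S} => T ord0) predT) //=.
apply: eq_bigr => s' _; rewrite IH mulr_sumr; apply: eq_bigr => T /eqP Ts'.
rewrite big_ord_recl mulrA.
have -> : widen_ord (leqnSn N.+1) ord0 = ord0 by apply: val_inj.
rewrite h0 hl Ts'.
have -> : ord_max = lift ord0 (ord_max : 'I_N.+1) by apply: val_inj.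
rewrite hl; congr (_ * _ * _); apply: eq_bigr => i _.
have -> : widen_ord (leqnSn N.+1) (lift ord0 i) = lift ord0 (widen_ord (leqnSn N) i).
  exact: val_inj.
by rewrite !hl.
Qed.

End PathSum.

Section Expansion.
Variables (R : comNzRingType) (q : R) (n : nat).
Hypothesis n0 : (0 < n)%N.

Lemma foldr_step_sum (I : finType) (c : I -> R) (psi : I -> seq bool -> R) x ks l :
  foldr (step n q x) (fun l' => \sum_i c i * psi i l') ks l =
  \sum_i c i * foldr (step n q x) (psi i) ks l.
Proof.
elim: ks l => [|k ks IH] l //=.
rewrite /step !IH; case: ifP => _; last first.
  by rewrite addr0; apply: eq_bigr => i _; rewrite addr0.
rewrite mulr_sumr -big_split; apply: eq_bigr => i _ /=; ring.
Qed.

Lemma addop_expand m x phi (l : m.-tuple bool) :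
  addop n q x phi l = \sum_(l' : m.-tuple bool) phi l' * addop n q x (delta R l') l.
Proof.
rewrite /addop -foldr_step_sum.
apply: (@size_foldr_ext _ _ _ m); rewrite ?size_tuple // => l' sl'.
have -> : l' = tval (Tuple (introT eqP sl')) by [].
set t := Tuple _; rewrite (bigD1 t) //= big1 ?addr0 => [|u ut].
  by rewrite /delta eqxx mulr1.
rewrite /delta; have -> : (tval t == tval u) = false.
  by apply: contra_neqF ut => /eqP E; apply: val_inj.
by rewrite mulr0.
Qed.

Variables (M : nat) (la : {fset cell}).
Hypotheses (dla : is_diagram la) (bla : in_box M la).

Definition diag_weight (x : R) (A B : fpowerset la) : R :=
  if is_diagram (val A) && is_diagram (val B) then strip_weight q n x (val A) (val B)
  else 0.

Definition addops (xs : seq R) (phi : seq bool -> R) : seq bool -> R :=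
  foldr (addop n q) phi xs.

Lemma addops_outside xs (mu : {fset cell}) : is_diagram mu -> in_box M mu ->
  ~~ (mu `<=` la) -> addops xs (delta R (bits M la)) (bits M mu) = 0.
Proof.
elim: xs mu => [|x xs IH] mu dmu bmu sub /=.
  rewrite /delta; case: eqP => // /(bits_inj dmu bmu dla bla) E.
  by rewrite E fsubset_refl in sub.
have sb : size (bits M mu) == (2 * M)%N by rewrite size_bits.
rewrite (addop_expand x _ (Tuple sb)) big1 // => l' _ /=.
have [_ h2] := foldr_delta q n0 x (2 * M - n) (bits M mu) l'.
case: (pselect (exists m s, reach n (2 * M - n) (bits M mu) l' m s)) => [[m [s r]]|nr].
  have [B [dB bB sB <- _]] := reach_tiling n0 dmu bmu r.
  rewrite -/(addops xs _) IH ?mul0r //.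
  by apply: contra sub; apply: fsubset_trans.
rewrite /addop size_bits h2 ?mulr0 // => m s r.
by apply: nr; exists m, s.
Qed.

(** The sum over all words reduces to subdiagrams of [la]: what is reached from a diagram is a
    diagram, and since moves only enlarge it, one not contained in [la] never leads to [la]. *)
Lemma addops_pathsum xs (A : fpowerset la) : is_diagram (val A) ->
  addops xs (delta R (bits M la)) (bits M (val A)) =
  pathsum diag_weight xs (fun B => (val B == la)%:R) A.
Proof.
have box (B : fpowerset la) : in_box M (val B).
  have := fsvalP B; rewrite fpowersetE => /fsubsetP sub c cB.
  exact/bla/sub.
elim: xs A => [|x xs IH] A dA /=.
  rewrite /delta; congr (nat_of_bool _)%:R; apply/eqP/eqP => [E|-> //].
  exact: (bits_inj dA (box A) dla bla).
have sb (D : {fset cell}) : size (bits M D) == (2 * M)%N by rewrite size_bits.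
pose tb D := Tuple (sb D).
rewrite (addop_expand x _ (tb (val A))) -/(addops xs _).
have tb_inj : {in [set B : fpowerset la | is_diagram (val B)] &,
    injective (fun B : fpowerset la => tb (val B))}.
  move=> B C; rewrite !inE => dB dC /(congr1 val)/= E.
  by apply/val_inj/(bits_inj dB (box B) dC (box C)).
rewrite (bigID (mem [set tb (val B) | B in [set B : fpowerset la | is_diagram (val B)]])) /=.
rewrite [X in _ + X]big1 ?addr0; last first.
  move=> l' nl'; have [_ h2] := foldr_delta q n0 x (2 * M - n) (bits M (val A)) l'.
  case: (pselect (exists m s, reach n (2 * M - n) (bits M (val A)) l' m s)) => [[m [s r]]|nr].
    have [B [dB bB sB BE _]] := reach_tiling n0 dA (box A) r.
    case: (boolP (B `<=` la)) => [Bla|Bla]; last first.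
      by rewrite -BE addops_outside ?mul0r.
    have BP : B \in fpowerset la by rewrite fpowersetE.
    case/imsetP: nl'; exists [` BP]; first by rewrite inE.
    exact: val_inj.
  rewrite /addop size_bits h2 ?mulr0 // => m s r.
  by apply: nr; exists m, s.
rewrite big_imset //= [RHS](bigID (fun B : fpowerset la => is_diagram (val B))) /=.
rewrite [X in _ + X]big1 ?addr0; last first.
  by move=> B dB; rewrite /diag_weight (negbTE dB) andbF mul0r.
apply: eq_big => [B|B]; first by rewrite inE.
rewrite inE => dB; rewrite mulrC /diag_weight dA dB /=; congr (_ * _).
  exact: (addop_strip q n0 x dA (box A) dB (box B)).
exact: IH.
Qed.

End Expansion.

Theorem ribbonG_addops (K : comNzRingType) (q : K) n M (la mu : young) N :
  (0 < n)%N -> in_box M la -> mu `<=` la ->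
  ribbonG q n la mu N =
  addops (q%:MP_[N]) n [seq 'X_i | i <- enum 'I_N] (delta _ (bits M la)) (bits M mu).
Proof.
move=> n0 bla sub; have muP : (mu : {fset cell}) \in fpowerset la by rewrite fpowersetE.
have dmu := diagramP mu; have dla := diagramP la.
pose m0 : fpowerset la := [` muP].
have -> : (mu : {fset cell}) = val m0 by [].
rewrite (addops_pathsum _ n0 dla bla) // pathsumE /ribbonG.
rewrite [RHS]big_mkcond [LHS]big_mkcond; apply: eq_bigr => T _.
case: ifP => /asboolP tT; last first.
  (* A chain that is not a tableau has a wrong end or a step of weight 0. *)
  case: eqP => // T0; case: (boolP (val (T ord_max) == la)) => TM; last by rewrite mulr0.
  case: (pselect (forall i : 'I_N,
     diag_weight (q%:MP_[N]) n ('X_i) (T (widen_ord (leqnSn N) i)) (T (lift ord0 i)) <> 0)).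
    move=> nz; case: tT; split=> //.
    - by rewrite T0.
    - exact/eqP.
    - move=> i; case: (unliftP ord0 i) => [j ->|->]; last by rewrite T0.
      by have := nz j; rewrite /diag_weight; case: ifP => // /andP[].
    - move=> i; have := nz i; rewrite /diag_weight /strip_weight.
      by case: ifP => // _; case: ifP => // /asboolP.
  move=> /existsNP[i /contrapT E].
  by rewrite (bigD1 i) //= E !mul0r.
have [T0 TM dT sT] := tT.
have -> : T ord0 == m0 by apply/eqP/val_inj.
rewrite TM eqxx mulr1 /tableau_spin /tableau_weight mpolyXE_id.
rewrite -mul_mpolyC rmorphXn /= -prodrXr -big_split /=.
apply: eq_bigr => i _; rewrite /diag_weight !dT /= /strip_weight mnmE.
by case: asboolP (sT i).
Qed.

(** * Conjugation of boundary words *)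

Definition flip (l : seq bool) : seq bool := rev (map negb l).

Section Flip.
Variable n : nat.
Hypothesis n0 : (0 < n)%N.

Lemma size_flip l : size (flip l) = size l.
Proof. by rewrite size_rev size_map. Qed.

Lemma flipK : involutive flip.
Proof.
by move=> l; rewrite /flip map_rev revK -map_comp map_id_in // => b _ /=; rewrite negbK.
Qed.

Lemma nth_flip l j : (j < size l)%N ->
  nth false (flip l) j = ~~ nth false l (size l - j.+1).
Proof.
move=> jl; rewrite nth_rev size_map // (nth_map false) //.
by rewrite -subSn // subSS leq_subr.
Qed.

Lemma can_flip l k : (k < size l - n)%N ->
  can n (size l - n - k.+1) (flip l) = can n k l.
Proof.
move=> kl; rewrite /can size_flip !nth_flip; try lia.
have -> : (size l - (size l - n - k.+1).+1 = k + n)%N by lia.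
have -> : (size l - (size l - n - k.+1 + n).+1 = k)%N by lia.
rewrite negbK; have -> : (size l - n - k.+1 + n < size l)%N by lia.
have -> : (k + n < size l)%N by lia.
by rewrite /= andbC.
Qed.

Lemma mv_flip l k : (k < size l - n)%N -> can n k l ->
  mv n (size l - n - k.+1) (flip l) = flip (mv n k l).
Proof.
move=> kl c; have c' := c; rewrite -can_flip // in c'.
apply: (@eq_from_nth _ false); first by rewrite size_mv // !size_flip size_mv.
move=> j; rewrite size_mv // size_flip => jl.
rewrite nth_mv !nth_flip ?size_mv // nth_mv.
have -> : (j == size l - n - k.+1 + n)%N = (size l - j.+1 == k)%N by lia.
have -> : (j == size l - n - k.+1)%N = (size l - j.+1 == k + n)%N by lia.
case: (eqVneq (size l - j.+1)%N k) => [->|_]; last by case: ifP.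
by have -> : (k == k + n)%N = false by lia.
Qed.

Lemma count_flip l : (count id (flip l) + count id l = size l)%N.
Proof.
by rewrite count_rev count_map addnC -(count_predC id l); congr addn.
Qed.

(** The n-1 places strictly between the ends of the move are complemented. *)
Lemma jmp_flip l k : (k < size l - n)%N ->
  (jmp n (size l - n - k.+1) (flip l) + jmp n k l = n.-1)%N.
Proof.
move=> kl; rewrite /jmp.
have sd : size (take n.-1 (drop k.+1 l)) = n.-1.
  by rewrite size_takel // size_drop; lia.
have -> : take n.-1 (drop (size l - n - k.+1).+1 (flip l)) =
          flip (take n.-1 (drop k.+1 l)).
  apply: (@eq_from_nth _ false) => [|j].
    by rewrite size_flip sd size_takel // size_drop size_flip; lia.
  rewrite size_takel; last by rewrite size_drop size_flip; lia.
  move=> jn; rewrite nth_take // nth_drop !nth_flip ?sd //; last by lia.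
  rewrite nth_take; last by lia.
  by rewrite nth_drop; congr (~~ nth _ _ _); lia.
by rewrite count_flip.
Qed.

Variables (R : comNzRingType) (q qi : R).
Hypothesis qqi : q * qi = 1.

Lemma step_flip x k phi l : (k < size l - n)%N ->
  step n q x k phi l =
  step n qi (x * q ^+ n.-1) (size l - n - k.+1) (phi \o flip) (flip l).
Proof.
move=> kl; rewrite /step /= flipK can_flip //; congr +%R.
case: ifP => // c; rewrite mv_flip // flipK; congr (_ * _).
rewrite -(jmp_flip kl) exprD [q ^+ _ * _]mulrC -!mulrA -exprMn_comm; last exact: mulrC.
by rewrite qqi expr1n mulr1.
Qed.

(** A move at [k] becomes one at [size l - n - k.+1], which reverses the order of the attempts and
    so turns [addop] into [remop]. *)
Lemma addop_flip x phi l :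
  addop n q x phi l = remop n qi (x * q ^+ n.-1) (phi \o flip) (flip l).
Proof.
rewrite /addop /remop size_flip.
have -> : rev (iota 0 (size l - n)) =
    [seq (size l - n - k.+1)%N | k <- iota 0 (size l - n)].
  apply: (@eq_from_nth _ 0%N) => [|j]; rewrite size_rev ?size_map // size_iota => jl.
  rewrite nth_rev ?size_iota // (nth_map 0%N) ?size_iota // !nth_iota; lia.
have : all (fun k => k < size l - n)%N (iota 0 (size l - n)).
  by apply/allP => k; rewrite mem_iota.
move: (iota 0 (size l - n)) => ks.
have [m sl] : exists m, size l = m by exists (size l).
rewrite sl; elim: ks l sl => [|k ks IH] l sl /=; first by rewrite flipK.
move=> /andP[kl ksl].
have E : forall l', size l' = m -> foldr (step n q x) phi ks l' =
   (foldr (step n qi (x * q ^+ n.-1)) (phi \o flip)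
      [seq (m - n - k.+1)%N | k <- ks] \o flip) l'.
  by move=> l' sl'; rewrite (IH l').
transitivity (step n q x k (foldr (step n qi (x * q ^+ n.-1)) (phi \o flip)
      [seq (m - n - k.+1)%N | k <- ks] \o flip) l).
  by rewrite /step E //; case: ifP => // c; rewrite E // size_mv.
rewrite step_flip ?sl //.
by congr (step _ _ _ _ _ _); apply: functional_extensionality_dep => l' /=; rewrite flipK.
Qed.

Lemma addops_flip (X : seq R) phi l :
  foldr (addop n q) phi X l =
  foldr (remop n qi) (phi \o flip) [seq x * q ^+ n.-1 | x <- X] (flip l).
Proof.
elim: X l => [|x X IH] l /=; first by rewrite flipK.
rewrite addop_flip; congr (remop _ _ _ _ _).
by apply: functional_extensionality_dep => l' /=; rewrite IH flipK.
Qed.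

End Flip.

Lemma dg_transpose M (S : {fset cell}) k : (k <= 2 * M)%N ->
  dg M (transpose S) k = dg M S (2 * M - k).
Proof.
move=> kM; apply: eq_count => t; rewrite /cellat mem_transpose.
have -> : (t + (k - M) = t + (M - (2 * M - k)))%N by lia.
by have -> : (t + (M - k) = t + (2 * M - k - M))%N by lia.
Qed.

Lemma bits_conjugate M (la : young) :
  bits M (conjugate la) = flip (bits M la).
Proof.
apply: (@eq_from_nth _ false); first by rewrite size_flip !size_bits.
move=> e; rewrite size_bits => eM; rewrite nth_bits // nth_flip size_bits //.
rewrite nth_bits; last by lia.
rewrite /bit !dg_transpose; try lia.
have E1 : (2 * M - e = (2 * M - e.+1).+1)%N by lia.
rewrite E1; case: (ltnP e M) => h1; case: (ltnP (2 * M - e.+1) M) => h2; try lia.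
Qed.

Lemma in_box_transpose M (S : {fset cell}) : in_box M S -> in_box M (transpose S).
Proof. by move=> h [i j]; rewrite mem_transpose => /h /= []. Qed.

Lemma delta_flip (R : comNzRingType) l : delta R (flip l) \o flip = delta R l.
Proof.
apply: functional_extensionality_dep => l'; rewrite /delta /=.
by rewrite (inj_eq (can_inj flipK)).
Qed.

(** * Symmetric functions *)

Section Functorial.
Variables (A B : comNzRingType) (f : {rmorphism A -> B}).

Lemma rmorph_foldr_step q n x phi ks l :
  f (foldr (step n q x) phi ks l) = foldr (step n (f q) (f x)) (f \o phi) ks l.
Proof.
elim: ks l => [|k ks IH] l //=.
by rewrite /step rmorphD IH; case: ifP => _; rewrite ?rmorph0 // !rmorphM rmorphXn IH.
Qed.

Lemma rmorph_addops q n X phi l :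
  f (addops q n X phi l) = addops (f q) n (map f X) (f \o phi) l.
Proof.
elim: X l => [|x X IH] l //=; rewrite /addop rmorph_foldr_step.
congr (foldr _ _ _ _); apply: functional_extensionality_dep => l' /=.
exact: IH.
Qed.

Lemma rmorph_delta l : f \o delta A l = delta B l.
Proof. by apply: functional_extensionality_dep => l'; rewrite /delta /= rmorph_nat. Qed.

Lemma rmorph_esuper X Z k : f (esuper X Z k) = esuper (map f X) (map f Z) k.
Proof.
rewrite /esuper; elim: X k => [|x X IH] k /=; last first.
  by rewrite /mulgen rmorphD rmorphM !IH; case: k => [|k]; rewrite ?rmorph0 ?IH.
elim: Z k => [|z Z IH] k /=; first by rewrite rmorph_nat.
by elim: k => [|k IHk] /=; rewrite ?rmorphD ?rmorphM ?IH ?IHk.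
Qed.

Lemma rmorph_peval (K : Type) (c : K -> A) v (e : pexp K) :
  f (peval c v e) = peval (f \o c) (f \o v) e.
Proof.
by elim: e => //= e1 IH1 e2 IH2; rewrite ?rmorphD ?rmorphM IH1 IH2.
Qed.

End Functorial.

Section Families.
Variable K : fieldType.

Definition vars (N : nat) : seq {mpoly K[N]} := [seq 'X_i | i <- enum 'I_N].

Lemma size_vars N : size (vars N) = N.
Proof. by rewrite size_map size_enum_ord. Qed.

Definition at_point N (A : comNzRingType) (c : {rmorphism K -> A}) (X : seq A) :
  {mpoly K[N]} -> A := mmap c (fun i : 'I_N => X`_i).

HB.instance Definition _ N A c X := GRing.RMorphism.on (@at_point N A c X).

Lemma at_pointC N A c X a : @at_point N A c X a%:MP = c a.
Proof. exact: mmapC. Qed.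

Lemma at_point_vars N A c X : size X = N -> map (@at_point N A c X) (vars N) = X.
Proof.
move=> sX; apply: (@eq_from_nth _ 0); rewrite size_map size_vars // => i iN.
rewrite (nth_map 0) ?size_vars // (nth_map (Ordinal iN)) ?size_enum_ord //.
rewrite /at_point mmapX mmap1U.
by congr (_`_ _); rewrite nth_enum_ord.
Qed.

(* A polynomial in a list of variables that is meaningful over every ring
   receiving the constants, so that it can be evaluated anywhere. *)
Definition family : Type := forall A : comNzRingType, (K -> A) -> seq A -> A.

Definition natural_family (F : family) : Prop :=
  forall (A B : comNzRingType) (f : {rmorphism A -> B}) c X,
    f (F A c X) = F B (f \o c) (map f X).

Definition fam (F : family) : polyfam K := fun N => F _ (@mpolyC N K) (vars N).

(** Permuting the variables and setting the last one to 0 are ring morphisms that fix the constants;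
    by naturality they act only on the list of variables. *)
Lemma natural_symfun F : natural_family F ->
  (forall N X Y, perm_eq X Y -> F _ (@mpolyC N K) X = F _ (@mpolyC N K) Y) ->
  (forall N X, F _ (@mpolyC N K) (0 :: X) = F _ (@mpolyC N K) X) ->
  (exists d, forall N, (msize (fam F N) <= d)%N) -> is_symfun (fam F).
Proof.
move=> nF pF zF dF; split=> // [N|N].
- apply/issymP => s; rewrite /fam nF.
  have -> : @msym N K s \o @mpolyC N K = @mpolyC N K.
    by apply: functional_extensionality_dep => a /=; rewrite /msym mmapC.
  apply: pF; rewrite /vars -map_comp.
  have -> : [seq (@msym N K s \o (fun i => 'X_i)) i | i <- enum 'I_N] =
      [seq 'X_i | i <- [seq s i | i <- enum 'I_N]].
    by rewrite -[RHS]map_comp; apply: eq_map => i /=; rewrite /msym mmapX mmap1U.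
  apply: perm_map; apply: uniq_perm; rewrite ?enum_uniq //.
    by rewrite (map_inj_uniq (@perm_inj _ s)) enum_uniq.
  move=> i; rewrite mem_enum; apply/mapP; exists (s^-1%g i); rewrite ?mem_enum //.
  by rewrite permKV.
- pose g : {rmorphism {mpoly K[N.+1]} -> {mpoly K[N]}} :=
    mmap (@mpolyC N K) (fun i : 'I_N.+1 => if unlift ord_max i is Some j then 'X_j else 0).
  have -> : drop_last (fam F N.+1) = g (fam F N.+1) by [].
  rewrite /fam nF.
  have -> : g \o @mpolyC N.+1 K = @mpolyC N K.
    by apply: functional_extensionality_dep => a /=; rewrite /g /= mmapC.
  rewrite -[RHS]zF; apply: pF; rewrite {1}/vars enum_ordSr !map_rcons perm_rcons.
  have -> : g 'X_ord_max = 0 by rewrite /g /= mmapX mmap1U unlift_none.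
  rewrite perm_cons.
  suff -> : [seq g p | p <- [seq 'X_i | i <- [seq widen_ord (leqnSn N) i | i <- enum 'I_N]]] =
            vars N by [].
  rewrite -map_comp -[LHS]map_comp; apply: eq_map => i.
  rewrite /g /= mmapX mmap1U.
  have -> : widen_ord (leqnSn N) i = lift ord_max i.
    by apply: val_inj; rewrite /= /bump leqNgt ltn_ord.
  by rewrite liftK.
Qed.

End Families.

Section Degrees.
Variables (K : fieldType) (N : nat).
Implicit Types (p r : {mpoly K[N]}).

Lemma msizeM_bound a b p r : (msize p <= a.+1)%N -> (msize r <= b.+1)%N ->
  (msize (p * r) <= (a + b).+1)%N.
Proof.
move=> pa rb; have [->|p0] := eqVneq p 0; first by rewrite mul0r msize0.
have [->|r0] := eqVneq r 0; first by rewrite mulr0 msize0.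
rewrite msizeM //; have := leq_add pa rb; rewrite addSn addnS.
by case: (msize p + msize r)%N.
Qed.

Lemma msizeD_bound a p r : (msize p <= a)%N -> (msize r <= a)%N ->
  (msize (p + r) <= a)%N.
Proof. by move=> pa rb; rewrite (leq_trans (msizeD_le _ _)) // geq_max pa. Qed.

Lemma msize_vars x : x \in vars K N -> (msize x <= 2)%N.
Proof. by move=> /mapP[i _ ->]; rewrite msizeX mdeg1. Qed.

Lemma msize_esuper (X Z : seq {mpoly K[N]}) k :
  (forall x, x \in X -> msize x <= 2)%N -> (forall z, z \in Z -> msize z <= 2)%N ->
  (msize (esuper X Z k) <= k.+1)%N.
Proof.
move=> hX hZ; rewrite /esuper; elim: X hX k => [|x X IH] hX k /=; last first.
  have hx := hX x (mem_head _ _).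
  have hX' y : y \in X -> (msize y <= 2)%N by move=> yX; apply: hX; rewrite inE yX orbT.
  have {}IH := IH hX'.
  rewrite /mulgen; apply: msizeD_bound => //.
  case: k => [|k]; first by rewrite mulr0 msize0.
  exact: msizeM_bound hx (IH k).
elim: Z hZ k => [|z Z IH] hZ k /=.
  by case: k => [|k] /=; rewrite ?msize1 ?mulr0n ?msize0.
have hz := hZ z (mem_head _ _).
have hZ' y : y \in Z -> (msize y <= 2)%N by move=> yZ; apply: hZ; rewrite inE yZ orbT.
have {}IH := IH hZ'.
elim: k => [|k IHk] /=; first exact: IH.
by apply: msizeD_bound => //; apply: msizeM_bound hz IHk.
Qed.

End Degrees.

Section Generators.
Variable K : fieldType.

Lemma divgen_inj (R : comNzRingType) (z : R) a : divgen z (mulgen (- z) a) = a.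
Proof.
apply: functional_extensionality_dep; elim=> [|k IH] /=.
  by rewrite /mulgen mulr0 addr0.
rewrite IH /mulgen; ring.
Qed.

Lemma mulgen_divgenN (R : comNzRingType) (z : R) a : mulgen (- z) (divgen z a) = a.
Proof. by rewrite -{2}(opprK z) mulgen_divgen. Qed.

Lemma divgenC (R : comNzRingType) (y z : R) a :
  divgen y (divgen z a) = divgen z (divgen y a).
Proof.
rewrite -[RHS](divgen_inj y); congr (divgen y _).
rewrite -[RHS](divgen_inj z); congr (divgen z _).
by rewrite mulgenC !mulgen_divgenN.
Qed.

Lemma divgen0 (R : comNzRingType) (a : nat -> R) : divgen 0 a = a.
Proof.
by apply: functional_extensionality_dep; case=> [|k] //=; rewrite mul0r addr0.
Qed.

Definition efam k : family K := fun A _ X => esuper X [::] k.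
Definition hfam k : family K := fun A _ X => esuper [::] X k.

Lemma efam_symfun k : is_symfun (fam (efam k)).
Proof.
apply: natural_symfun => [A B f c X|N X Y pe|N X|].
- exact: rmorph_esuper.
- rewrite /efam /esuper; congr (_ k); apply: foldr_perm pe => x y s; exact: mulgenC.
- by rewrite /efam /esuper /= mulgen0.
- exists k.+1 => N; apply: msize_esuper => // x; exact: msize_vars.
Qed.

Lemma hfam_symfun k : is_symfun (fam (hfam k)).
Proof.
apply: natural_symfun => [A B f c X|N X Y pe|N X|].
- exact: rmorph_esuper.
- rewrite /hfam /esuper /=; congr (_ k); apply: foldr_perm pe => x y s; exact: divgenC.
- by rewrite /hfam /esuper /= divgen0.
- exists k.+1 => N; apply: msize_esuper => // x; exact: msize_vars.
Qed.

Lemma vars_rcons N :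
  vars K N.+1 = rcons [seq mwiden p | p <- vars K N] 'X_ord_max.
Proof.
rewrite /vars enum_ordSr map_rcons; congr rcons.
rewrite -map_comp -[RHS]map_comp; apply: eq_map => i /=.
by rewrite mwidenX mnmwiden1.
Qed.

Lemma mesym_esuper N k : mesym N K k = esuper (vars K N) [::] k.
Proof.
elim: N k => [|N IH] k.
  have -> : vars K 0 = [::] by apply: size0nil; rewrite size_vars.
  rewrite /esuper /=; case: k => [|k]; first by rewrite mesym0E.
  by rewrite mesym_geqnE.
rewrite vars_rcons; case: k => [|k].
  rewrite mesym0E /esuper; elim: (rcons _ _) => //= x X IHX.
  by rewrite /mulgen mulr0 addr0 -IHX.
have -> : esuper (rcons [seq mwiden p | p <- vars K N] 'X_ord_max) [::] =
          esuper ('X_ord_max :: [seq mwiden p | p <- vars K N]) [::].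
  rewrite /esuper; apply: foldr_perm => [*|]; first exact: mulgenC.
  by rewrite perm_rcons.
rewrite mesymSS !IH (@rmorph_esuper _ _ (@mwiden N K)).
rewrite (@rmorph_esuper _ _ (@mwiden N K)).
by rewrite {3}/esuper /= /mulgen mulrC.
Qed.

End Generators.

(** * A symmetric function of bounded degree is determined by finitely many variables *)

Section Determined.
Variable K : fieldType.

Lemma drop_lastX N (m : 'X_{1..N.+1}) :
  drop_last 'X_[K, m] =
  if m ord_max == 0%N then 'X_[[multinom m (lift ord_max i) | i < N]] else 0.
Proof.
rewrite /drop_last mmapX /mmap1 big_ord_recr /= unlift_none.
have liftE (i : 'I_N) : widen_ord (leqnSn N) i = lift ord_max i.
  by apply: val_inj; rewrite /= /bump leqNgt ltn_ord.
case: eqP => [->|/eqP m0]; last by rewrite expr0n (negbTE m0) mulr0.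
rewrite expr0 mulr1 mpolyXE_id; apply: eq_bigr => i _.
by rewrite liftE liftK mnmE.
Qed.

Lemma mcoeff_drop_last N (p : {mpoly K[N.+1]}) (m : 'X_{1..N.+1}) :
  m ord_max = 0%N ->
  (drop_last p)@_[multinom m (lift ord_max i) | i < N] = p@_m.
Proof.
move=> m0; rewrite {1}(mpolyE p).
have -> : drop_last (\sum_(m <- msupp p) p@_m *: 'X_[m]) =
    \sum_(m <- msupp p) p@_m *: drop_last 'X_[m].
  rewrite /drop_last raddf_sum; apply: eq_bigr => i _ /=.
  by rewrite mmapZ mul_mpolyC.
rewrite raddf_sum /= [in RHS](mpolyE p) raddf_sum /=.
apply: eq_bigr => m' _; rewrite !mcoeffZ drop_lastX mcoeffX; congr (_ * _).
case: eqP => [m'0|/eqP m'0]; last first.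
  rewrite mcoeff0; case: eqP => // E.
  by rewrite E m0 eqxx in m'0.
rewrite mcoeffX; congr (_%:R); congr nat_of_bool; apply/eqP/eqP => [E|-> //].
apply/mnmP => i; case: (unliftP ord_max i) => [j ->|->]; last by rewrite m0 m'0.
by move/mnmP: E => /(_ j); rewrite !mnmE.
Qed.

(** A monomial of degree at most N misses one of the N+1 variables. By symmetry this may be the last
    one, and such coefficients survive dropping it. *)
Lemma symmetric_drop_eq0 N (p : {mpoly K[N.+1]}) : p \is symmetric ->
  (msize p <= N.+1)%N -> drop_last p = 0 -> p = 0.
Proof.
move=> /issymP sp szp dp; apply/mpolyP => m; rewrite mcoeff0.
case: (boolP (m \in msupp p)) => [msp|]; last by rewrite -mcoeff_eq0 => /eqP.
have [i mi] : exists i, m i = 0%N.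
  apply: contrapT => no; have := leq_trans (msize_mdeg_lt msp) szp.
  rewrite ltnS mdegE leqNgt; apply/negP/negPn.
  have : (\sum_(i < N.+1) 1 <= \sum_(i < N.+1) m i)%N.
    by apply: leq_sum => i _; rewrite lt0n; apply/eqP => mi; apply: no; exists i.
  by rewrite sum1_card card_ord.
pose s := tperm i ord_max.
have <- : (msym s p)@_m = p@_m by rewrite sp.
rewrite mcoeff_sym -mcoeff_drop_last ?dp ?mcoeff0 //.
by rewrite mnmE tpermR.
Qed.

Lemma symfun_eq0 (f : polyfam K) D : (forall N, f N \is symmetric) ->
  (forall N, drop_last (f N.+1) = f N) -> (forall N, (msize (f N) <= D)%N) ->
  f D = 0 -> forall N, f N = 0.
Proof.
move=> sf cf df fD N; case/orP: (leq_total N D) => [/subnKC E|/subnKC E].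
  move: fD; rewrite -E; elim: (D - N)%N => [|k IH]; first by rewrite addn0.
  rewrite addnS => h; apply: IH; rewrite -cf h.
  by rewrite /drop_last mmap0.
rewrite -E; elim: (N - D)%N => [|k IH]; rewrite ?addn0 // addnS.
apply: symmetric_drop_eq0 => //; last by rewrite cf.
by rewrite (leq_trans (df _)) // leqW ?leq_addr.
Qed.

End Determined.

Section RibbonFamily.
Variables (K : fieldType) (q : K) (n : nat).
Hypotheses (n0 : (0 < n)%N) (q0 : q != 0).

Definition gfam (l' l : seq bool) : family K :=
  fun A c X => addops (c q) n X (delta A l') l.

(* Every move raises this statistic by [n], which bounds the degree. *)
Definition posw (l : seq bool) : nat := (\sum_(j < size l) nth false l j * j)%N.

Lemma posw_mv k l : can n k l -> posw (mv n k l) = (posw l + n)%N.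
Proof.
move=> c; rewrite /posw size_mv //; have /and3P[a kn b] := c.
have kl : (k < size l)%N by apply: leq_ltn_trans kn; apply: leq_addr.
have ne : Ordinal kn != Ordinal kl by rewrite -val_eqE /= -{2}[k]addn0 eqn_add2l -lt0n.
rewrite (bigD1 (Ordinal kl)) //= (bigD1 (Ordinal kn)) //=.
rewrite [in RHS](bigD1 (Ordinal kl)) //= [in RHS](bigD1 (Ordinal kn)) //=.
rewrite !nth_mv eqxx a (negbTE b) -{1}[k]addn0 eqn_add2l eq_sym eqn0Ngt n0 /=.
rewrite eqxx !mul1n !mul0n !add0n.
rewrite (eq_bigr (fun j : 'I_(size l) => nth false l j * j)%N); first by lia.
move=> j /andP[jk jn]; rewrite nth_mv.
by rewrite -!val_eqE /= in jk jn; rewrite (negbTE jk) (negbTE jn).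
Qed.

Lemma msize_addops N (X : seq {mpoly K[N]}) l' l :
  (forall x, x \in X -> msize x <= 2)%N ->
  (msize (addops q%:MP n X (delta _ l') l) <= (posw l').+1 - posw l)%N.
Proof.
elim: X l => [|x X IH] l hX /=.
  rewrite /delta; case: eqP => [->|_]; last by rewrite mulr0n msize0.
  by rewrite mulr1n msize1 subSnn.
have hx := hX x (mem_head _ _).
have hX' y : y \in X -> (msize y <= 2)%N by move=> yX; apply: hX; rewrite inE yX orbT.
have {}IH l1 := IH l1 hX'.
rewrite /addop; move: (iota 0 (size l - n)) => ks; elim: ks l => [|k ks IHk] l /=.
  exact: IH.
rewrite /step; apply: msizeD_bound => //; case: ifP => c; last by rewrite msize0.
have := IHk (mv n k l); rewrite posw_mv //.
set p := foldr _ _ _ _; rewrite -rmorphXn /= -mulrA mul_mpolyC.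
have [->|p0] := eqVneq p 0; first by rewrite scaler0 mulr0 msize0.
have : (0 < msize p)%N by rewrite lt0n msize_poly_eq0.
case E : (msize p) => [//|m] _ h.
have sc : (msize (q ^+ jmp n k l *: p) <= m.+1)%N by rewrite -E; apply: msizeZ_le.
apply: leq_trans (msizeM_bound hx sc) _; rewrite add1n.
by move: h; set a := posw l'; set b := posw l; move: n n0 a b; clear; lia.
Qed.

Lemma gfam_symfun l' l : is_symfun (fam (gfam l' l)).
Proof.
apply: natural_symfun => [A B f c X|N X Y pe|N X|].
- by rewrite /gfam rmorph_addops rmorph_delta.
- rewrite /gfam /addops; congr (_ l); apply: foldr_perm pe => x y s.
  by apply: addop_comm => //; rewrite mpolyC_eq0.
- by rewrite /gfam /addops /= addop0.
- exists (posw l').+1 => N; rewrite /fam /gfam.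
  apply: leq_trans (msize_addops _ _ _) _; last exact: leq_subr.
  by move=> x; apply: msize_vars.
Qed.

Lemma natural_gfam l' l : natural_family (gfam l' l).
Proof. by move=> A B f c X; rewrite /gfam rmorph_addops rmorph_delta. Qed.

Lemma ribbonG_fam M (la mu : young) : in_box M la -> mu `<=` la ->
  ribbonG q n la mu = fam (gfam (bits M la) (bits M mu)).
Proof.
move=> bla sub; apply: functional_extensionality_dep => N.
exact: ribbonG_addops.
Qed.

End RibbonFamily.

Section Generation.
Variable K : fieldType.
Implicit Types (f : symfun K).

Definition esymf k : symfun K := SymFun (asboolT (efam_symfun K k)).
Definition hsymf k : symfun K := SymFun (asboolT (hfam_symfun K k)).

Lemma symfunP f : is_symfun (symfun_val f).
Proof. by apply/asboolP; apply: (valP f). Qed.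

Lemma symfun_ext f g : (forall N, symfun_val f N = symfun_val g N) -> f = g.
Proof. by move=> E; apply: val_inj; apply: polyfamP. Qed.

Lemma symfun_addE f g N : symfun_val (f + g) N = symfun_val f N + symfun_val g N.
Proof. by []. Qed.

Lemma symfun_mulE f g N : symfun_val (f * g) N = symfun_val f N * symfun_val g N.
Proof. by []. Qed.

Lemma symfun_scaleE a f N : symfun_val (a *: f) N = a *: symfun_val f N.
Proof. by []. Qed.

Lemma symfun_1E N : symfun_val (1 : symfun K) N = 1.
Proof. by []. Qed.

Lemma peval_symfun (c : K -> K) (v : nat -> symfun K) e N :
  symfun_val (peval (fun a => (c a)%:A) v e) N =
  peval (fun a => (c a)%:MP) (fun k => symfun_val (v k) N) e.
Proof.
elim: e => [a|k|e1 h1 e2 h2|e1 h1 e2 h2].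
- rewrite [peval _ _ _]/= [in RHS]/=.
  transitivity (c a *: (1 : {mpoly K[N]})); last by rewrite -mul_mpolyC mulr1.
  exact: symfun_scaleE.
- by [].
- by rewrite [peval _ _ _ in LHS]/= symfun_addE h1 h2.
- by rewrite [peval _ _ _ in LHS]/= symfun_mulE h1 h2.
Qed.

(** Indices shift by one because the variables of [t] stand for e_1, ..., e_D, while the generator
    of index 0 is e_0 = 1. *)
Lemma pexp_mpoly D (t : {mpoly K[D]}) : exists e : pexp K,
  forall (A : comNzRingType) (c : {rmorphism K -> A}) (v : nat -> A),
    peval c v e = mmap c (fun i : 'I_D => v i.+1) t.
Proof.
pose P (t : {mpoly K[D]}) := exists e : pexp K,
  forall (A : comNzRingType) (c : {rmorphism K -> A}) (v : nat -> A),
    peval c v e = mmap c (fun i : 'I_D => v i.+1) t.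
have PC a : P a%:MP by exists (PConst a) => A c v; rewrite mmapC.
have PD t1 t2 : P t1 -> P t2 -> P (t1 + t2).
  by move=> [e1 h1] [e2 h2]; exists (PAdd e1 e2) => A c v; rewrite /= h1 h2 rmorphD.
have PM t1 t2 : P t1 -> P t2 -> P (t1 * t2).
  by move=> [e1 h1] [e2 h2]; exists (PMul e1 e2) => A c v; rewrite /= h1 h2 rmorphM.
have PX i : P 'X_i by exists (PVar _ i.+1) => A c v; rewrite mmapX mmap1U.
rewrite -/(P t) (mpolyE t); apply: big_ind => [||m _].
- by rewrite -mpolyC0; apply: PC.
- exact: PD.
- rewrite -mul_mpolyC; apply: (PM); first exact: PC.
  rewrite mpolyXE_id; apply: big_ind => [||i _]; first by rewrite -mpolyC1; apply: PC.
    exact: PM.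
  by elim: (m i) => [|j IH]; rewrite ?expr0 ?exprS; [rewrite -mpolyC1; apply: PC | apply: (PM)].
Qed.

(** The fundamental theorem in D variables supplies the expression. Its weight bound keeps the
    degree below D, so the equality in D variables extends to any number of them. *)
Lemma symfun_generated f : exists e : pexp K,
  forall N, symfun_val f N = peval (@mpolyC N K) (esuper (vars K N) [::]) e.
Proof.
have [sf cf [D df]] := symfunP f.
have [t [tE tw]] := sym_fundamental (sf D).
have [e he] := pexp_mpoly t; exists e.
pose g := peval (fun a : K => a%:A) esymf e : symfun K.
have gN N : symfun_val g N = mmap (@mpolyC N K) (fun i : 'I_D => esuper (vars K N) [::] i.+1) t.
  by rewrite /g (peval_symfun id) -he.
have gD : symfun_val g D = symfun_val f D.
  rewrite gN -tE /comp_mpoly /mmap; apply: eq_bigr => m _; congr (_ * _).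
  by apply: mmap1_eq => i; rewrite tnth_mktuple mesym_esuper.
have dg N : (msize (symfun_val g N) <= D)%N.
  rewrite gN /mmap; apply: leq_trans (msize_sum _ _ _) _.
  rewrite big_seq; elim/big_ind: _ => // [a b ha hb|m msp].
    by rewrite geq_max ha.
  have mw : (mnmwgt m < D)%N.
    by rewrite (leq_trans (mmeasure_mnm_lt mnmwgt msp)) // (leq_trans tw).
  rewrite mul_mpolyC (leq_trans (msizeZ_le _ _)) // (leq_trans _ mw) //.
  rewrite /mmap1 /mnmwgt; elim/big_ind2: _ => [|p a r b|i _]; first by rewrite msize1.
    exact: msizeM_bound.
  elim: (m i) => [|j IH]; first by rewrite expr0 msize1.
  rewrite exprS mulSn; apply: msizeM_bound IH.
  by apply: msize_esuper => // x; apply: msize_vars.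
have [sg cg _] := symfunP g.
have E : forall N, (symfun_val f N - symfun_val g N) = 0.
  apply: (@symfun_eq0 _ (fun N => symfun_val f N - symfun_val g N) D) => [N|N|N|].
  - by apply: rpredB; [apply: sf | apply: sg].
  - rewrite -(cf N) -(cg N) /drop_last.
    exact: (rmorphB (mmap (@mpolyC N K) (fun i : 'I_N.+1 =>
       if unlift ord_max i is Some j then 'X_j else 0))).
  - by apply: msizeD_bound; rewrite ?msizeN.
  - by rewrite gD subrr.
move=> N; have /eqP := E N; rewrite subr_eq0 => /eqP ->.
by rewrite /g (peval_symfun id).
Qed.

End Generation.

(** * The semi-linear map *)

Section Omega.
Variables (K : fieldType) (bar : {rmorphism K -> K}).
Hypothesis char0 : injective (fun k : nat => k%:R : K).

Lemma mpoly_char0 M : injective (fun k : nat => k%:R : {mpoly K[M]}).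
Proof.
move=> i j /= E; apply: char0.
by apply/eqP; rewrite -(mpolyC_eq M) !mpolyC_nat E.
Qed.

(** Constants enter through [bar], which makes evaluation semi-linear in the coefficients. *)
Definition barC M : K -> {mpoly K[M]} := @mpolyC M K \o bar.
HB.instance Definition _ M := GRing.RMorphism.on (@barC M).

Definition evars N (e : pexp K) : {mpoly K[N]} :=
  peval (@mpolyC N K) (esuper (vars K N) [::]) e.

Lemma evars_at_point M (X : seq {mpoly K[M]}) e :
  at_point (@barC M) X (evars (size X) e) = peval (@barC M) (esuper X [::]) e.
Proof.
rewrite rmorph_peval; congr (peval _ _ e); apply: functional_extensionality_dep => a /=.
  exact: at_pointC.
by rewrite rmorph_esuper at_point_vars.
Qed.

(** Both evaluations extend to supersymmetric functions of (X | Z) which agree for empty Z, hence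
    also for empty X. This makes the choice of an expression in [omega] harmless. *)
Lemma peval_hvars_ext e e' M (X : seq {mpoly K[M]}) :
  (forall N, evars N e = evars N e') ->
  peval (@barC M) (esuper [::] X) e = peval (@barC M) (esuper [::] X) e'.
Proof.
move=> E; apply: (super_eq (@mpoly_char0 M) (super_peval (@barC M) e)
  (super_peval (@barC M) e')) => Y.
by rewrite -!evars_at_point E.
Qed.

Section RibbonOmega.
Variables (q : K) (n : nat).
Hypotheses (n0 : (0 < n)%N) (q0 : q != 0) (qbar : bar q = q^-1).

(** Two supersymmetric functions are compared: [addrem] at 1/q and the evaluation of [e]. On the
    first list they agree by applying to the hypothesis a morphism that conjugates coefficients, and
    so turns q into 1/q. The claim is their equality on the second list. *)
Lemma peval_hvars_ribbon l' l e M (X : seq {mpoly K[M]}) :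
  (forall N, fam (gfam q n l' l) N = evars N e) ->
  peval (@barC M) (esuper [::] X) e =
  foldr (remop n (q^-1)%:MP) (delta _ l') X l.
Proof.
move=> E; pose qi : {mpoly K[M]} := (q^-1)%:MP.
have qi0 : qi != 0 by rewrite mpolyC_eq0 invr_eq0.
have := super_eq (@mpoly_char0 M) (super_addrem n0 qi0 (delta _ l') l)
  (super_peval (@barC M) e) => /(_ _ [::] X) <- // Y.
pose f : {rmorphism {mpoly K[size Y]} -> {mpoly K[M]}} :=
  @at_point K (size Y) _ (@barC M) Y.
transitivity (f (fam (gfam q n l' l) (size Y))); last by rewrite E; apply: evars_at_point.
have H : f (fam (gfam q n l' l) (size Y)) =
    addops (f q%:MP) n (map f (vars K (size Y))) (delta _ l') l.
  exact: natural_gfam.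
have V : map f (vars K (size Y)) = Y by apply: at_point_vars.
have fq : f q%:MP = qi.
  transitivity ((bar q)%:MP_[M]); last by rewrite qbar.
  exact: at_pointC.
by rewrite H V fq.
Qed.

Lemma addops_conj M0 (la mu : young) M (Y : seq {mpoly K[M]}) :
  in_box M0 la ->
  addops (q%:MP) n Y (delta _ (bits M0 (conjugate la))) (bits M0 (conjugate mu)) =
  foldr (remop n (q^-1)%:MP) (delta _ (bits M0 la)) [seq y * (q ^+ n.-1)%:MP | y <- Y]
    (bits M0 mu).
Proof.
move=> bla; rewrite /addops !bits_conjugate.
rewrite (@addops_flip n n0 _ q%:MP (q^-1)%:MP) ?flipK ?delta_flip //.
  by congr (foldr _ _ _ _); apply: eq_map => y; rewrite rmorphXn.
by rewrite -rmorphM /= divff.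
Qed.

End RibbonOmega.

Variables (q : K) (n : nat).

Definition homega (k : nat) : symfun K := q ^+ (n.-1 * k) *: hsymf K k.

Definition omega_at (e : pexp K) : symfun K := peval (fun a => (bar a)%:A) homega e.

Lemma esuper_scale (R : comNzRingType) (c : R) (X : seq R) k :
  esuper [::] [seq x * c | x <- X] k = c ^+ k * esuper [::] X k.
Proof.
rewrite /esuper /=; elim: X k => [|x X IH] k /=.
  by case: k => [|k]; rewrite ?expr0 ?mul1r // mulr0.
by elim: k => [|k IHk] /=; rewrite ?IH // IHk !exprS; ring.
Qed.

(** As h_k is homogeneous of degree k, the powers of q in [homega] amount to scaling every variable
    by q^(n-1). *)
Lemma omega_atE e M : symfun_val (omega_at e) M =
  peval (@barC M) (esuper [::] [seq x * (q ^+ n.-1)%:MP | x <- vars K M]) e.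
Proof.
rewrite /omega_at peval_symfun; congr (peval _ _ e).
apply: functional_extensionality_dep => k; rewrite esuper_scale -rmorphXn /=.
by rewrite -exprM mul_mpolyC.
Qed.

Lemma omega_at_ext e e' : (forall N, evars N e = evars N e') ->
  omega_at e = omega_at e'.
Proof.
by move=> E; apply: symfun_ext => N; rewrite !omega_atE; apply: peval_hvars_ext.
Qed.

Definition expr_of (f : symfun K) : pexp K := projT1 (cid (symfun_generated f)).

Lemma expr_ofE f N : symfun_val f N = evars N (expr_of f).
Proof. by rewrite /expr_of; case: cid => e /= ->. Qed.

(* Independent of the chosen expression by [omega_at_ext]. *)
Definition omega (f : symfun K) : symfun K := omega_at (expr_of f).

Lemma omegaE f e : (forall N, symfun_val f N = evars N e) -> omega f = omega_at e.
Proof. by move=> E; apply: omega_at_ext => N; rewrite -expr_ofE E. Qed.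

Lemma omegaD f g : omega (f + g) = omega f + omega g.
Proof.
rewrite (@omegaE _ (PAdd (expr_of f) (expr_of g))) // => N.
by rewrite symfun_addE !expr_ofE.
Qed.

Lemma omegaM f g : omega (f * g) = omega f * omega g.
Proof.
rewrite (@omegaE _ (PMul (expr_of f) (expr_of g))) // => N.
by rewrite symfun_mulE !expr_ofE.
Qed.

Lemma omegaZ a f : omega (a *: f) = bar a *: omega f.
Proof.
rewrite (@omegaE _ (PMul (PConst a) (expr_of f))) => [|N].
  by rewrite /omega_at [LHS]/= -scalerAl mul1r.
by rewrite symfun_scaleE expr_ofE /evars /= mul_mpolyC.
Qed.

Lemma omega1 : omega 1 = 1.
Proof.
rewrite (@omegaE _ (PConst 1)) => [|N]; last by rewrite symfun_1E.
by rewrite /omega_at /= rmorph1 scale1r.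
Qed.

Hypotheses (n0 : (0 < n)%N) (q0 : q != 0) (qbar : bar q = q^-1).

Definition box_size (S : {fset cell}) : nat :=
  (\max_(c <- S) maxn c.1 c.2).+1.

Lemma in_box_size S : in_box (box_size S) S.
Proof.
move=> c cS; have : (maxn c.1 c.2 <= \max_(c <- S) maxn c.1 c.2)%N.
  by rewrite (big_fsetD1 c) //= leq_maxl.
by rewrite geq_max !ltnS => /andP[].
Qed.

Lemma sub_transpose (S T : {fset cell}) : S `<=` T -> transpose S `<=` transpose T.
Proof.
by move=> /fsubsetP sub; apply/fsubsetP => -[i j]; rewrite !mem_transpose => /sub.
Qed.

Lemma ribbonG_symfun (la mu : young) : mu `<=` la -> is_symfun (ribbonG q n la mu).
Proof.
move=> sub; rewrite (ribbonG_fam q n0 (@in_box_size la) sub).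
exact: gfam_symfun.
Qed.

Lemma omega_ribbonG (la mu : young) (f g : symfun K) : mu `<=` la ->
  symfun_val f = ribbonG q n la mu ->
  symfun_val g = ribbonG q n (conjugate la) (conjugate mu) -> omega f = g.
Proof.
move=> sub fE gE; have bla := @in_box_size la.
apply: symfun_ext => N; rewrite omega_atE gE.
have sub' : conjugate mu `<=` conjugate la by apply: sub_transpose.
have bla' : in_box (box_size la) (conjugate la) by apply: in_box_transpose.
rewrite (ribbonG_addops q N n0 bla' sub') -/(vars K N) addops_conj //.
apply: peval_hvars_ribbon => // N'.
by rewrite -expr_ofE fE (ribbonG_fam q n0 bla sub).
Qed.

End Omega.

(** * Schur functions *)

Section SingleCells.
Implicit Types (S : {fset cell}) (P : {fset {fset cell}}).

Lemma ribbon1P S : is_ribbon 1 S <-> exists c, S = [fset c].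
Proof.
split=> [[_ _ /eqP/cardfs1P[c ->] _]|[[i j] ->]]; first by exists c.
split.
- have [k kE] : exists k, k = i.+1 by exists i.+1.
  have [l lE] : exists l, l = j.+1 by exists j.+1.
  pose D : {fset cell} := [fset c in [seq (a, b) | a <- iota 0 k, b <- iota 0 l]].
  have memD a b : ((a, b) \in D) = (a <= i)%N && (b <= j)%N.
    rewrite !inE -[(a <= i)%N]ltnS -[(b <= j)%N]ltnS -kE -lE.
    apply/allpairsP/andP => [[[x y] /=]|[ai bj]].
      by rewrite !mem_iota => -[/andP[_ xi] /andP[_ yj] [-> ->]].
    by exists (a, b); rewrite !mem_iota.
  have dD : is_diagram D.
    by apply/allP => -[a b]; rewrite !memD /= => /andP[ai bj]; lia.
  have dD' : is_diagram (D `\ (i, j)).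
    apply/allP => -[a b]; rewrite !in_fsetD1 !memD /= !xpair_eqE => h; lia.
  exists (Young dD), (Young dD'); split; first exact: fsubD1set.
  apply/fsetP => -[a b]; rewrite in_fsetD in_fset1 in_fsetD1 memD xpair_eqE; lia.
- move=> c d; have /fset1P h1 := fsvalP c; have /fset1P h2 := fsvalP d.
  have -> : c = d by apply: val_inj; apply: etrans h1 (esym h2).
  exact: connect0.
- by rewrite cardfs1.
- by move=> [a [b [/fset1P E /fset1P E' _ _]]]; have := etrans E (esym E') => -[]; lia.
Qed.

Lemma spin1 c : spin [fset c] = 0%N.
Proof.
rewrite /spin /nrows; have -> : [fset x.1 | x in [fset c]] = [fset c.1].
  apply/fsetP => r; rewrite in_fset1; apply/imfsetP/eqP => [[x /= /fset1P -> //]|->].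
  by exists c; rewrite //= in_fset1.
by rewrite cardfs1.
Qed.

Lemma toprightmost1 c : toprightmost [fset c] c.
Proof. by split=> [|d /fset1P ->]; rewrite ?in_fset1. Qed.

Lemma tiling1E S P : is_tiling 1 S P -> P = [fset [fset c] | c in S].
Proof.
move=> [rib dis cov]; apply/fsetP => A; apply/idP/imfsetP => [AP|[c /= /cov[B BP cB] ->]].
  have /ribbon1P[c E] := rib _ AP; exists c => //=.
  by apply/cov; exists A => //; rewrite E in_fset1.
have /ribbon1P[d E] := rib _ BP; rewrite E in cB *.
by move: cB BP => /fset1P ->; rewrite E.
Qed.

Lemma tiling1_stats S P : is_tiling 1 S P ->
  #|` P| = #|` S| /\ (\sum_(A <- P) spin A)%N = 0%N.
Proof.
move=> /tiling1E ->; split; first by rewrite card_imfset //= => c d /fset1_inj.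
rewrite big_seq big1 // => A /imfsetP[c _ ->]; exact: spin1.
Qed.

Lemma horizontal_strip1 S : is_skew S ->
  is_horizontal_strip 1 S <-> forall i j, (i.+1, j) \in S -> (i, j) \notin S.
Proof.
move=> sS; split=> [[_ [P [tP hP]]] i j ijS|h].
  have PE := tiling1E tP; apply: (hP [fset (i.+1, j)] (i.+1, j)) => //.
    by rewrite PE; apply/imfsetP; exists (i.+1, j).
  exact: toprightmost1.
split=> //; exists [fset [fset c] | c in S]; split.
  split=> [A /imfsetP[c _ ->]|A B /imfsetP[c _ ->] /imfsetP[d _ ->] ne|c].
  - by apply/ribbon1P; exists c.
  - by rewrite fdisjoint1X in_fset1; apply/eqP => E; apply: ne; rewrite E.
  - split=> [cS|[A /imfsetP[d /= dS ->] /fset1P -> //]].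
    by exists [fset c]; rewrite ?in_fset1 //; apply/imfsetP; exists c.
move=> A [r c] /imfsetP[d /= dS ->] [/fset1P E _] i /= rE.
by apply: h; rewrite -rE E.
Qed.

End SingleCells.

Lemma empty_diagram : is_diagram fset0.
Proof. by apply/allP. Qed.

Definition young0 : young := Young empty_diagram.

Section Tableaux.
Variables (la : young) (N : nat).
Implicit Types (T : {ffun la -> 'I_N}) (C : chain la N).

Definition level T (i : nat) : {fset cell} :=
  [fset val c | c in [pred c : la | (T c < i)%N]].

Lemma mem_level T i (c : la) : (val c \in level T i) = (T c < i)%N.
Proof.
apply/imfsetP/idP => [[d /= dT /val_inj ->] //|h].
by exists c.
Qed.

Lemma level_sub T i : level T i `<=` la.
Proof. by apply/fsubsetP => x /imfsetP[c _ ->]; apply: fsvalP. Qed.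

Lemma levelP T i : level T i \in fpowerset la.
Proof. by rewrite fpowersetE level_sub. Qed.

Definition to_chain T : chain la N := [ffun i : 'I_N.+1 => [` levelP T i]].

Lemma to_chainE T i : val (to_chain T i) = level T i.
Proof. by rewrite ffunE. Qed.

Lemma to_chain_inj : injective to_chain.
Proof.
move=> T T' E; apply/ffunP => c; apply: val_inj => /=.
have H i : (i < N.+1)%N -> (T c < i)%N = (T' c < i)%N.
  move=> iN; rewrite -!mem_level; have := congr1 (fun C : chain la N => val (C (Ordinal iN))) E.
  by rewrite !to_chainE /= => ->.
have h1 : (T c < T' c)%N = false by rewrite H ?ltnn // ltnW // ltnS.
have h2 : (T' c < T c)%N = false by rewrite -H ?ltnn // ltnW // ltnS.
by apply/eqP; rewrite eqn_leq leqNgt h2 /= leqNgt h1.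
Qed.

Lemma level_diagram T i : is_ssyt T -> is_diagram (level T i).
Proof.
move=> sT; apply/allP => -[r s] rsT; have rsla := fsubsetP (level_sub T i) _ rsT.
have /allP/(_ _ rsla)/andP[/= u l] := diagramP la.
move: rsT; rewrite -[(r, s)]/(val [` rsla]) mem_level => Ti.
rewrite -[(r.-1, s)]/(val [` u]) -[(r, s.-1)]/(val [` l]) !mem_level.
have [_ hu] := sT [` u] [` rsla]; have [hl _] := sT [` l] [` rsla].
apply/andP; split.
- case: r rsla u Ti hu {hl l} => [|r] rsla u Ti hu.
    by have -> : [` u] = [` rsla] by apply: val_inj.
  by apply: ltn_trans Ti; apply: hu.
- clear hu; case: s rsla {u} l Ti hl => [|s] rsla l Ti hl.
    by have -> : [` l] = [` rsla] by apply: val_inj.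
  by apply: leq_ltn_trans Ti; apply: hl.
Qed.

Lemma mem_chain_step T i (c : la) :
  (val c \in chain_step (to_chain T) i) = (T c == i).
Proof.
rewrite /chain_step in_fsetD !to_chainE !mem_level /= /bump /= add1n ltnS -leqNgt.
by rewrite -val_eqE /= eqn_leq andbC.
Qed.

Lemma chain_step_sub C i : chain_step C i `<=` la.
Proof.
apply: fsubset_trans (fsubsetDl _ _) _.
by have := fsvalP (C (lift ord0 i)); rewrite fpowersetE.
Qed.

Lemma to_chain_tableau T : is_ssyt T -> is_ribbon_tableau 1 young0 (to_chain T).
Proof.
move=> sT; have ext (S : {fset cell}) i : S `<=` la ->
   (forall c : la, (val c \in S) = (T c < i)%N) -> S = level T i.
  move=> Sla h; apply/fsetP => x; apply/idP/idP => xS.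
    have xla := fsubsetP Sla _ xS.
    by rewrite -[x]/(val [` xla]) mem_level -h.
  have xla := fsubsetP (level_sub T i) _ xS.
  by rewrite -[x]/(val [` xla]) h -mem_level.
split.
- rewrite to_chainE; apply/esym/ext; first exact: fsub0set.
  by move=> c; rewrite in_fset0.
- rewrite to_chainE; apply/esym/ext => // c.
  by rewrite fsvalP /= ltn_ord.
- by move=> i; rewrite to_chainE; apply: level_diagram.
- move=> i.
  have sub : val (to_chain T (widen_ord (leqnSn N) i)) `<=` val (to_chain T (lift ord0 i)).
    rewrite !to_chainE; apply/fsubsetP => x xl; have xla := fsubsetP (level_sub T _) _ xl.
    move: xl; rewrite -[x]/(val [` xla]) !mem_level /= /bump add1n.
    exact: ltnW.
  split=> //; apply/horizontal_strip1.
    rewrite /chain_step !to_chainE.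
    exists (Young (level_diagram (lift ord0 i) sT)),
           (Young (level_diagram (widen_ord (leqnSn N) i) sT)).
    by split=> //; move: sub; rewrite !to_chainE.
  move=> r s h; apply/negP => h'.
  have la1 := fsubsetP (chain_step_sub _ _) _ h; have la2 := fsubsetP (chain_step_sub _ _) _ h'.
  move: h h'; rewrite -[(r.+1, s)]/(val [` la1]) -[(r, s)]/(val [` la2]) !mem_chain_step.
  move=> /eqP E /eqP E'; have [_ /(_ erefl (leqnn _))] := sT [` la2] [` la1].
  by rewrite E E' ltnn.
Qed.

Lemma tableau_to_chain C : is_ribbon_tableau 1 young0 C ->
  exists2 T, is_ssyt T & C = to_chain T.
Proof.
move=> [C0 CN dC sC]; pose cf j := val (C (inord j)).
have wE (i : 'I_N) : widen_ord (leqnSn N) i = inord i.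
  by apply: val_inj; rewrite /= inordK // ltnW // ltnS ltn_ord.
have lE (i : 'I_N) : lift ord0 i = inord i.+1.
  by apply: val_inj; rewrite /= inordK // ltnS.
have mono j k : (j <= k)%N -> (k <= N)%N -> cf j `<=` cf k.
  move=> /subnKC <-; elim: (k - j)%N => [|d IH]; first by rewrite addn0 fsubset_refl.
  rewrite addnS => dN; apply: fsubset_trans (IH (ltnW dN)) _.
  by have [sub _] := sC (Ordinal dN); move: sub; rewrite wE lE.
have ex (c : la) : exists i : 'I_N, val c \in chain_step C i.
  apply: contrapT => no.
  have out k : (k <= N)%N -> val c \notin cf k.
    elim: k => [|k IH] kN.
      by rewrite /cf (_ : inord 0 = ord0) ?C0 ?in_fset0 //; apply: val_inj; rewrite /= inordK.
    apply/negP => ck; apply: no; exists (Ordinal kN).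
    by rewrite /chain_step in_fsetD wE lE ck andbT; apply: IH; apply: ltnW.
  have := out N (leqnn _); rewrite /cf (_ : inord N = ord_max) ?CN ?fsvalP //.
  by apply: val_inj; rewrite /= inordK.
pose T : {ffun la -> 'I_N} := [ffun c => xchoose (ex c)].
have TP c : val c \in chain_step C (T c) by rewrite ffunE; apply: (xchooseP (ex c)).
have memT (c : la) k : (k <= N)%N -> (val c \in cf k) = (T c < k)%N.
  move=> kN; have := TP c; rewrite /chain_step in_fsetD wE lE => /andP[n1 n2].
  case: (ltnP (T c) k) => h; first exact: (fsubsetP (mono _ _ h kN)).
  by apply/negbTE; apply: contra n1; apply: (fsubsetP (mono _ _ h _)); apply: ltnW.
exists T; last first.
  apply/ffunP => i; apply: val_inj; rewrite to_chainE.
  have iE : val (C i) = cf i by rewrite /cf inord_val.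
  apply/fsetP => x; apply/idP/idP => xC.
    have xla : x \in (la : {fset cell}).
      by have := fsvalP (C i); rewrite fpowersetE => /fsubsetP; apply.
    by move: xC; rewrite iE -[x]/(val [` xla]) memT ?mem_level // -ltnS.
  have xla := fsubsetP (level_sub T i) _ xC.
  by move: xC; rewrite iE -[x]/(val [` xla]) memT ?mem_level // -ltnS.
(* Weak growth in both directions holds because every member of the chain is a diagram; strictness
   down columns is left to horizontality. *)
have weak (c d : la) : ((val c).1 <= (val d).1)%N -> ((val c).2 <= (val d).2)%N -> (T c <= T d)%N.
  move=> h1 h2; rewrite -ltnS -memT //; have : val d \in cf (T d).+1 by rewrite memT.
  rewrite [val d]surjective_pairing [val c]surjective_pairing => dd.
  by apply: diagram_le dd h1 h2; apply: dC.
move=> c d; split=> E lt; first by apply: weak; [rewrite E | apply: ltnW].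
rewrite ltn_neqAle weak ?E //; last exact: ltnW.
rewrite andbT; apply/negP => /eqP Tcd.
(* Two equal labels in one column would, by convexity, put the square just above [d] into the same
   strip as [d]. *)
have [sub str] := sC (T d); have [sk _] := str.
have h := (horizontal_strip1 sk).1 str.
have dS := TP d; have cS := TP c; rewrite (val_inj Tcd : T c = T d) in cS.
case Ed : (val d).1 lt => [//|r] lt; rewrite [val d]surjective_pairing Ed in dS.
have /negP := h _ _ dS; apply; rewrite [val c]surjective_pairing in cS.
by apply: (skew_convex sk cS dS); rewrite ?E ?leqnn // -ltnS lt leqnSn.
Qed.

End Tableaux.

(** Any q is allowed, since single squares have spin 0; the value q = 1 is the one used later. *)
Lemma schur_ribbonG (K : comNzRingType) (q : K) (la : young) :
  schur K la = ribbonG q 1 la young0.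
Proof.
apply: functional_extensionality_dep => N; rewrite /schur /ribbonG.
have sE (C : chain la N) : `[< is_ribbon_tableau 1 young0 C >] =
    (C \in [set to_chain T | T in [set T : {ffun la -> 'I_N} | `[< is_ssyt T >]]]).
  apply/asboolP/imsetP => [/tableau_to_chain[T sT ->]|[T]].
    by exists T => //; rewrite inE; apply/asboolP.
  by rewrite inE => /asboolP sT ->; apply: to_chain_tableau.
rewrite (eq_bigl _ _ sE) big_imset /=; last by move=> T T' _ _; apply: to_chain_inj.
apply: eq_big => [T|T /asboolP sT]; first by rewrite inE.
have [_ _ _ strips] := to_chain_tableau sT.
have stats i := tiling1_stats (strip_tilingP (strips i).2).1.
have -> : tableau_spin 1 (to_chain T) = 0%N.
  by rewrite /tableau_spin big1 // => i _; have [_ ->] := stats i.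
rewrite expr0 scale1r /tableau_weight mpolyXE_id.
rewrite (partition_big (fun c : la => T c) predT) //=; apply: eq_bigr => i _.
rewrite (eq_bigr (fun _ => 'X_i)) => [|c /eqP -> //].
rewrite prodr_const mnmE; congr (_ ^+ _).
have [-> _] := stats i.
pose s := [seq val c | c <- enum [pred c : la | T c == i]].
have -> : chain_step (to_chain T) i = [fset x in s].
  apply/fsetP => x; rewrite [in RHS]in_fset /s.
  apply/idP/mapP => [xS|[c]]; last by rewrite mem_enum inE => Tc ->; rewrite mem_chain_step.
  have xla := fsubsetP (chain_step_sub _ _) _ xS.
  by exists [` xla]; rewrite // mem_enum inE -mem_chain_step.
by rewrite card_fseq undup_id ?size_map ?cardE // map_inj_uniq ?enum_uniq //; apply: val_inj.
Qed.

Section SchurLead.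
Variables (K : fieldType) (la : young) (N : nat).
Implicit Types (T : {ffun la -> 'I_N}).

Definition ssyt_weight T : 'X_{1..N} := [multinom #|[pred c : la | T c == i]| | i < N].

Lemma schur_weightE : schur K la N =
  \sum_(T : {ffun la -> 'I_N} | `[< is_ssyt T >]) 'X_[ssyt_weight T].
Proof.
apply: eq_bigr => T _; rewrite mpolyXE_id.
rewrite (partition_big (fun c : la => T c) predT) //=; apply: eq_bigr => i _.
rewrite (eq_bigr (fun _ => 'X_i)) => [|c /eqP -> //].
by rewrite prodr_const mnmE.
Qed.

Lemma ssyt_row T (c : la) : is_ssyt T -> ((val c).1 <= T c)%N.
Proof.
move=> sT; case: c => -[r s] rsla /=.
elim: r rsla => // r IH rsla.
have /allP/(_ _ rsla)/andP[/= u _] := diagramP la.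
have [_ /(_ erefl (leqnn _))] := sT [` u] [` rsla].
exact: leq_ltn_trans (IH u).
Qed.

Lemma sum_ssyt_weight T (F : nat -> nat) :
  (\sum_(i < N) ssyt_weight T i * F i = \sum_(c : la) F (T c))%N.
Proof.
rewrite [RHS](partition_big (fun c : la => T c) predT) //=; apply: eq_bigr => i _.
rewrite (eq_bigr (fun _ => F i)) => [|c /eqP -> //].
by rewrite sum_nat_const mnmE.
Qed.

Lemma mdeg_ssyt_weight T : mdeg (ssyt_weight T) = #|` la|.
Proof.
rewrite mdegE cardfE -sum1_card -(sum_ssyt_weight T (fun _ => 1%N)).
by apply: eq_bigr => i _; rewrite muln1.
Qed.

Lemma msize_schur : (msize (schur K la N) <= #|` la|.+1)%N.
Proof.
rewrite schur_weightE; apply: leq_trans (msize_sum _ _ _) _.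
by apply/bigmax_leqP => T _; rewrite msizeX mdeg_ssyt_weight.
Qed.

Hypothesis laN : forall c : la, ((val c).1 < N)%N.

Definition row_filling : {ffun la -> 'I_N} := [ffun c => Ordinal (laN c)].

Lemma row_filling_ssyt : is_ssyt row_filling.
Proof. by move=> c d; rewrite !ffunE /=; split=> // ->. Qed.

(** An entry is at least its row index, so [T] has no more entries up to [i] than the row filling.
    At the first index where the weights differ, [T] therefore cannot have more. *)
Lemma ssyt_weight_le T : is_ssyt T -> (ssyt_weight T <= ssyt_weight row_filling)%O.
Proof.
move=> sT; rewrite leNgt; apply/negP => /ltmcP[|i eq lt].
  by rewrite !mdeg_ssyt_weight.
pose F j := nat_of_bool (j <= i)%N.
have : (\sum_(j < N) ssyt_weight T j * F j <=
        \sum_(j < N) ssyt_weight row_filling j * F j)%N.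
  rewrite !sum_ssyt_weight; apply: leq_sum => c _; rewrite /F ffunE /=.
  by have := ssyt_row c sT; case: (leqP (T c) i) => // h1 h2; rewrite (leq_trans h2 h1).
apply/negP; rewrite -ltnNge (bigD1 i) //= [X in (_ < X)%N](bigD1 i) //=.
rewrite /F leqnn !muln1 -addSn leq_add // leq_sum // => j ji.
case: (leqP j i) => jle; last by rewrite !muln0.
rewrite eq //; move: ji; rewrite -val_eqE /= => ji.
by rewrite ltn_neqAle ji.
Qed.

Lemma ssyt_weight_eq T : is_ssyt T -> ssyt_weight T = ssyt_weight row_filling ->
  T = row_filling.
Proof.
move=> sT E; have S : (\sum_(c : la) (val c).1 = \sum_(c : la) T c)%N.
  rewrite -(sum_ssyt_weight T id) E (sum_ssyt_weight row_filling id).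
  by apply: eq_bigr => c _; rewrite ffunE.
have [_ /esym] := leqif_sum (fun (c : la) (_ : true) => leqif_geq (ssyt_row c sT)).
rewrite S eqxx => /fintype.forallP h; apply/ffunP => c; apply: val_inj.
rewrite ffunE /=; apply/eqP; rewrite eqn_leq (ssyt_row c sT) andbT.
exact: h.
Qed.

Lemma mcoeff_schur_lead : (schur K la N)@_(ssyt_weight row_filling) = 1.
Proof.
rewrite schur_weightE raddf_sum /= (bigD1 row_filling) /=; last first.
  by apply/asboolP/row_filling_ssyt.
rewrite mcoeffX eqxx big1 ?addr0 // => T /andP[/asboolP sT ne].
rewrite mcoeffX; case: eqP => // E; case/eqP: ne.
exact: ssyt_weight_eq.
Qed.

Lemma msupp_schur m : m \in msupp (schur K la N) ->
  (m <= ssyt_weight row_filling)%O.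
Proof.
rewrite mcoeff_msupp schur_weightE raddf_sum /= => h.
apply: contraNT h => mle; rewrite big1 // => T /asboolP sT.
by rewrite mcoeffX; case: eqP => // E; rewrite -E ssyt_weight_le in mle.
Qed.

End SchurLead.

Section SchurSpan.
Variable K : fieldType.

Lemma schur_symfun (la : young) : is_symfun (schur K la).
Proof.
rewrite (@schur_ribbonG K 1); apply: ribbonG_symfun => //; exact: oner_neq0.
Qed.

Definition schurf (la : young) : symfun K := SymFun (asboolT (schur_symfun la)).

Definition rows_of N (m : 'X_{1..N}) : {fset cell} :=
  [fset c in [seq (i, j) | i <- iota 0 N, j <- iota 0 (mdeg m)] |
    (c.2 < nth 0 m c.1)%N].

Lemma mem_rows_of N (m : 'X_{1..N}) (i : 'I_N) j :
  ((i : nat, j) \in rows_of m) = (j < m i)%N.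
Proof.
have -> : m i = nth 0%N m i by rewrite (mnm_nth 0%N).
rewrite !inE /=; apply/andP/idP => [[]//|h]; split=> //.
apply/allpairsP; exists (i : nat, j); rewrite !mem_iota /= add0n; split=> //.
rewrite add0n (leq_trans h) // mdegE (bigD1 i) //=.
by rewrite (mnm_nth 0%N) leq_addr.
Qed.

Lemma rows_of_lt N (m : 'X_{1..N}) c : c \in rows_of m -> (c.1 < N)%N.
Proof.
by rewrite !inE /= => /andP[/allpairsP[[i j] /= []]]; rewrite mem_iota => /andP[_ h] _ ->.
Qed.

Lemma rows_of_diagram N (m : 'X_{1..N}) :
  (forall i j : 'I_N, (i <= j)%N -> (m j <= m i)%N) -> is_diagram (rows_of m).
Proof.
move=> mono; apply/allP => -[r s] h; have rN := rows_of_lt h; rewrite /= in rN *.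
have rN' : (r.-1 < N)%N by apply: leq_ltn_trans rN; apply: leq_pred.
have memr a b (aN : (a < N)%N) : ((a, b) \in rows_of m) = (b < m (Ordinal aN))%N.
  by rewrite -mem_rows_of.
rewrite (memr _ _ rN) in h; rewrite (memr _ _ rN') (memr _ _ rN).
rewrite (leq_trans h) ?mono ?leq_pred //=.
by apply: leq_ltn_trans h; apply: leq_pred.
Qed.

Lemma row_filling_weight N (m : 'X_{1..N}) (dm : is_diagram (rows_of m))
    (h : forall c : Young dm, ((val c).1 < N)%N) :
  ssyt_weight (row_filling h) = m.
Proof.
apply/mnmP => i; rewrite mnmE -[RHS](size_iota 0).
have inj : injective (fun c : Young dm => val c) by apply: val_inj.
pose s := [seq (i : nat, j) | j <- iota 0 (m i)].
transitivity (size s); last by rewrite size_map !size_iota.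
rewrite cardE -(size_map (fun c : Young dm => val c)); apply: perm_size.
apply: uniq_perm; first by rewrite map_inj_uniq ?enum_uniq.
  by rewrite map_inj_uniq ?iota_uniq // => a b [].
move=> x; apply/mapP/mapP => [[c]|[j]].
  rewrite mem_enum inE ffunE -val_eqE /= => /eqP ci ->.
  exists (val c).2; last by rewrite -ci -surjective_pairing.
  rewrite mem_iota /= add0n -mem_rows_of -ci -surjective_pairing.
  exact: fsvalP.
rewrite mem_iota add0n /= -mem_rows_of => hj ->.
by exists [` hj] => //; rewrite mem_enum inE ffunE -val_eqE.
Qed.

(** The leading exponent of a symmetric polynomial is a partition, whose Schur polynomial has the
    same leading monomial with coefficient 1; subtract and repeat. The bound on the sizes allows the
    resulting combination to be compared in all numbers of variables. *)
Lemma sym_schur_span N D (p : {mpoly K[N]}) : p \is symmetric ->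
  (msize p <= D)%N -> exists2 s : seq (K * young),
    all (fun x => #|` diagram x.2| < D)%N s & p = \sum_(x <- s) x.1 *: schur K x.2 N.
Proof.
elim/mleadrect: p => p IH sp szp.
have [->|p0] := eqVneq p 0; first by exists [::]; rewrite ?big_nil.
pose m := mlead p; have dm := rows_of_diagram (mlead_msym_sorted sp).
pose la := Young dm; have laN (c : la) : ((val c).1 < N)%N.
  by apply: (@rows_of_lt _ m); apply: fsvalP.
have wE : ssyt_weight (row_filling laN) = m by apply: row_filling_weight.
have cardla : #|` la| = mdeg m by rewrite -wE mdeg_ssyt_weight.
have mp : m \in msupp p by apply: mlead_supp.
have laD : (#|` la| < D)%N.
  by rewrite cardla (leq_trans (msize_mdeg_lt mp)).
have [ss _ _] := schur_symfun la.
pose p' := p - p@_m *: schur K la N.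
have sp' : p' \is symmetric.
  by apply: rpredB => //; apply: rpredZ; apply: ss.
have szp' : (msize p' <= D)%N.
  apply: msizeD_bound => //; rewrite msizeN (leq_trans (msizeZ_le _ _)) //.
  exact: leq_trans (msize_schur K la N) laD.
have lead' : p' = 0 \/ (mlead p' < m)%O.
  have [->|p'0] := eqVneq p' 0; [by left | right].
  have m'p : mlead p' \in msupp p' by apply: mlead_supp.
  rewrite lt_neqAle; apply/andP; split.
    apply: contraTneq m'p => ->; rewrite mcoeff_msupp negbK /p' mcoeffB mcoeffZ.
    by rewrite -{3}wE mcoeff_schur_lead mulr1 subrr.
  rewrite leNgt; apply: contraTN m'p => lt.
  rewrite mcoeff_msupp negbK /p' mcoeffB mcoeffZ mcoeff_gt_mlead // sub0r.
  rewrite oppr_eq0; apply/eqP; case: (boolP (mlead p' \in msupp (schur K la N))).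
    move=> /(msupp_schur laN); rewrite wE => /(lt_le_trans lt).
    by rewrite ltxx.
  by rewrite -mcoeff_eq0 => /eqP ->; rewrite mulr0.
have [s sD sE] : exists2 s : seq (K * young),
    all (fun x => #|` diagram x.2| < D)%N s & p' = \sum_(x <- s) x.1 *: schur K x.2 N.
  by case: lead' => [->|lt]; [exists [::]; rewrite ?big_nil | apply: IH].
exists ((p@_m, la) :: s); first by rewrite /= laD.
by rewrite big_cons -sE /p' addrC subrK.
Qed.

Lemma symfun_sumE (I : Type) (s : seq I) (F : I -> symfun K) N :
  symfun_val (\sum_(i <- s) F i) N = \sum_(i <- s) symfun_val (F i) N.
Proof.
elim: s => [|i s IH]; rewrite ?big_nil // !big_cons -IH.
exact: symfun_addE.
Qed.

Lemma schur_span (f : symfun K) : exists s : seq (K * young),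
  f = \sum_(x <- s) x.1 *: schurf x.2.
Proof.
have [sf cf [D df]] := symfunP f.
have [s sD sE] := sym_schur_span (sf D) (df D); exists s.
pose g := \sum_(x <- s) x.1 *: schurf x.2.
have gE N : symfun_val g N = \sum_(x <- s) x.1 *: schur K x.2 N.
  by rewrite /g symfun_sumE; apply: eq_bigr => x _; apply: symfun_scaleE.
have [sg cg _] := symfunP g.
have dg N : (msize (symfun_val g N) <= D)%N.
  rewrite gE; elim: s sD {sE g gE sg cg} => [|x s IH] /=.
    by rewrite big_nil msize0.
  move=> /andP[xD sD]; rewrite big_cons; apply: msizeD_bound; last exact: IH.
  rewrite (leq_trans (msizeZ_le _ _)) //.
  exact: leq_trans (msize_schur K x.2 N) xD.
apply: symfun_ext => N; apply/eqP; rewrite -subr_eq0; apply/eqP.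
apply: (@symfun_eq0 _ (fun N => symfun_val f N - symfun_val g N) D) => [M|M|M|].
- by apply: rpredB; [apply: sf | apply: sg].
- rewrite -(cf M) -(cg M) /drop_last.
  exact: (rmorphB (mmap (@mpolyC M K) (fun i : 'I_M.+1 =>
     if unlift ord_max i is Some j then 'X_j else 0))).
- by apply: msizeD_bound; rewrite ?msizeN.
- by rewrite gE sE subrr.
Qed.

End SchurSpan.

(** * The substitution of the inverse of q *)

Section Bar.
Variable R : realType.
Local Notation Cq := (Cq R).
Local Notation q := (q R).

Lemma frac_numden (a : Cq) : a = tofrac \n_(repr a) / tofrac \d_(repr a).
Proof.
have d0 : tofrac \d_(repr a) != 0 :> Cq by rewrite tofrac_eq0 denom_ratioP.
apply: (canRL (mulfK d0)); rewrite -{1}[a]reprK.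
move: (repr a) => x; unlock tofrac.
rewrite -[LHS]FracField.pi_mul; apply/eqmodP; rewrite /= FracField.equivfE.
rewrite /FracField.mulf !numden_Ratio ?mulf_neq0 ?oner_eq0 ?denom_ratioP //.
by rewrite !mulr1 mulrC.
Qed.

HB.instance Definition _ := GRing.RMorphism.copy (@constq R) (@tofrac _ \o polyC).

Lemma eval_invqD p r : eval_invq (p + r) = eval_invq p + eval_invq r :> Cq.
Proof. by rewrite /eval_invq rmorphD hornerD. Qed.

Lemma eval_invqM p r : eval_invq (p * r) = eval_invq p * eval_invq r :> Cq.
Proof. by rewrite /eval_invq rmorphM hornerM. Qed.

Lemma eval_invqN p : eval_invq (- p) = - eval_invq p :> Cq.
Proof. by rewrite /eval_invq rmorphN hornerN. Qed.

Lemma eval_invqC c : eval_invq c%:P = constq c :> Cq.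
Proof. by rewrite /eval_invq map_polyC hornerC. Qed.

Lemma eval_invqX : eval_invq 'X = q^-1.
Proof. by rewrite /eval_invq map_polyX hornerX. Qed.

Lemma horner_map_constq (p : {poly R[i]}) : (map_poly (@constq R) p).[q] = tofrac p.
Proof.
rewrite -[map_poly _ p]/(map_poly (@tofrac _ \o polyC) p) map_poly_comp.
by rewrite horner_map -/(p \Po 'X) comp_polyXr.
Qed.

Lemma q_neq0 : q != 0.
Proof. by rewrite /q tofrac_eq0 polyX_eq0. Qed.

Lemma eval_invq_neq0 (p : {poly R[i]}) : p != 0 -> eval_invq p != 0 :> Cq.
Proof.
move=> p0; have [s sE] : exists s, size p = s.+1.
  by exists (size p).-1; rewrite prednK // lt0n size_poly_eq0.
(* The polynomial with reversed coefficients; its constant term is the leading coefficient of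
   [p]. *)
pose r := \sum_(i < s.+1) p`_i *: 'X^(s - i).
have E : q ^+ s * eval_invq p = tofrac r.
  rewrite /eval_invq horner_coef size_map_poly sE mulr_sumr rmorph_sum.
  apply: eq_bigr => i _; rewrite coef_map /= -mul_polyC rmorphM rmorphXn mulrCA.
  congr (_ * _); rewrite exprVn expfB_cond ?(negbTE q_neq0) //.
  by rewrite add0n -ltnS.
have : tofrac r != 0 :> Cq.
  rewrite tofrac_eq0; apply: contraNneq p0 => r0.
  have := congr1 (fun g : {poly R[i]} => g`_0) r0.
  rewrite coef0 /r coef_sum big_ord_recr /= coefZ coefXn subnn eqxx mulr1 big1.
    by rewrite add0r -lead_coef_eq0 lead_coefE sE /= => ->.
  move=> i _; rewrite coefZ coefXn; case: eqP => [/esym/eqP|_]; last by rewrite mulr0.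
  by rewrite subn_eq0 leqNgt ltn_ord.
by rewrite -E mulf_eq0 negb_or => /andP[].
Qed.

(** Independence of [bar] from the representative, by cross-multiplication. *)
Lemma bar_frac (p s : {poly R[i]}) : s != 0 ->
  bar (tofrac p / tofrac s) = eval_invq p / eval_invq s :> Cq.
Proof.
move=> s0; rewrite /bar; set a := tofrac p / tofrac s.
have := frac_numden a; set m := \n_(repr a); set d := \d_(repr a) => aE.
have d0 : d != 0 by apply: denom_ratioP.
have E : p * d = m * s.
  apply/eqP; rewrite -tofrac_eq !tofracM; apply/eqP.
  apply/eqP; rewrite -eqr_div ?tofrac_eq0 //; apply/eqP.
  by rewrite -aE.
apply/eqP; rewrite eqr_div ?eval_invq_neq0 //; apply/eqP.
by rewrite -!eval_invqM -E mulrC.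
Qed.

Lemma bar_tofrac p : bar (tofrac p) = eval_invq p :> Cq.
Proof.
rewrite -[tofrac p]divr1 -tofrac1 bar_frac ?oner_eq0 //.
by rewrite -[1]/(1%:P) eval_invqC rmorph1 divr1.
Qed.

Lemma bar_is_zmod_morphism : zmod_morphism (@bar R).
Proof.
move=> a b; rewrite (frac_numden a) (frac_numden b).
have da := denom_ratioP (repr a); have db := denom_ratioP (repr b).
have ea := eval_invq_neq0 da; have eb := eval_invq_neq0 db.
rewrite -mulNr -tofracN addf_div ?tofrac_eq0 // -!tofracM -tofracD.
rewrite !bar_frac ?mulf_neq0 // eval_invqD !eval_invqM eval_invqN.
by rewrite -addf_div // mulNr.
Qed.

Lemma bar_is_monoid_morphism : monoid_morphism (@bar R).
Proof.
split=> [|a b].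
  by rewrite -tofrac1 bar_tofrac -[1]/(1%:P) eval_invqC rmorph1.
rewrite (frac_numden a) (frac_numden b).
have da := denom_ratioP (repr a); have db := denom_ratioP (repr b).
rewrite mulf_div -!tofracM !bar_frac ?mulf_neq0 // !eval_invqM.
by rewrite -mulf_div.
Qed.

HB.instance Definition _ := GRing.isZmodMorphism.Build Cq Cq (@bar R)
  bar_is_zmod_morphism.
HB.instance Definition _ := GRing.isMonoidMorphism.Build Cq Cq (@bar R)
  bar_is_monoid_morphism.

Lemma bar_constq c : bar (constq c) = constq c :> Cq.
Proof. by rewrite bar_tofrac eval_invqC. Qed.

Lemma bar_q : bar q = q^-1.
Proof. by rewrite bar_tofrac eval_invqX. Qed.

Lemma bar_eval_invq p : bar (eval_invq p) = tofrac p :> Cq.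
Proof.
rewrite /eval_invq.
transitivity (map_poly (@bar R) (map_poly (@constq R) p)).[bar q^-1].
  by rewrite horner_map.
have -> : bar q^-1 = q.
  by transitivity ((bar q)^-1); [apply: fmorphV | rewrite bar_q invrK].
rewrite -horner_map_constq.
congr (_.[_]); rewrite -map_poly_comp; apply: eq_map_poly => c /=.
exact: bar_constq.
Qed.

Lemma barK : involutive (@bar R).
Proof.
move=> a; set n := \n_(repr a); set d := \d_(repr a).
have aE : a = tofrac n / tofrac d := frac_numden a.
have -> : bar a = eval_invq n / eval_invq d.
  by rewrite aE bar_frac // denom_ratioP.
transitivity (bar (eval_invq n) / bar (eval_invq d)); first exact: fmorph_div.
by rewrite !bar_eval_invq -aE.
Qed.

Lemma Cq_char0 : injective (fun k : nat => k%:R : Cq).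
Proof.
move=> i j /= /eqP; rewrite -!(rmorph_nat (@tofrac _)) tofrac_eq -!polyC_natr.
by rewrite (inj_eq polyC_inj) eqr_nat => /eqP.
Qed.

End Bar.

Lemma young_ext (la mu : young) : (la : {fset cell}) = mu -> la = mu.
Proof.
case: la mu => [D dD] [D' dD'] /= E; subst D'; congr Young; exact: bool_irrelevance.
Qed.

Lemma transposeK (S : {fset cell}) : transpose (transpose S) = S.
Proof. by apply/fsetP => -[i j]; rewrite !mem_transpose. Qed.

Lemma conjugateK (la : young) : conjugate (conjugate la) = la.
Proof. by apply: young_ext; apply: transposeK. Qed.

Lemma conjugate_young0 : conjugate young0 = young0.
Proof.
by apply: young_ext; apply/fsetP => -[i j]; rewrite mem_transpose !in_fset0.
Qed.

Lemma card_transpose (S : {fset cell}) : #|` transpose S| = #|` S|.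
Proof. by rewrite /transpose card_imfset // => -[a b] [c d] [-> ->]. Qed.

Section OmegaSchur.
Variables (K : fieldType) (bar : {rmorphism K -> K}).
Hypothesis char0 : injective (fun k : nat => k%:R : K).
Variables (q : K) (n : nat).

Lemma schur_at_point (la : young) N (c : K) :
  at_point (@mpolyC N K) [seq x * c%:MP | x <- vars K N] (schur K la N) =
  c ^+ #|` la| *: schur K la N.
Proof.
rewrite /schur rmorph_sum scaler_sumr; apply: eq_bigr => T _.
rewrite rmorph_prod cardfE -mul_mpolyC rmorphXn /= -prodr_const -big_split /=.
apply: eq_bigr => x _; rewrite /at_point mmapX mmap1U.
rewrite (nth_map 0) ?size_vars // mulrC; congr (_ * _).
by rewrite (nth_map (T x)) ?size_enum_ord // nth_ord_enum.
Qed.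

(** After [omega_atE] only the scaled variables remember q and n, so the argument for ribbon
    functions applies with n = 1 and q = 1 at these variables. Homogeneity of the Schur function
    then extracts the power of q. *)
Lemma omega_schur (la : young) :
  omega bar q n (schurf K la) = q ^+ (n.-1 * #|` la|) *: schurf K (conjugate la).
Proof.
have bla := @in_box_size la; have lt01 : (0 < 1)%N by [].
have o1 : bar 1 = 1^-1 by rewrite rmorph1 invr1.
have sub0 (mu : young) : young0 `<=` mu by apply: fsub0set.
have fE N : fam (gfam 1 1 (bits (box_size la) la) (bits (box_size la) young0)) N =
    evars N (expr_of (schurf K la)).
  rewrite -(ribbonG_fam 1 lt01 bla (sub0 la)) -schur_ribbonG.
  exact: (expr_ofE (schurf K la) N).
apply: symfun_ext => N; rewrite /omega omega_atE.
rewrite (peval_hvars_ribbon char0 lt01 (oner_neq0 K) o1 _ fE).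
set Z := [seq _ | x <- vars K N].
(* A trivial scaling that puts the list into the form required by [addops_conj] for n = 1, q = 1. *)
have ZE : Z = [seq y * (1 ^+ 1.-1)%:MP | y <- Z].
  by rewrite -[LHS]map_id; apply: eq_map => y; rewrite expr0 mulr1.
rewrite [X in foldr _ _ X _]ZE -(addops_conj lt01 (oner_neq0 K)) // conjugate_young0.
have bla' : in_box (box_size la) (conjugate la) by apply: in_box_transpose.
pose f : {rmorphism {mpoly K[N]} -> {mpoly K[N]}} := @at_point K N _ (@mpolyC N K) Z.
have H : f (schur K (conjugate la) N) = addops (f 1%:MP) 1 (map f (vars K N))
    (delta _ (bits (box_size la) (conjugate la))) (bits (box_size la) young0).
  rewrite (schur_ribbonG 1) (ribbonG_fam 1 lt01 bla' (sub0 _)).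
  exact: natural_gfam.
have V : map f (vars K N) = Z by apply: at_point_vars; rewrite size_map size_vars.
rewrite V rmorph1 in H; rewrite -[(1%:MP)]/(1 : {mpoly K[N]}) -H.
transitivity ((q ^+ n.-1) ^+ #|` conjugate la| *: schur K (conjugate la) N).
  exact: schur_at_point.
by rewrite -exprM card_transpose.
Qed.

End OmegaSchur.

Theorem theorem33 (R : realType) (n : nat) (hn : (1 <= n)%N) :
  exists w : Lambdaq R -> Lambdaq R,
    [/\ is_omega n w,
        forall w' : Lambdaq R -> Lambdaq R, is_omega n w' -> w' =1 w,
        C_algebra_hom w,
        involutive w
      & forall la mu : young, fsubset mu la ->
          maps_to w (ribbonG (q R) n la mu)
                    (ribbonG (q R) n (conjugate la) (conjugate mu))].
Proof.
pose w : Lambdaq R -> Lambdaq R := omega (@bar R) (q R) n.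
have wD f g : w (f + g) = w f + w g by apply: omegaD; apply: Cq_char0.
have wZ a f : w (a *: f) = bar a *: w f by apply: omegaZ; apply: Cq_char0.
have w1 : w 1 = 1 by apply: omega1; apply: Cq_char0.
have wM f g : w (f * g) = w f * w g by apply: omegaM; apply: Cq_char0.
have wC : C_linear w by move=> c f g; rewrite wD wZ bar_constq.
have wS la : w (schurf _ la) =
    q R ^+ ((n - 1) * #|` diagram la|) *: schurf _ (conjugate la).
  by rewrite subn1; apply: omega_schur; apply: Cq_char0.
have hw : is_omega n w.
  split; first by split.
    by rewrite wZ w1 bar_q.
  move=> la; exists (schurf _ la), (q R ^+ ((n - 1) * #|` diagram la|) *: schurf _ (conjugate la)).
  by split.
have lin0 (u : Lambdaq R -> Lambdaq R) : C_linear u -> u 0 = 0.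
  move=> uC; have := uC 1 0 0; rewrite rmorph1 !scale1r addr0 => E.
  by apply: (addrI (u 0)); rewrite -E addr0.
have linD (u : Lambdaq R -> Lambdaq R) : C_linear u -> forall f g, u (f + g) = u f + u g.
  by move=> uC f g; have := uC 1 f g; rewrite rmorph1 !scale1r.
(* Schur functions span over the field of rational functions while [u] and [v] are only linear over
   the complex numbers, so all multiples by [a] are compared. *)
have spanE (u v : Lambdaq R -> Lambdaq R) : C_linear u -> C_linear v ->
    (forall a la, u (a *: schurf _ la) = v (a *: schurf _ la)) -> u =1 v.
  move=> uC vC E f; have [s ->] := schur_span f.
  elim: s => [|x s IH]; first by rewrite !big_nil !lin0.
  by rewrite !big_cons !linD // IH E.
exists w; split=> //.
- move=> w' [[w'C w'Z] _ w'S]; apply: spanE => // a la.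
  rewrite w'Z wZ; congr (_ *: _).
  have [f [g [fE gE wE]]] := w'S la.
  have <- : f = schurf _ la by apply: val_inj.
  rewrite wE; have -> : f = schurf _ la by apply: val_inj.
  by rewrite wS; apply: val_inj.
- apply: spanE => [c f g|c f g|a la] //.
    by rewrite !wC.
  (* The second application conjugates the power of q produced by the first and multiplies by the
     same power, as conjugate diagrams have equal size. *)
  rewrite !wZ barK wS wZ wS conjugateK card_transpose !scalerA.
  rewrite rmorphXn /= (_ : bar (q R) = (q R)^-1); last exact: bar_q.
  by rewrite exprVn -mulrA mulVf ?mulr1 // expf_neq0 ?q_neq0.
- move=> la mu sub.
  have sub' : conjugate mu `<=` conjugate la by apply: sub_transpose.
  exists (SymFun (asboolT (ribbonG_symfun hn (q_neq0 R) sub))),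
         (SymFun (asboolT (ribbonG_symfun hn (q_neq0 R) sub'))).
  split=> //.
  by apply: (omega_ribbonG _ hn _ (bar_q R) sub) => //; [apply: Cq_char0 | apply: q_neq0].
Qed.
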